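(* Assume that, for some $\beta_0\in(0,\beta_c)$, one connected component $\omega$ of the superconductivity set $SC_{\beta_0}$ is such that $V_{\beta_0}$ takes the same value on each connected component of $\partial\omega$ (i.e. $V_{\beta_0}$ is equal to one and the same constant on all of $\partial\omega$). Then there exists $\delta>0$ such that $$SC_\beta\cap\overline\omega=SC_{\beta_0}\cap\overline\omega=\omega\qquad\text{for all }\beta\in(\beta_0-\delta,\beta_0].$$
   Context: $\mathcal M\subset\mathbb R^3$ is a smooth compact embedded surface homeomorphic to $\mathbb S^2$ with the induced metric; $\nabla$, $\Delta$ and integrals refer to this metric. $f:\mathcal M\to\mathbb R$ is a given non-constant function (in the application $f=*F$ for a 2-form $F$ on $\mathcal M$), and $H:=\Delta f$ is assumed to belong to $C^1(\mathcal M)$. Set $\beta_c:=\max_{\mathcal M}f-\min_{\mathcal M}f>0$. For $0<\beta\le\beta_c$, $V_\beta$ denotes the unique solution of the two-sided obstacle problem $$\min\Big\{\int_{\mathcal M}\big(|\nabla V|^2+2HV\big):V\in H^1(\mathcal M),\ |V|\le\beta/2\Big\};$$ it is of class $C^1$. The superconductivity region is $SC_\beta:=\{x\in\mathcal M:|V_\beta(x)|<\beta/2\}$. Since $SC_\beta$ is defined only for $\beta>0$, $\delta$ is understood to satisfy $\delta\le\beta_0$. *)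

(* Defs.v *)
From HB Require Import structures.
From mathcomp Require Import all_boot all_order all_algebra.
From mathcomp Require Import all_classical all_reals all_analysis.
Set Implicit Arguments.
Unset Strict Implicit.
Unset Printing Implicit Defensive.
Import Order.TTheory GRing.Theory Num.Theory.
Import numFieldNormedType.Exports.
Local Open Scope classical_set_scope.
Local Open Scope ring_scope.

Section CalculusInThePlane.
Context {R : realType}.

Definition basis2 (i : 'I_2) : R * R := if i == ord0 then (1, 0) else (0, 1).

Definition pd {W : normedModType R} (i : 'I_2) (f : R * R -> W) : R * R -> W :=
  fun p => 'D_(basis2 i) f p.

Fixpoint Ck {W : normedModType R} (k : nat) (U : set (R * R))
    (f : R * R -> W) : Prop :=
  (forall p, U p -> {for p, continuous f}) /\
  match k with
  | 0 => True
  | k'.+1 => forall i : 'I_2,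
      (forall p, U p -> derivable f p (basis2 i)) /\ Ck k' U (pd i f)
  end.

Definition smooth {W : normedModType R} (U : set (R * R)) (f : R * R -> W) :=
  forall k, Ck k U f.

Definition test_function (U : set (R * R)) (psi : R * R -> R) :=
  Ck 1 setT psi /\
  exists K : set (R * R),
    [/\ compact K, K `<=` U & forall p, ~ K p -> psi p = 0].

Definition lebesgue2 := (@lebesgue_measure R \x @lebesgue_measure R)%E.

End CalculusInThePlane.

Section Surfaces.
Context {R : realType}.
Local Notation E3 := 'rV[R]_3.

Definition dot (x y : E3) : R := \sum_i x 0 i * y 0 i.

Definition sphere2 : set E3 := [set x | dot x x = 1].

Definition homeomorphic (A B : set E3) :=
  exists h k : E3 -> E3,
    [/\ {within A, continuous h}, {within B, continuous k},
        set_fun A B h, set_fun B A k &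
        (forall x, A x -> k (h x) = x) /\ (forall y, B y -> h (k y) = y)].

(* The rows are the two coordinate tangent vectors. *)
Definition jac (phi : R * R -> E3) (p : R * R) : 'M[R]_(2, 3) :=
  \matrix_i pd i phi p.

Definition metric (phi : R * R -> E3) (p : R * R) : 'M[R]_2 :=
  jac phi p *m (jac phi p)^T.

Definition area_density (phi : R * R -> E3) (p : R * R) : R :=
  Num.sqrt (\det (metric phi p)).

(* Regular parametrization: a smooth immersion of an open subset of the plane
   that is a homeomorphism onto a relatively open subset of M. *)
Definition chart (M : set E3) (U : set (R * R)) (phi : R * R -> E3) :=
  [/\ open U, smooth U phi, set_inj U phi,
      forall p, U p -> row_free (jac phi p) &
      forall A, open A -> A `<=` U ->
        exists2 O : set E3, open O & phi @` A = M `&` O].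

Definition regular_surface (M : set E3) :=
  forall x, M x -> exists U phi, chart M U phi /\ (phi @` U) x.

Definition smooth_sphere (M : set E3) :=
  [/\ compact M, regular_surface M & homeomorphic M sphere2].

(* Functions on M are represented by total functions on R^3 of which only the
   values on M matter. *)
Definition CkM (k : nat) (M : set E3) (u : E3 -> R) :=
  forall U phi, chart M U phi -> Ck k U (u \o phi).

(* Laplace-Beltrami operator in local coordinates:
   |g|^(-1/2) d_i (|g|^(1/2) g^(ij) d_j u). *)
Definition laplace_chart (phi : R * R -> E3) (u : E3 -> R) (p : R * R) : R :=
  (area_density phi p)^-1 *
  \sum_i pd i (fun q => area_density phi q *
                 \sum_j (invmx (metric phi q)) i j * pd j (u \o phi) q) p.

Definition is_laplacian (M : set E3) (u h : E3 -> R) :=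
  forall U phi, chart M U phi ->
    forall p, U p -> h (phi p) = laplace_chart phi u p.

Definition borel3 := g_sigma_algebraType (@open E3).

(* These conditions determine the Riemannian area sigma uniquely, since M is
   covered by countably many charts. *)
Definition is_area_measure (M : set E3)
    (sigma : {measure set borel3 -> \bar R}) :=
  sigma (~` M) = 0%E /\
  forall U phi, chart M U phi ->
  forall A : set borel3, measurable A -> A `<=` phi @` U ->
    sigma A =
      (\int[lebesgue2]_(p in U `&` phi @^-1` A) (area_density phi p)%:E)%E.

Definition tangent_field (M : set E3) (G : E3 -> E3) :=
  forall U phi, chart M U phi ->
    forall p, U p -> (G (phi p) <= jac phi p)%MS.

(* The tangent field G is the weak gradient of u: in every chart the i-th weak
   partial derivative of u \o phi is <G, d_i phi>.  Test functions are C^1 with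
   compact support, as in Gilbarg-Trudinger. *)
Definition weak_gradient (M : set E3) (u : E3 -> R) (G : E3 -> E3) :=
  tangent_field M G /\
  forall U phi, chart M U phi ->
  forall psi, test_function U psi ->
  forall i : 'I_2,
    \int[lebesgue2]_(p in U) (u (phi p) * pd i psi p) =
    - \int[lebesgue2]_(p in U) (dot (G (phi p)) (pd i phi p) * psi p).

(* u is in H^1(M), with gradient G. G is unique almost everywhere, so energy
   and obstacle_solution do not depend on which G is taken. *)
Definition H1 (M : set E3) (sigma : {measure set borel3 -> \bar R})
    (u : E3 -> R) (G : E3 -> E3) :=
  [/\ measurable_fun (M : set borel3) (u : borel3 -> R),
      forall j, measurable_fun (M : set borel3)
                  ((fun x => G x 0 j) : borel3 -> R),
      sigma.-integrable M (fun x => (u x ^+ 2)%:E),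
      sigma.-integrable M (fun x => (dot (G x) (G x))%:E) &
      weak_gradient M u G].

Definition energy (M : set E3) (sigma : {measure set borel3 -> \bar R})
    (H u : E3 -> R) (G : E3 -> E3) : R :=
  \int[sigma]_(x in M) (dot (G x) (G x) + 2 * H x * u x).

Definition admissible (M : set E3) (sigma : {measure set borel3 -> \bar R})
    (beta : R) (u : E3 -> R) (G : E3 -> E3) :=
  H1 M sigma u G /\ {ae sigma, forall x, M x -> `|u x| <= beta / 2}.

Definition obstacle_solution (M : set E3)
    (sigma : {measure set borel3 -> \bar R}) (H : E3 -> R) (beta : R)
    (V : E3 -> R) :=
  exists2 G, admissible M sigma beta V G &
    forall W G', admissible M sigma beta W G' ->
      energy M sigma H V G <= energy M sigma H W G'.

Definition oscillation (M : set E3) (f : E3 -> R) : R :=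
  sup (f @` M) - inf (f @` M).

Definition SC (M : set E3) (beta : R) (V : E3 -> R) : set E3 :=
  [set x | M x /\ `|V x| < beta / 2].

Definition is_component (A w : set E3) :=
  exists2 x, A x & w = connected_component A x.

Definition boundary_in (M w : set E3) : set E3 :=
  M `&` closure w `&` closure (M `\` w).

End Surfaces.
Arguments borel3 : clear implicits.

(* Main.v *)
Require Import Defs.
From HB Require Import structures.
From mathcomp Require Import all_boot all_order all_algebra.
From mathcomp Require Import all_classical all_reals all_analysis.
From mathcomp Require Import measurable_realfun.
From mathcomp Require Import ring lra.
Set Implicit Arguments.
Unset Strict Implicit.
Unset Printing Implicit Defensive.
Import Order.TTheory GRing.Theory Num.Theory.
Import numFieldNormedType.Exports.
Local Open Scope classical_set_scope.
Local Open Scope ring_scope.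

(** Write V0 and V1 for the solutions with beta0 and beta <= beta0, and
d = (beta0 - beta) / 2.  The boundary of omega avoids the set where
|V0| < beta0 / 2, so the common boundary value is beta0 / 2 or - beta0 / 2.
In the first case V1 = V0 - d on omega as long as V0 - d stays above
- beta / 2 there, that is, as long as beta > beta0 - delta with
delta = min V0 + beta0 / 2 over the closure of omega.  This delta is positive
because V0 is above its lower obstacle in omega and equals beta0 / 2 on the
boundary.  On omega, V1 < beta / 2 then follows from V0 < beta0 / 2 and
V1 > - beta / 2 from the choice of delta, while V1 = beta / 2 on the boundary:
the region does not change.  The second case is the mirror image.

The equality V1 = V0 - d is two inequalities.  On all of M,
V0 - V1 <= d ([solution_comparison]); on omega, V1 - V0 <= - d
([component_comparison]), where the boundary value is used.  Both are instances
of the maximum principle [comparison] for w = u - v - k, with u and v solutions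
of two obstacle problems.  Let theta be the cube of the positive part of w,
cut off outside the set A of interest.  If v + t theta and u - t theta are
admissible for small t > 0, adding the two first variations gives
int 3 (w^+)^2 |D|^2 <= 0 over A, where D is the difference of the weak
gradients.  Hence w is locally constant where it is positive
([locally_constant]), and connectedness of M leaves two possibilities: w <= 0
on A, or A = M and w is a positive constant.

The second possibility is excluded by [not_in_contact]: a solution that stays
strictly below its upper obstacle solves the free equation, hence equals f up
to a constant, and oscillates by as much as f.  The oscillation of V is at most
beta <= beta0, which is less than that of f.  This also shows omega <> M.

Two facts carry the analysis.  The first is Green's identity
int <grad f, D> + H psi = 0 for psi of class C^1 with weak gradient D
([green]), obtained with a partition of unity: on a piece supported in
a chart it is the definition of D, tested against the components of
sqrt(det g) g^(-1) df times the cut-off.  The second is the chain rule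
[H1_chain]: the weak gradients of the solutions are only square integrable
fields, never identified with classical gradients.  The exponent 3 is chosen so that
the weak gradient of theta is a C^1 factor times D, and that factor can be moved into
the test function. *)

(** * Continuously differentiable functions in the plane *)

(** A linear approximation with error e |h| for every e is the little-o form of
differentiability. *)
Lemma frechet_differentiable (R : realType) (V W : normedModType R)
    (f : V -> W) (L : {linear V -> W}) (x : V) :
  continuous L ->
  (forall e : R, 0 < e ->
     \forall h \near (0 : V), `|f (h + x) - f x - L h| <= e * `|h|) ->
  differentiable f x /\ 'd f x = L :> (V -> W).
Proof.
move=> cL hf.
have oL : f \o shift x = cst (f x) + (L : V -> W) +o_ (0 : V) id.
  apply/eqaddoP => e e0; near=> h => /=.
  have -> : (f \o shift x - (cst (f x) + (L : V -> W))) h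
      = f (h + x) - f x - L h by rewrite !fctE /= opprD addrA.
  by near: h; exact: hf.
have E := diff_unique cL oL.
by split => //; apply/diff_locallyP; rewrite E.
Unshelve. all: by end_near.
Qed.

Section PlaneCalculus.
Context {R : realType}.
Implicit Types (U : set (R * R)) (g h : R * R -> R) (p : R * R).

Lemma ord2_cases (i : 'I_2) : i = ord0 \/ i = ord_max.
Proof. by case: i => [[|[|//]] Hi]; [left|right]; apply: val_inj. Qed.

Lemma basis20 : basis2 ord0 = (1, 0) :> R * R. Proof. by []. Qed.
Lemma basis21 : basis2 ord_max = (0, 1) :> R * R. Proof. by []. Qed.

Lemma is_derive_line0 g (t y : R) : derivable g (t, y) (basis2 ord0) ->
  is_derive t 1 (fun s : R => g (s, y)) (pd ord0 g (t, y)).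
Proof.
have E : (fun h : R => h^-1 *: ((g \o shift (t, y)) (h *: basis2 ord0) - g (t, y)))
  = (fun h : R => h^-1 *: (((fun s => g (s, y)) \o shift t) (h *: 1) - g (t, y))).
  apply/funext => h /=; congr (_ *: (g _ - _)).
  by rewrite basis20; congr (_, _) => /=; rewrite scaler0 add0r.
by move=> dg; split; [move: dg; rewrite /derivable E|rewrite /derive -E].
Qed.

Lemma is_derive_line1 g (t x : R) : derivable g (x, t) (basis2 ord_max) ->
  is_derive t 1 (fun s : R => g (x, s)) (pd ord_max g (x, t)).
Proof.
have E : (fun h : R => h^-1 *: ((g \o shift (x, t)) (h *: basis2 ord_max) - g (x, t)))
  = (fun h : R => h^-1 *: (((fun s => g (x, s)) \o shift t) (h *: 1) - g (x, t))).
  apply/funext => h /=; congr (_ *: (g _ - _)).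
  by rewrite basis21; congr (_, _) => /=; rewrite scaler0 add0r.
by move=> dg; split; [move: dg; rewrite /derivable E|rewrite /derive -E].
Qed.

(** The mean value inequality applied to F(t) - a t.  It is used twice: with a the
derivative at a point, to compare increments with partial derivatives, and with
a = e = 0, to see that a function with vanishing derivative is constant. *)
Lemma mvt_deviation (F dF : R -> R) (x y a e : R) :
  (forall t, Num.min x y <= t <= Num.max x y ->
     is_derive t 1 F (dF t) /\ `|dF t - a| <= e) ->
  `|F y - F x - (y - x) * a| <= e * `|y - x|.
Proof.
wlog xy : x y / x <= y => [hw|].
  case/orP: (le_total x y) => [/hw//|yx hF].
  rewrite -normrN (distrC y x).
  have -> : - (F y - F x - (y - x) * a) = F x - F y - (x - y) * a by ring.
  by apply: hw => // t; rewrite minC maxC; apply: hF.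
rewrite min_l// max_r// => hF.
have [||c cxy ->] := @MVT_segment R F dF x y xy.
- by move=> t; rewrite in_itv/= => /andP[xt ty]; apply: (hF t _).1; rewrite !ltW.
- apply: derivable_within_continuous => t; rewrite in_itv/= => txy.
  by have [] := (hF t txy).1.
have -> : dF c * (y - x) - (y - x) * a = (dF c - a) * (y - x) by ring.
by rewrite normrM ler_wpM2r//; move: cxy; rewrite in_itv/= => /hF[].
Qed.

Lemma open_box U p : open U -> U p ->
  exists2 r : R, 0 < r & forall q, `|q.1 - p.1| < r -> `|q.2 - p.2| < r -> U q.
Proof.
move=> oU Up; have /nbhs_ballP[r /= r0 Hr] := open_nbhs_nbhs (conj oU Up).
exists r => // -[q1 q2] /= h1 h2; apply: Hr; split => /=; rewrite /ball /=.
  by rewrite distrC.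
by rewrite distrC.
Qed.

Lemma cont_box g p (e : R) : {for p, continuous g} -> 0 < e ->
  exists2 r : R, 0 < r &
    forall q, `|q.1 - p.1| < r -> `|q.2 - p.2| < r -> `|g q - g p| <= e.
Proof.
move=> /cvgrPdist_le /[apply] /nbhs_ballP[r /= r0 Hr].
exists r => // -[q1 q2] /= h1 h2; rewrite distrC; apply: Hr.
by split => /=; rewrite /ball /= distrC.
Qed.

Lemma between_shift (x h t : R) :
  Num.min x (h + x) <= t <= Num.max x (h + x) -> `|t - x| <= `|h|.
Proof.
rewrite ge_min le_max => /andP[/orP[] A /orP[] B]; rewrite ler_norml;
  apply/andP; split; lra || (case: (ler0P h) => ?; lra).
Qed.

(** Continuous partial derivatives give Frechet differentiability: the increment
splits into a horizontal and a vertical step, and on each one the mean value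
inequality compares it with the partial derivative at the base point. *)
Lemma Ck1_differentiable U g p : open U -> Ck 1 U g -> U p -> differentiable g p.
Proof.
case: p => p1 p2 oU [_ dg] Up.
have [d0 [c0 _]] := dg ord0.
have [d1 [c1 _]] := dg ord_max.
pose L (h : R * R) := h.1 * pd ord0 g (p1, p2) + h.2 * pd ord_max g (p1, p2).
have linL : linear L.
  by move=> k [u1 u2] [v1 v2]; rewrite /L /= /GRing.scale /=; ring.
pose LL := GRing.isLinear.Build _ _ _ _ _ linL.
pose fL : {linear (R * R)%type -> R} := HB.pack L LL.
have cL : continuous (fL : (R * R)%type -> R).
  move=> q /=; rewrite /L.
  by apply: cvgD; apply: cvgM; [exact: cvg_fst|exact: cvg_cst|exact: cvg_snd|exact: cvg_cst].
apply: (frechet_differentiable cL _).1 => e e0.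
have e2 : 0 < e / 2 by rewrite divr_gt0.
have [r r0 Hr] := open_box oU Up.
have [r1 r10 Hr1] := cont_box (c0 _ Up) e2.
have [r2 r20 Hr2] := cont_box (c1 _ Up) e2.
have key (h : R * R) : `|h| < Num.min r (Num.min r1 r2) ->
    `|g (h + (p1, p2)) - g (p1, p2) - fL h| <= e * `|h|; last first.
  near=> h; apply: key; near: h; apply: (nbhs0_lt (V := (R * R)%type)).
  by rewrite !lt_min r0 r10 r20.
case: h => h1 h2 hr.
  have hm : `|(h1, h2)| = Num.max `|h1| `|h2| by [].
  have h1m : `|h1| <= `|(h1, h2)| by rewrite hm le_max lexx.
  have h2m : `|h2| <= `|(h1, h2)| by rewrite hm le_max lexx orbT.
  move: hr; rewrite !lt_min => /and3P[hr hr1 hr2].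
  have -> : fL (h1, h2) =
    h1 * pd ord0 g (p1, p2) + h2 * pd ord_max g (p1, p2) by [].
  have -> : ((h1, h2) + (p1, p2))%R = (h1 + p1, h2 + p2) :> R * R by [].
  have -> (a b x y : R) : a - b - (x + y) =
    (a - g (p1, h2 + p2) - x) + (g (p1, h2 + p2) - b - y) by ring.
  apply: le_trans (ler_normD (g (h1 + p1, h2 + p2) - g (p1, h2 + p2) - _) _) _.
  rewrite [leRHS](_ : _ = e / 2 * `|(h1, h2)| + e / 2 * `|(h1, h2)|);
    last by rewrite -mulrDl -splitr.
  apply: lerD.
    apply: (@le_trans _ _ (e / 2 * `|h1|)); last by rewrite ler_pM2l.
    have -> : h1 = (h1 + p1) - p1 by ring.
    rewrite [X in g (X, _) - g _]subrK.
    apply: (mvt_deviation (F := fun s => g (s, h2 + p2))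
      (dF := fun s => pd ord0 g (s, h2 + p2))) => t tb.
    have tb1 := between_shift tb.
    split.
      apply: is_derive_line0; apply: d0; apply: Hr => /=.
        exact: le_lt_trans (le_trans tb1 h1m) hr.
      by rewrite addrK; exact: le_lt_trans h2m hr.
    apply: Hr1 => /=; first exact: le_lt_trans (le_trans tb1 h1m) hr1.
    by rewrite addrK; exact: le_lt_trans h2m hr1.
  apply: (@le_trans _ _ (e / 2 * `|h2|)); last by rewrite ler_pM2l.
  have -> : h2 = (h2 + p2) - p2 by ring.
  rewrite [X in g (_, X) - g _]subrK.
  apply: (mvt_deviation (F := fun s => g (p1, s))
      (dF := fun s => pd ord_max g (p1, s))) => t tb.
  have tb1 := between_shift tb.
  split.
    apply: is_derive_line1; apply: d1; apply: Hr => /=; first by rewrite subrr normr0.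
    exact: le_lt_trans (le_trans tb1 h2m) hr.
  apply: Hr2 => /=; first by rewrite subrr normr0.
  exact: le_lt_trans (le_trans tb1 h2m) hr2.
Unshelve. all: by end_near.
Qed.


Lemma continuous_near_eq (T S : topologicalType) (f f' : T -> S) (p : T) :
  (\near p, f p = f' p) -> {for p, continuous f} -> {for p, continuous f'}.
Proof.
move=> ff' cf; rewrite /prop_for /continuous_at -(nbhs_singleton ff').
by apply: cvg_trans cf; apply: near_eq_cvg; apply: filterS ff' => q ->.
Qed.

Lemma open_near (T : topologicalType) (U : set T) (p : T) (P : T -> Prop) :
  open U -> U p -> (forall q, U q -> P q) -> \near p, P p.
Proof. by move=> oU Up UP; apply: (filterS _ (open_nbhs_nbhs (conj oU Up))). Qed.

Lemma pd_diffE i g p : differentiable g p -> pd i g p = 'd g p (basis2 i).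
Proof. by move=> dg; rewrite /pd deriveE. Qed.

(** The way [Ck 1] is established below: differentiability makes the partial
derivatives exist, so that only their formulas and continuity remain. *)
Lemma Ck1_intro U g (dg : 'I_2 -> R * R -> R) : open U ->
  (forall p, U p -> differentiable g p) ->
  (forall p i, U p -> pd i g p = dg i p) ->
  (forall p i, U p -> {for p, continuous (dg i)}) -> Ck 1 U g.
Proof.
move=> oU gd gdg cdg; split => [p Up|i]; first exact/differentiable_continuous/gd.
split => [p Up|]; first exact/diff_derivable/gd.
split=> // p Up; apply: (continuous_near_eq _ (cdg _ _ Up)).
by apply: (open_near oU Up _) => q Uq; rewrite gdg.
Qed.

Lemma Ck1_continuous U g p : Ck 1 U g -> U p -> {for p, continuous g}.
Proof. by move=> [+ _]; exact. Qed.

Lemma Ck1_pd_continuous U g i p : Ck 1 U g -> U p -> {for p, continuous (pd i g)}.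
Proof. by move=> [_ Cg] Up; have [_ [cg _]] := Cg i; exact: cg. Qed.

Lemma Ck1S U V g : U `<=` V -> Ck 1 V g -> Ck 1 U g.
Proof.
move=> UV [c d]; split => [p /UV/c//|i]; have [d1 [d2 _]] := d i.
by split => [p /UV/d1//|]; split => // p /UV/d2.
Qed.

Lemma pd_near_eq i g h p : (\near p, g p = h p) -> pd i g p = pd i h p.
Proof. by move=> gh; rewrite /pd; apply: near_eq_derive. Qed.

Lemma pd_eq_on U i g h p : open U -> U p -> (forall q, U q -> g q = h q) ->
  pd i g p = pd i h p.
Proof. by move=> oU Up gh; apply/pd_near_eq/(open_near oU Up). Qed.

(** Being C^1 is a local property; this is what makes a C^1 function cut off by 0
along a set where it already vanishes C^1 again. *)
Lemma Ck1_local U g :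
  (forall p, U p -> exists W h, [/\ open W, W p, Ck 1 W h &
     forall q, W q -> g q = h q]) -> Ck 1 U g.
Proof.
move=> loc; split => [p /loc[W [h [oW Wp [ch _] gh]]]|i].
  by apply: (continuous_near_eq _ (ch _ Wp)); apply: (open_near oW Wp _) => q /gh.
split => [p /loc[W [h [oW Wp [_ Ch] gh]]]|].
  have [dh _] := Ch i; apply: (near_eq_derivable (f := h)); last exact: dh.
  by apply: (open_near oW Wp _) => q /gh.
split=> // p /loc[W [h [oW Wp [_ Ch] gh]]]; have [_ [ch _]] := Ch i.
apply: (continuous_near_eq _ (ch _ Wp)); apply: (open_near oW Wp _) => q Wq.
by apply: (pd_eq_on _ oW Wq) => t /gh.
Qed.

Lemma Ck1_eq_on U g h : open U -> (forall q, U q -> g q = h q) ->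
  Ck 1 U h -> Ck 1 U g.
Proof. by move=> oU gh Ch; apply: Ck1_local => p Up; exists U, h. Qed.

Lemma pd_cst i (c : R) p : pd i (cst c) p = 0.
Proof. by rewrite /pd derive_cst. Qed.

Lemma Ck1_cst U (c : R) : open U -> Ck 1 U (cst c).
Proof.
move=> oU; apply: (Ck1_intro (dg := fun _ => cst 0)) => // p i Up.
- exact: pd_cst.
- exact: cvg_cst.
Qed.

Lemma pdD U i g h p : open U -> Ck 1 U g -> Ck 1 U h -> U p ->
  pd i (g \+ h) p = pd i g p + pd i h p.
Proof.
by move=> oU [_ Cg] [_ Ch] Up; have [dg _] := Cg i; have [dh _] := Ch i; rewrite /pd deriveD; auto.
Qed.

Lemma Ck1D U g h : open U -> Ck 1 U g -> Ck 1 U h -> Ck 1 U (g \+ h).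
Proof.
move=> oU Cg Ch; apply: (Ck1_intro (dg := fun i => pd i g \+ pd i h)) => //.
- by move=> p Up; apply: differentiableD; exact: Ck1_differentiable Up.
- by move=> p i Up; exact: (pdD _ oU).
- by move=> p i Up; apply: cvgD; apply: Ck1_pd_continuous Up.
Qed.

Lemma pdM U i g h p : open U -> Ck 1 U g -> Ck 1 U h -> U p ->
  pd i (g \* h) p = g p * pd i h p + h p * pd i g p.
Proof.
by move=> oU [_ Cg] [_ Ch] Up; have [dg _] := Cg i; have [dh _] := Ch i; rewrite /pd deriveM; auto.
Qed.

Lemma Ck1M U g h : open U -> Ck 1 U g -> Ck 1 U h -> Ck 1 U (g \* h).
Proof.
move=> oU Cg Ch; apply: (Ck1_intro (dg := fun i p => g p * pd i h p + h p * pd i g p)) => //.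
- by move=> p Up; apply: differentiableM; exact: Ck1_differentiable Up.
- by move=> p i Up; exact: (pdM _ oU).
- move=> p i Up; apply: cvgD; apply: cvgM.
  + exact: Ck1_continuous Up.
  + exact: Ck1_pd_continuous Up.
  + exact: Ck1_continuous Up.
  + exact: Ck1_pd_continuous Up.
Qed.

Lemma Ck1Ml U (c : R) g : open U -> Ck 1 U g -> Ck 1 U (fun p => c * g p).
Proof. by move=> oU Cg; exact: (Ck1M oU (Ck1_cst c oU)). Qed.

Lemma pdMl U i (c : R) g p : open U -> Ck 1 U g -> U p ->
  pd i (fun p => c * g p) p = c * pd i g p.
Proof.
move=> oU Cg Up; rewrite (pdM i oU (Ck1_cst c oU) Cg Up).
by rewrite pd_cst mulr0 addr0.
Qed.

Lemma Ck1_sum U (I : Type) (s : seq I) (F : I -> R * R -> R) : open U ->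
  (forall k, Ck 1 U (F k)) -> Ck 1 U (fun p => \sum_(k <- s) F k p).
Proof.
move=> oU CF; elim: s => [|k s IH].
  by apply: (Ck1_eq_on oU _ (Ck1_cst 0 oU)) => q _; rewrite big_nil.
by apply: (Ck1_eq_on oU _ (Ck1D oU (CF k) IH)) => q _; rewrite big_cons.
Qed.

Lemma pd_sum U i (I : Type) (s : seq I) (F : I -> R * R -> R) p : open U ->
  (forall k, Ck 1 U (F k)) -> U p ->
  pd i (fun p => \sum_(k <- s) F k p) p = \sum_(k <- s) pd i (F k) p.
Proof.
move=> oU CF Up; elim: s => [|k s IH].
  by rewrite big_nil (pd_eq_on (h := cst 0) i oU Up) ?pd_cst// => q _; rewrite big_nil.
rewrite big_cons -IH -(pdD i oU (CF k) (Ck1_sum s oU CF) Up).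
by apply: (pd_eq_on i oU Up) => q _; rewrite big_cons.
Qed.

Lemma pd_comp U i g (th th' : R -> R) p : open U -> Ck 1 U g -> U p ->
  is_derive (g p) 1 th (th' (g p)) -> pd i (th \o g) p = th' (g p) * pd i g p.
Proof.
move=> oU Cg Up dth; have dg := Ck1_differentiable oU Cg Up.
have dth' : differentiable th (g p) by apply/derivable1_diffP; case: dth.
rewrite pd_diffE; last exact: differentiable_comp.
rewrite diff_comp//= pd_diffE// deriv1E; last by case: dth.
by rewrite /= derive1E (@derive_val _ _ _ _ _ _ _ dth) mulrC.
Qed.

Lemma Ck1_comp U g (th th' : R -> R) : open U -> Ck 1 U g ->
  (forall p, U p -> is_derive (g p) 1 th (th' (g p))) ->
  (forall p, U p -> {for g p, continuous th'}) -> Ck 1 U (th \o g).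
Proof.
move=> oU Cg dth cth'.
apply: (Ck1_intro (dg := fun i p => th' (g p) * pd i g p)) => //.
- move=> p Up; apply: differentiable_comp; first exact: Ck1_differentiable Up.
  by apply/derivable1_diffP; case: (dth p Up).
- by move=> p i Up; apply: (pd_comp _ oU) => //; exact: dth.
- move=> p i Up; apply: cvgM; last exact: Ck1_pd_continuous Up.
  by apply: continuous_comp; [exact: Ck1_continuous Up|exact: cth'].
Qed.

Lemma Ck1V U g : open U -> Ck 1 U g -> (forall p, U p -> g p != 0) ->
  Ck 1 U (fun p => (g p)^-1).
Proof.
move=> oU Cg g0; apply: (Ck1_comp (th := GRing.inv) (th' := fun x => - x ^- 2)) => //.
- move=> p Up; split; first exact: (derivableV (f := id)) (g0 _ Up) _.
  by rewrite (deriveV (f := id)) ?g0// derive_id [LHS]mulr1.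
- move=> p Up; apply: cvgN; apply: cvgV; first by rewrite expf_eq0 g0.
  by apply: cvgM; exact: cvg_id.
Qed.

(** From the second power on, the positive part has no corner at 0: the difference
quotient there is bounded by |h| for small h. *)
Lemma is_derive_pos_pow n (x : R) :
  is_derive x 1 (fun s => Num.max 0 s ^+ n.+2) (n.+2%:R * Num.max 0 x ^+ n.+1).
Proof.
have dX (y : R) : is_derive y 1 (fun s : R => s ^+ n.+2) (n.+2%:R * y ^+ n.+1).
  by split; [exact: exprn_derivable|rewrite exp_derive /= [LHS]mulr1].
have [x0|[x0|x0]] : x < 0 \/ (0 < x \/ x = 0) by case: (ltgtP x 0); auto.
- rewrite max_l ?ltW// expr0n mulr0.
  have D0 : is_derive x 1 (cst (0 : R)) (0 : R) by exact: is_derive_cst.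
  apply: (near_eq_is_derive _ D0).
  near=> y; rewrite max_l ?expr0n//; apply/ltW; near: y.
  exact: lt_nbhsl.
- rewrite max_r ?ltW//; apply: (near_eq_is_derive _ (dX x)).
  near=> y; rewrite max_r//; apply/ltW; near: y; exact: lt_nbhsr.
- rewrite x0 maxxx expr0n mulr0.
  have lim : h^-1 *: (((fun s : R => Num.max 0 s ^+ n.+2) \o shift (0 : R)) (h *: (1 : R))
      - Num.max 0 (0 : R) ^+ n.+2) @[h --> 0^'] --> (0 : R).
    apply/cvgr0Pnorm_le => e e0; near=> h => /=.
    have h0 : h != 0 by near: h; exact: nbhs_dnbhs_neq.
    have hn : `|h| <= Num.min e 1.
      near: h; apply: dnbhs0_le; by rewrite lt_min e0 ltr01.
    move: hn; rewrite le_min => /andP[he h1].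
    rewrite addr0 maxxx expr0n subr0 [h *: 1]mulr1 normrZ normfV.
    have mh : `|Num.max 0 h| <= `|h|.
      rewrite ger0_norm; last by rewrite le_max lexx.
      by rewrite ge_max normr_ge0 ler_norm.
    rewrite ler_pdivrMl ?normr_gt0// normrX exprS.
    rewrite ler_pM ?exprn_ge0// exprS.
    rewrite (le_trans _ he)// -[leRHS]mulr1 ler_pM ?exprn_ge0//.
    by rewrite exprn_ile1// (le_trans mh).
  split; first by apply/cvg_ex; exists 0.
  exact/cvg_lim.
Unshelve. all: by end_near.
Qed.

Lemma pos_pow_continuous n : continuous (fun s : R => Num.max 0 s ^+ n).
Proof.
move=> x.
have c1 : {for x, continuous (fun s : R => Num.max 0 s)}.
  exact: (@continuous_max _ _ (cst 0) id x (cvg_cst _) cvg_id).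
apply: (@cvg_comp _ _ _ (fun s : R => Num.max 0 s) (fun t : R => t ^+ n)).
  exact: c1.
exact: exprn_continuous.
Qed.

Lemma Ck1_pos_pow n U g : open U -> Ck 1 U g ->
  Ck 1 U (fun p => Num.max 0 (g p) ^+ n.+2).
Proof.
move=> oU Cg; apply: (Ck1_comp (th := fun s => Num.max 0 s ^+ n.+2)
  (th' := fun s => n.+2%:R * Num.max 0 s ^+ n.+1)) => // p Up.
- exact: is_derive_pos_pow.
- by apply: cvgM; [exact: cvg_cst|exact: pos_pow_continuous].
Qed.

Lemma pd_pos_pow n U g i p : open U -> Ck 1 U g -> U p ->
  pd i (fun p => Num.max 0 (g p) ^+ n.+2) p
  = n.+2%:R * Num.max 0 (g p) ^+ n.+1 * pd i g p.
Proof.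
move=> oU Cg Up; apply: (pd_comp (th := fun s => Num.max 0 s ^+ n.+2)
  (th' := fun s => n.+2%:R * Num.max 0 s ^+ n.+1) i oU Cg Up).
exact: is_derive_pos_pow.
Qed.

End PlaneCalculus.

Lemma compact_bound (R : realType) (T : topologicalType) (K : set T) (F : T -> R) :
  compact K -> {within K, continuous F} ->
  exists2 C : R, 0 < C & forall p, K p -> `|F p| <= C.
Proof.
move=> cK cF; have /compact_bounded[N [_ HN]] := continuous_compact cF cK.
exists (Num.max N 0 + 1); first by rewrite ltr_wpDl// le_max lexx orbT.
move=> x Kx; apply: (HN (Num.max N 0 + 1)); last by exists x.
by rewrite (@le_lt_trans _ _ (Num.max N 0))// ?le_max ?lexx// ltrDl.
Qed.

Lemma compact_bound_open (R : realType) (T : topologicalType) (U K : set T) (F : T -> R) :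
  compact K -> K `<=` U -> (forall p, U p -> {for p, continuous F}) ->
  exists2 C : R, 0 < C & forall p, K p -> `|F p| <= C.
Proof.
move=> cK KU cF; apply: compact_bound => //.
by apply: continuous_in_subspaceT => p /[!inE] /KU /cF.
Qed.

(** * Integration in the plane *)
Section Borel.
Context {R : realType}.

Lemma measurable_fun_gt d (T : measurableType d) (D : set T) (g : T -> R) :
  (forall a : R, measurable (D `&` [set x | a < g x])) -> measurable_fun D g.
Proof.
move=> mg; apply: (measurability _ (RGenOInfty.measurableE R)).
move=> /= _ [_ [a ->] <-].
rewrite [X in measurable X](_ : _ = D `&` [set x | a < g x]) //.
by apply/seteqP; split => x [Dx] /=; rewrite in_itv/= andbT.
Qed.

End Borel.

Section PlaneIntegrals.
Context {R : realType}.
Local Notation P2 := (measurableTypeR R * measurableTypeR R)%type.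
Local Notation leb2 := (@lebesgue2 R : {measure set P2 -> \bar R}).

Definition rational_box (q : rat * rat * (rat * rat)) : set (R * R) :=
  [set p | ratr q.1.1 < p.1 < ratr q.1.2 /\ ratr q.2.1 < p.2 < ratr q.2.2].

Lemma open_box_measurable (a b c d : R) :
  measurable ([set p | a < p.1 < b /\ c < p.2 < d] : set P2).
Proof.
rewrite [X in measurable X](_ : _ = `]a, b[%classic `*` `]c, d[%classic).
  by apply: measurableX; exact: measurable_itv.
by apply/seteqP; split => -[x y] /=; rewrite !in_itv.
Qed.

(** The measurable structure of the plane is the product one; an open set belongs
to it as a countable union of boxes with rational ends. *)
Lemma open_measurable2 (A : set (R * R)) : open A -> measurable (A : set P2).
Proof.
move=> oA.
pose F q : set P2 := if `[< rational_box q `<=` A >] then rational_box q else set0.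
have -> : A = \bigcup_q F q.
  apply/seteqP; split => [[x y] Axy|p [q _]]; last first.
    by rewrite /F; case: asboolP => [sub|_ //]; exact: sub.
  have [r r0 Hr] := open_box oA Axy.
  have rl (z : R) : z - r < z by rewrite ltrBlDr ltrDl.
  have ru (z : R) : z < z + r by rewrite ltrDl.
  have [a /[!in_itv]/=/andP[xa ax]] := rat_in_itvoo (rl x).
  have [b /[!in_itv]/=/andP[xb bx]] := rat_in_itvoo (ru x).
  have [c /[!in_itv]/=/andP[yc cy]] := rat_in_itvoo (rl y).
  have [d /[!in_itv]/=/andP[yd dy]] := rat_in_itvoo (ru y).
  exists ((a, b), (c, d)) => //; rewrite /F; case: asboolP => [_|[]].
    by rewrite /rational_box /= ax xb cy yd.
  move=> [s t] [/= /andP[s1 s2] /andP[t1 t2]]; apply: Hr => /=;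
    by rewrite ltr_norml; apply/andP; split; lra.
apply: countable_bigcupT_measurable => [|q]; first exact: countableP.
rewrite /F; case: asboolP => _; [exact: open_box_measurable|exact: measurable0].
Qed.

Lemma continuous_measurable2 (U : set (R * R)) (g : R * R -> R) : open U ->
  (forall p, U p -> {for p, continuous g}) -> measurable_fun (U : set P2) g.
Proof.
move=> oU cg; apply: measurable_fun_gt => a; apply: open_measurable2.
rewrite openE => p [Up /= ap]; rewrite /interior; apply: filterI.
  exact: open_nbhs_nbhs.
apply: (cg _ Up [set t | a < t]); exact: lt_nbhsr.
Qed.

Lemma compact_open_compl (K : set (R * R)) : compact K -> open (~` K).
Proof.
by move=> cK; apply: closed_openC; apply: compact_closed cK; exact: norm_hausdorff.
Qed.

Lemma compact_measurable2 (K : set (R * R)) : compact K -> measurable (K : set P2).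
Proof.
move=> cK; rewrite -[K]setCK; apply: measurableC; apply: open_measurable2.
exact: compact_open_compl.
Qed.

Lemma compact_sub_square (K : set (R * R)) : compact K ->
  exists2 b : R, 0 < b & forall p, K p -> `|p.1| <= b /\ `|p.2| <= b.
Proof.
move=> /(compact_bounded (V := (R * R)%type))[N [_ HN]].
exists (Num.max N 0 + 1); first by rewrite ltr_wpDl// le_max lexx orbT.
move=> p Kp; have := HN (Num.max N 0 + 1) _ p Kp.
have -> : N < Num.max N 0 + 1 by rewrite (@le_lt_trans _ _ (Num.max N 0))// ?le_max ?lexx// ltrDl.
move=> /(_ isT) /=; rewrite [X in X <= _ -> _]/(Num.max `|p.1| `|p.2|).
by rewrite ge_max => /andP[].
Qed.

Lemma compact_lty2 (K : set (R * R)) : compact K -> (leb2 K < +oo)%E.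
Proof.
move=> cK; have [b b0 Kb] := compact_sub_square cK.
apply: (@le_lt_trans _ _ (leb2 (`[-b, b]%classic `*` `[-b, b]%classic))).
  apply: le_measure; rewrite ?inE.
  - exact: compact_measurable2.
  - by apply: measurableX; exact: measurable_itv.
  - by move=> p /Kb[] /= ? ?; rewrite !in_itv/= -!ler_norml.
have fin : (lebesgue_measure (`[(- b)%R, b]%classic : set R) < +oo)%E.
  by rewrite lebesgue_measure_itv /=; case: ifP => _ //; rewrite -EFinB ltry.
rewrite [X in (X < _)%E](_ : _ = (@lebesgue_measure R `[(- b)%R, b]%classic
    * @lebesgue_measure R `[(- b)%R, b]%classic)%E); last first.
  by apply: product_measure1E; exact: measurable_itv.
by apply: lte_mul_pinfty => //; rewrite ge0_fin_numE.
Qed.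

(** U may have infinite measure; the function is dominated by a multiple of the
indicator of K. *)
Lemma compact_support_integrable (U K : set (R * R)) (F : R * R -> R) :
  open U -> compact K -> K `<=` U -> (forall p, U p -> {for p, continuous F}) ->
  (forall p, U p -> ~ K p -> F p = 0) ->
  leb2.-integrable (U : set P2) (EFin \o F).
Proof.
move=> oU cK KU cF F0.
have mU := open_measurable2 oU; have mK := compact_measurable2 cK.
have [C _ HC] := compact_bound_open cK KU cF.
pose G : P2 -> \bar R := (EFin \o cst C) \_ K.
apply: (le_integrable mU (g := G)) => //.
- by apply/measurable_EFinP; exact: continuous_measurable2.
- move=> p Up; rewrite /G patchE; case: ifPn; rewrite ?inE ?notin_setE => Kp.
    by rewrite /= lee_fin (le_trans (HC _ Kp))// ler_norm.
  by rewrite /= F0// normr0.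
- apply: (integrableS measurableT) => //.
  rewrite /G; apply/(integrable_mkcond _ mK).
  apply: (measurable_bounded_integrable mK (compact_lty2 cK)) => //.
  by exists `|C|; split => // M CM p _; exact: ltW.
Qed.

Lemma integral_derivative_eq0 (F dF : R -> R) (b : R) : 0 < b ->
  (forall x : R, is_derive x 1 F (dF x)) -> continuous dF ->
  (forall x, b <= `|x| -> F x = 0) -> (forall x, b <= `|x| -> dF x = 0) ->
  (\int[lebesgue_measure]_x (dF x)%:E = 0)%E.
Proof.
move=> b0 dFP cdF F0 dF0.
have -> : (fun x => (dF x)%:E) = ((fun x => (dF x)%:E) \_ `[- b, b]).
  apply/funext => x; rewrite patchE; case: ifPn => //.
  rewrite notin_setE /= in_itv/= -ler_norml => /negP; rewrite -ltNge => /ltW /dF0 -> //.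
rewrite -integral_mkcond.
have cF x : {for x, continuous F}.
  by apply/differentiable_continuous/derivable1_diffP; case: (dFP x).
have LR : derivable_oo_LRcontinuous F (- b) b.
  split => [x _||]; first by case: (dFP x).
  + exact: cvg_at_right_filter (cF _).
  + exact: cvg_at_left_filter (cF _).
have F'E : {in `]- b, b[, derive1 F =1 dF}.
  by move=> x _; rewrite derive1E; exact: derive_val.
rewrite (continuous_FTC2 _ _ LR F'E) ?gtrN//; last exact: continuous_subspaceT.
have nb : `|b| = b by rewrite ger0_norm// ltW.
have Fb : F b = 0 by apply: F0; rewrite nb.
have FNb : F (- b) = 0 by apply: F0; rewrite normrN nb.
by rewrite Fb FNb subee.
Qed.

Lemma pd_eq0_off (g : R * R -> R) (K : set (R * R)) i p : compact K ->
  (forall q, ~ K q -> g q = 0) -> ~ K p -> pd i g p = 0.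
Proof.
move=> cK g0 nKp.
by rewrite (pd_eq_on (h := cst 0) i (compact_open_compl cK) nKp)// pd_cst.
Qed.

(** Fubini reduces to lines parallel to the i-th axis, on which the fundamental
theorem of calculus leaves only boundary values, zero for a compact support. *)
Lemma integral_pd_eq0 (g : R * R -> R) (K : set (R * R)) i : Ck 1 setT g ->
  compact K -> (forall p, ~ K p -> g p = 0) -> \int[leb2]_p pd i g p = 0.
Proof.
move=> Cg cK g0.
have ig : leb2.-integrable setT (EFin \o pd i g).
  apply: (compact_support_integrable (K := K)) => //; first exact: openT.
    by move=> p _; exact: Ck1_pd_continuous Cg I.
  by move=> p _; exact: pd_eq0_off.
have [b b0 Kb] := compact_sub_square cK.
have offK (x y : R) : b + 1 <= `|x| \/ b + 1 <= `|y| -> ~ K (x, y).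
  move=> h /Kb[/= h1 h2]; case: h => h.
    by have := le_trans h h1; rewrite leNgt ltrDl ltr01.
  by have := le_trans h h2; rewrite leNgt ltrDl ltr01.
(* Points with a coordinate of modulus b may lie in K, those with one of modulus
   at least b + 1 do not. *)
have b1 : 0 < b + 1 by rewrite addr_gt0.
rewrite /Rintegral; have [i0|i1] := ord2_cases i.
- subst i; rewrite -(integral21_prod_meas1 ig) /fubini_G integral0_eq// => y _.
  apply: (@integral_derivative_eq0 (fun x => g (x, y)) _ (b + 1)) => //=.
  + by move=> x; apply: is_derive_line0; case: Cg => _ /(_ ord0)[+ _]; exact.
  + move=> x; apply: (@continuous_comp _ _ _ (fun x => (x, y)) (pd ord0 g)).
      by apply/differentiable_continuous/differentiable_pair.
    exact: (Ck1_pd_continuous (p := (x, y)) Cg I).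
  + by move=> x bx; apply/g0/offK; left.
  + by move=> x bx; apply: (pd_eq0_off _ cK g0); apply: offK; left.
- subst i; rewrite -(integral12_prod_meas1 ig) /fubini_F integral0_eq// => x _.
  apply: (@integral_derivative_eq0 (fun y => g (x, y)) _ (b + 1)) => //=.
  + by move=> y; apply: is_derive_line1; case: Cg => _ /(_ ord_max)[+ _]; exact.
  + move=> y; apply: (@continuous_comp _ _ _ (fun y => (x, y)) (pd ord_max g)).
      by apply/differentiable_continuous/differentiable_pair.
    exact: (Ck1_pd_continuous (p := (x, y)) Cg I).
  + by move=> y b_y; apply/g0/offK; right.
  + by move=> y b_y; apply: (pd_eq0_off _ cK g0); apply: offK; right.
Qed.

End PlaneIntegrals.

(** * Test functions *)
Section Squares.
Context {R : realType}.

Definition square (p : R * R) (d : R) : set (R * R) :=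
  `[p.1 - d, p.1 + d]%classic `*` `[p.2 - d, p.2 + d]%classic.

Lemma compact_square p d : compact (square p d).
Proof. by apply: compact_setX; exact: segment_compact. Qed.

Lemma square_nbhs p d : 0 < d -> nbhs p (square p d).
Proof.
case: p => p1 p2 d0; exists (`[p1 - d, p1 + d]%classic, `[p2 - d, p2 + d]%classic) => //=.
have near_itv (a : R) : nbhs a `[a - d, a + d]%classic.
  apply: (filterS (P := `]a - d, a + d[%classic)); first exact: subset_itv_oo_cc.
  by apply: near_in_itvoo; rewrite in_itv/=; apply/andP; split; lra.
by split; exact: near_itv.
Qed.

Lemma open_square (U : set (R * R)) p : open U -> U p ->
  exists2 d : R, 0 < d & square p d `<=` U.
Proof.
move=> oU Up; have [r r0 Hr] := open_box oU Up.
exists (r / 2); first by rewrite divr_gt0.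
move=> [x y] [] /=; rewrite !in_itv/= => /andP[x1 x2] /andP[y1 y2].
have dr : r / 2 < r by lra.
by apply: Hr => /=; rewrite ltr_norml; apply/andP; split; lra.
Qed.

End Squares.

Section TestFunctions.
Context {R : realType}.
Local Notation P2 := (measurableTypeR R * measurableTypeR R)%type.
Local Notation leb2 := (@lebesgue2 R : {measure set P2 -> \bar R}).
Implicit Types (U : set (R * R)) (g h psi : R * R -> R) (p : R * R).

(** A C^1 function on U vanishing off a compact part of U extends by zero to
a test function: near a point outside U it is zero because the complement of
the compact set is open. *)
Lemma test_function_patch U (K : set (R * R)) g : open U -> Ck 1 U g ->
  compact K -> K `<=` U -> (forall p, U p -> ~ K p -> g p = 0) ->
  test_function U (g \_ U).
Proof.
move=> oU Cg cK KU g0.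
have z q : ~ K q -> (g \_ U) q = 0.
  by move=> nKq; rewrite patchE; case: ifPn => //; rewrite inE => Uq; exact: g0.
split; last by exists K.
apply: Ck1_local => p _; have [Up|nUp] := pselect (U p).
  exists U, g; split => //.
  by move=> q Uq; rewrite patchE mem_set.
exists (~` K), (cst 0); split => //.
- exact: compact_open_compl.
- by move=> /KU.
- exact/Ck1_cst/compact_open_compl.
Qed.

(** The source of the test functions used with weak gradients: coordinate
coefficients of a chart are C^1 on U only, yet may multiply a test function. *)
Lemma test_function_mul U g psi : open U -> Ck 1 U g -> test_function U psi ->
  test_function U ((g \* psi) \_ U).
Proof.
move=> oU Cg [Cpsi [K [cK KU psi0]]]; have CpsiU : Ck 1 U psi by exact: Ck1S Cpsi.
apply: (test_function_patch oU (Ck1M oU Cg CpsiU) cK KU) => p _ nKp.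
by rewrite /= psi0// mulr0.
Qed.

Lemma test_function_integrable U g psi : open U ->
  (forall p, U p -> {for p, continuous g}) -> test_function U psi ->
  leb2.-integrable (U : set P2) (EFin \o (g \* psi)).
Proof.
move=> oU cg [Cpsi [K [cK KU psi0]]].
apply: (compact_support_integrable oU cK KU) => p Up.
  by apply: cvgM; [exact: cg|exact: (Ck1_continuous (p := p) Cpsi I)].
by move=> nKp; rewrite /= psi0// mulr0.
Qed.

Lemma test_function_pd_integrable U g psi i : open U ->
  (forall p, U p -> {for p, continuous g}) -> test_function U psi ->
  leb2.-integrable (U : set P2) (EFin \o (g \* pd i psi)).
Proof.
move=> oU cg [Cpsi [K [cK KU psi0]]].
apply: (compact_support_integrable oU cK KU) => p Up.
  by apply: cvgM; [exact: cg|exact: (Ck1_pd_continuous (p := p) Cpsi I)].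
by move=> nKp; rewrite /= (pd_eq0_off _ cK psi0 nKp) mulr0.
Qed.

Lemma pd_test_function_mul U g psi i p : open U -> Ck 1 U g ->
  test_function U psi -> U p ->
  pd i ((g \* psi) \_ U) p = g p * pd i psi p + psi p * pd i g p.
Proof.
move=> oU Cg [Cpsi _] Up; rewrite -(pdM i oU Cg (Ck1S _ Cpsi) Up)//.
by apply: (pd_eq_on i oU Up) => q Uq; rewrite patchE mem_set.
Qed.

Lemma integration_by_parts_plane U g psi i : open U -> Ck 1 U g ->
  test_function U psi ->
  \int[leb2]_(p in U) (g p * pd i psi p) = - \int[leb2]_(p in U) (pd i g p * psi p).
Proof.
move=> oU Cg tpsi; have [Ct [K [cK KU t0]]] := test_function_mul oU Cg tpsi.
have /= := integral_pd_eq0 i Ct cK t0.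
have -> : pd i ((g \* psi) \_ U) = (pd i ((g \* psi) \_ U)) \_ U.
  apply/funext => p; rewrite patchE; case: ifPn => //; rewrite notin_setE => nUp.
  by rewrite (pd_eq0_off _ cK t0)// => /KU.
rewrite -Rintegral_mkcond => E.
apply/eqP; rewrite -subr_eq0 opprK -E; apply/eqP.
rewrite -RintegralD; first last.
- apply: test_function_integrable => // p Up; exact: Ck1_pd_continuous Cg Up.
- apply: test_function_pd_integrable => // p Up; exact: Ck1_continuous Cg Up.
- exact: open_measurable2.
apply: eq_Rintegral => p /[!inE] Up.
by rewrite (pd_test_function_mul i oU Cg tpsi Up) (mulrC (psi p)).
Qed.

Lemma lebesgue2_open_gt0 U p : open U -> U p -> (0 < leb2 U)%E.
Proof.
move=> oU Up; have [r r0 Hr] := open_box oU Up.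
have pos (x : R) : (0 < @lebesgue_measure R `](x - r)%R, (x + r)%R[%classic)%E.
  rewrite lebesgue_measure_itv /= lte_fin ifT; last by lra.
  by rewrite -EFinB lte_fin; lra.
apply: (@lt_le_trans _ _ (leb2 (`]p.1 - r, p.1 + r[%classic `*` `]p.2 - r, p.2 + r[%classic))).
  rewrite [X in (_ < X)%E](_ : _ = (@lebesgue_measure R `](p.1 - r)%R, (p.1 + r)%R[%classic
    * @lebesgue_measure R `](p.2 - r)%R, (p.2 + r)%R[%classic)%E); last first.
    by apply: product_measure1E; exact: measurable_itv.
  exact: mule_gt0.
apply: le_measure; rewrite ?inE.
- by apply: measurableX; exact: measurable_itv.
- exact: open_measurable2.
- move=> [x y] [] /=; rewrite !in_itv/= => /andP[x1 x2] /andP[y1 y2].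
  by apply: Hr => /=; rewrite ltr_norml; apply/andP; split; lra.
Qed.

(** Where g is positive it is so on an open set, which has positive measure. *)
Lemma continuous_integral_eq0 U g : open U ->
  (forall p, U p -> {for p, continuous g}) -> (forall p, U p -> 0 <= g p) ->
  leb2.-integrable (U : set P2) (EFin \o g) -> \int[leb2]_(p in U) g p = 0 ->
  forall p, U p -> g p = 0.
Proof.
move=> oU cg g0 ig int0 p Up; apply/eqP; apply: contrapT => /negP gp0.
have gp : 0 < g p by rewrite lt_def gp0 g0.
have mg := continuous_measurable2 oU cg.
have mU := open_measurable2 oU.
have oW : open (U `&` [set q | 0 < g q]).
  rewrite openE => q [Uq gq]; rewrite /interior; apply: filterI.
    exact: open_nbhs_nbhs.
  apply: (cg _ Uq [set t | 0 < t]); exact: lt_nbhsr.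
have : (\int[leb2]_(p in U) `|(g p)%:E| = 0)%E.
  transitivity (\int[leb2]_(p in U) (g p)%:E)%E.
    by apply: eq_integral => q /[!inE] Uq; rewrite gee0_abs// lee_fin g0.
  by rewrite -(fineK (integrable_fin_num mU ig)); congr (_%:E).
move=> /(ae_eq_integral_abs _ mU (measurable_int _ ig)).1 [N [mN N0 sub]].
have := lebesgue2_open_gt0 oW (conj Up gp); apply/negP; rewrite -leNgt.
rewrite -N0; apply: le_measure; rewrite ?inE//; first exact: open_measurable2.
move=> q [Uq gq]; apply: sub => /= /(_ Uq) [] gq0.
by move: gq; rewrite /= gq0 ltxx.
Qed.

Lemma Ck1_linear U (L : {linear (R * R)%type -> R}) : continuous L -> open U ->
  Ck 1 U (L : R * R -> R).
Proof.
move=> cL oU; apply: (Ck1_intro (dg := fun i => cst (L (basis2 i)))) => //.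
- by move=> p _; exact: linear_differentiable.
- by move=> p i _; rewrite pd_diffE ?diff_lin//; exact: linear_differentiable.
- by move=> p i _; exact: cvg_cst.
Qed.

Lemma Ck1_fst U : open U -> Ck 1 U (fst : R * R -> R).
Proof.
by move=> oU; apply: (@Ck1_linear U (@fst R R)) => // p; exact: cvg_fst.
Qed.

Lemma Ck1_snd U : open U -> Ck 1 U (snd : R * R -> R).
Proof.
by move=> oU; apply: (@Ck1_linear U (@snd R R)) => // p; exact: cvg_snd.
Qed.

Lemma bump_function U p : open U -> U p -> exists psi : R * R -> R,
  [/\ test_function U psi, forall q, 0 <= psi q & 0 < psi p].
Proof.
move=> oU Up; have [d d0 sub] := open_square oU Up.
have oT := @openT (R * R)%type.
pose w q : R := d ^+ 2 + ((-1) * ((q.1 - p.1) * (q.1 - p.1)) +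
                          (-1) * ((q.2 - p.2) * (q.2 - p.2))).
exists (fun q => Num.max 0 (w q) ^+ 2); split.
- split.
    apply: (@Ck1_pos_pow _ 0 setT w oT).
    apply: (Ck1D oT (Ck1_cst _ oT)); apply: (Ck1D oT); apply: (Ck1Ml _ oT); apply: (Ck1M oT);
      by apply: (Ck1D oT _ (Ck1_cst _ oT)); first [exact: Ck1_fst|exact: Ck1_snd].
  exists (square p d); split => //; first exact: compact_square.
  move=> [x y] /= nK; rewrite max_l ?expr0n// leNgt; apply/negP => w0; apply: nK.
  rewrite /square /= !in_itv/=; move: w0; rewrite /w /= => w0.
  have x2 : `|x - p.1| <= `|d|.
    rewrite -ler_sqr ?nnegrE// !real_normK ?num_real//.
    by have := sqr_ge0 (y - p.2); rewrite !expr2; lra.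
  have y2 : `|y - p.2| <= `|d|.
    rewrite -ler_sqr ?nnegrE// !real_normK ?num_real//.
    by have := sqr_ge0 (x - p.1); rewrite !expr2; lra.
  move: x2 y2; rewrite (gtr0_norm d0) !ler_norml => /andP[? ?] /andP[? ?].
  by split; apply/andP; split; lra.
- by move=> q; rewrite exprn_ge0// le_max lexx.
- rewrite exprn_gt0// lt_max; apply/orP; right.
  by rewrite /w !subrr mulr0 !mulr0 !addr0 exprn_gt0.
Qed.

(** The fundamental lemma of the calculus of variations: a bump supported where g
has the sign of g p would give a positive integral. *)
Lemma eq0_of_test_functions U g : open U ->
  (forall p, U p -> {for p, continuous g}) ->
  (forall psi, test_function U psi -> \int[leb2]_(p in U) (g p * psi p) = 0) ->
  forall p, U p -> g p = 0.
Proof.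
move=> oU cg Hg p Up; apply: contrapT => gp0.
pose W := U `&` [set q | 0 < g p * g q].
have oW : open W.
  rewrite openE => q [Uq gq]; rewrite /interior; apply: filterI.
    exact: open_nbhs_nbhs.
  have cq : {for q, continuous (fun t => g p * g t)}.
    by apply: cvgM; [exact: cvg_cst|exact: cg].
  apply: (cq [set t | 0 < t]); exact: lt_nbhsr.
have gg : 0 < g p * g p by rewrite -expr2 exprn_even_gt0//=; apply/eqP.
have [psi [[Cpsi [K [cK KW psi0]]] psi_ge0 psip]] := bump_function oW (conj Up gg).
have tU : test_function U psi by split => //; exists K; split => // q /KW[].
have : g p * (g p * psi p) = 0.
  apply: (@continuous_integral_eq0 U (fun q => g p * (g q * psi q))) => //.
  - move=> q Uq; apply: cvgM; first exact: cvg_cst.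
    by apply: cvgM; [exact: cg|exact: (Ck1_continuous (p := q) Cpsi I)].
  - move=> q Uq; have [Kq|nKq] := pselect (K q); last by rewrite psi0// !mulr0.
    by rewrite mulrA mulr_ge0//; have [_ /ltW] := KW _ Kq.
  - apply: (@compact_support_integrable _ U K) => //.
    + by move=> q /KW[].
    + move=> q Uq; apply: cvgM; first exact: cvg_cst.
      by apply: cvgM; [exact: cg|exact: (Ck1_continuous (p := q) Cpsi I)].
    + by move=> q _ nKq; rewrite psi0// !mulr0.
  - rewrite RintegralZl ?Hg ?mulr0//; first exact: open_measurable2.
    exact: test_function_integrable.
rewrite mulrA => /eqP; rewrite mulf_eq0 => /orP[] /eqP h.
  by move: gg; rewrite h ltxx.
by move: psip; rewrite h ltxx.
Qed.

End TestFunctions.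

(** * Integrals on the surface in a chart *)

(** The defining property of the area measure is a change of variables for
indicators; it passes to nonnegative functions through simple functions and
monotone convergence, and to integrable ones through positive and negative
parts. *)
Section ChangeOfVariables.
Context {R : realType} d1 d2 (X : measurableType d1) (Y : measurableType d2).
Variables (mu : {measure set X -> \bar R}) (nu : {measure set Y -> \bar R}).
Variables (U : set X) (S : set Y) (T : X -> Y) (rho : X -> R).
Hypotheses (mU : measurable U) (mS : measurable S).
Hypotheses (mT : measurable_fun U T) (TS : forall x, U x -> S (T x)).
Hypotheses (mrho : measurable_fun U rho) (rho0 : forall x, U x -> 0 <= rho x).
Hypothesis nuE : forall A, measurable A -> A `<=` S ->
  nu A = (\int[mu]_(x in U `&` T @^-1` A) (rho x)%:E)%E.

Import HBNNSimple.

Let int_indic (B : set Y) : measurable B ->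
  (\int[nu]_(y in S) (\1_B y)%:E = \int[mu]_(x in U) (\1_B (T x) * rho x)%:E)%E.
Proof.
move=> mB; rewrite integral_indic// setIC nuE; [|exact: measurableI|by move=> y []].
rewrite (integral_mkcond (U `&` _)) [RHS]integral_mkcond.
apply: eq_integral => x _; rewrite !patchE.
have [Ux|nUx] := pselect (U x); last first.
  by rewrite memNset ?memNset// => -[].
rewrite (mem_set Ux) indicE; have [Bx|nBx] := pselect (B (T x)).
  rewrite !mem_set ?mul1r//; split => //; split => //; exact: TS.
by rewrite memNset ?memNset ?mul0r// => -[_ []].
Qed.

Lemma ge0_change_of_variables (g : Y -> \bar R) : measurable_fun S g ->
  (forall y, S y -> 0 <= g y)%E ->
  (\int[nu]_(y in S) g y = \int[mu]_(x in U) (g (T x) * (rho x)%:E))%E.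
Proof.
move=> mg g0; pose h := nnsfun_approx mS mg.
have hcvg y : S y -> (h n y)%:E @[n --> \oo] --> g y.
  by move=> Sy; apply: cvg_nnsfun_approx.
have mhT n : measurable_fun U (h n \o T).
  apply: (measurable_comp measurableT) => //; exact: measurable_funPT.
transitivity (limn (fun n => \int[nu]_(y in S) (h n y)%:E))%E.
  rewrite -monotone_convergence//.
  - by apply: eq_integral => y /[!inE] Sy; apply/esym/cvg_lim => //; exact: hcvg.
  - by move=> n; apply/measurable_EFinP; apply: measurable_funTS.
  - by move=> n y _; rewrite lee_fin.
  - by move=> y _ m n mn; rewrite lee_fin; exact/lefP/nd_nnsfun_approx.
transitivity (limn (fun n => \int[mu]_(x in U) (h n (T x) * rho x)%:E))%E; last first.
  rewrite -monotone_convergence//.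
  - apply: eq_integral => x /[!inE] Ux; apply/cvg_lim => //.
    under eq_fun do rewrite EFinM.
    by apply: cvgeZr => //; apply: hcvg; exact: TS.
  - by move=> n; apply/measurable_EFinP; apply: measurable_funM => //; exact: mhT.
  - by move=> n x Ux; rewrite lee_fin mulr_ge0// rho0.
  - move=> x Ux m n mn; rewrite lee_fin ler_wpM2r ?rho0//; exact/lefP/nd_nnsfun_approx.
congr (limn _); apply/funext => n.
have mind (r : R) : measurable_fun setT (fun y => r * \1_(h n @^-1` [set r]) y).
  by apply: measurable_funM.
transitivity (\sum_(r \in range (h n)) \int[nu]_(y in S) (r * \1_(h n @^-1` [set r]) y)%:E)%E.
  under eq_integral do rewrite fimfunE -fsumEFin//.
  rewrite ge0_integral_fsum//.
  - by move=> r; apply/measurable_EFinP; exact: measurable_funTS.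
  - by move=> r y _; rewrite nnfun_muleindic_ge0.
transitivity (\sum_(r \in range (h n))
    \int[mu]_(x in U) (r * \1_(h n @^-1` [set r]) (T x) * rho x)%:E)%E; last first.
  rewrite -ge0_integral_fsum//.
  - apply: eq_integral => x _; rewrite [in RHS]fimfunE EFinM -fsumEFin//.
    rewrite ge0_mule_fsuml; last by move=> r; exact: nnfun_muleindic_ge0.
    by apply: eq_fsbigr => r _; rewrite EFinM.
  - move=> r; apply/measurable_EFinP; apply: measurable_funM => //.
    exact: (measurable_comp measurableT _ (mind r) mT).
  - move=> r x Ux; rewrite EFinM mule_ge0 ?lee_fin ?rho0//.
    exact: nnfun_muleindic_ge0.
apply: eq_fsbigr => r /[!inE] -[y0 _ yr].
have r0 : 0 <= r by rewrite -yr.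
have mB : measurable (h n @^-1` [set r]) by [].
under eq_integral do rewrite EFinM.
rewrite ge0_integralZl_EFin//; last first.
  by apply/measurable_EFinP; apply: measurable_funTS.
rewrite int_indic// -ge0_integralZl_EFin//.
- by apply: eq_integral => x _; rewrite -EFinM mulrA.
- by move=> x Ux; rewrite lee_fin mulr_ge0// rho0.
- apply/measurable_EFinP; apply: measurable_funM => //.
  apply: (measurable_comp measurableT _ _ mT) => //.
Qed.

Lemma integrable_change_of_variables (g : Y -> R) : measurable_fun S g ->
  nu.-integrable S (EFin \o g) <->
  mu.-integrable U (fun x => (g (T x) * rho x)%:E).
Proof.
move=> mg.
have mgT : measurable_fun U (fun x => (g (T x) * rho x)%:E).
  apply/measurable_EFinP; apply: measurable_funM => //.
  by apply: (measurable_comp mS _ mg mT) => _ [x Ux <-]; exact: TS.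
have E : (\int[nu]_(y in S) `|(g y)%:E| = \int[mu]_(x in U) `|(g (T x) * rho x)%:E|)%E.
  rewrite ge0_change_of_variables//; last first.
    by apply: measurableT_comp => //; exact/measurable_EFinP.
  apply: eq_integral => x /[!inE] Ux.
  by rewrite EFinM abseM (@gee0_abs _ (rho x)%:E) ?lee_fin ?rho0.
split => /integrableP[_ fin]; apply/integrableP; split => //.
- by rewrite -E.
- exact/measurable_EFinP.
- by rewrite [ltLHS]E.
Qed.

Lemma Rintegral_change_of_variables (g : Y -> R) : measurable_fun S g ->
  \int[nu]_(y in S) g y = \int[mu]_(x in U) (g (T x) * rho x).
Proof.
move=> mg; rewrite /Rintegral; congr fine.
have mge : measurable_fun S (EFin \o g) by exact/measurable_EFinP.
rewrite integralE [RHS]integralE; congr (_ - _)%E.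
- rewrite ge0_change_of_variables//; last exact: measurable_funepos.
  apply: eq_integral => x /[!inE] Ux; rewrite !funeposE.
  by rewrite maxe_pMl ?mul0e ?lee_fin ?rho0.
- rewrite ge0_change_of_variables//; last exact: measurable_funeneg.
  apply: eq_integral => x /[!inE] Ux; rewrite !funenegE.
  by rewrite maxe_pMl ?mul0e ?mulNe ?lee_fin ?rho0.
Qed.

End ChangeOfVariables.

(** * Topology of charts *)
Section ChartTopology.
Context {R : realType}.
Local Notation E3 := 'rV[R]_3.
Local Notation P2 := (measurableTypeR R * measurableTypeR R)%type.
Local Notation leb2 := (@lebesgue2 R : {measure set P2 -> \bar R}).
Implicit Types (M : set E3) (U : set (R * R)) (phi : R * R -> E3) (p : R * R).

Lemma chart_continuous M U phi p : chart M U phi -> U p -> {for p, continuous phi}.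
Proof. by move=> [_ /(_ 0%N)[c _] _ _ _]; exact: c. Qed.

Lemma chart_preimage M U phi p (W : set E3) : chart M U phi -> U p -> open W ->
  W (phi p) -> \forall q \near p, U q /\ W (phi q).
Proof.
move=> c Up oW Wp; have [oU _ _ _ _] := c; apply: filterI.
  exact: open_nbhs_nbhs.
have cphi := chart_continuous c Up.
exact: (cphi _ (open_nbhs_nbhs (conj oW Wp))).
Qed.

Lemma chart_image M U phi : chart M U phi ->
  exists2 O : set E3, open O & phi @` U = M `&` O.
Proof. by move=> [oU _ _ _]; apply. Qed.

Lemma chart_in M U phi p : chart M U phi -> U p -> M (phi p).
Proof.
move=> c Up; have [W _ E] := chart_image c.
by have : (phi @` U) (phi p) by [exists p]; rewrite E => -[].
Qed.

(** A chart is open onto its image; this is the only form in which that part of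
the definition is used. *)
Lemma chart_nbhs M U phi p (N : set (R * R)) : chart M U phi -> U p -> nbhs p N ->
  exists2 O : set E3, open O /\ O (phi p) & M `&` O `<=` phi @` (U `&` N).
Proof.
move=> [oU _ _ _ im] Up nN.
have [||W oW E] := im (U `&` N°); first by apply: openI => //; exact: open_interior.
  by move=> q [].
have : (M `&` W) (phi p) by rewrite -E; exists p.
move=> [_ Wp]; exists W => //; rewrite -E => _ [q [Uq Nq] <-]; exists q => //.
by split => //; exact: interior_subset.
Qed.

Lemma chart_nbhs_near M U phi p (P : E3 -> Prop) : chart M U phi -> U p ->
  (\forall q \near p, P (phi q)) ->
  exists2 O : set E3, open O /\ O (phi p) & forall y, M y -> O y -> P y.
Proof.
move=> c Up nP; have [W oW sub] := chart_nbhs c Up nP; exists W => // y My Wy.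
by have [|q [_ +] <-] := sub y.
Qed.

(** The inverse of a chart is continuous on M, as charts are open onto their
images; outside the image it takes a default value. *)
Lemma chart_inverse M U phi : chart M U phi -> exists k : E3 -> R * R,
  [/\ forall p, U p -> k (phi p) = p,
      forall y, (phi @` U) y -> U (k y) /\ phi (k y) = y &
      forall p, U p -> k y @[y --> within M (nbhs (phi p))] --> p].
Proof.
move=> c; have [oU _ inj _ im] := c.
pose k y := xget (0, 0) [set q | U q /\ phi q = y].
have kP y : (phi @` U) y -> U (k y) /\ phi (k y) = y.
  by move=> [q Uq qy]; rewrite /k; case: xgetP => [z _ //|/(_ q)[]].
have kphi p : U p -> k (phi p) = p.
  move=> Up; have [|Uk pk] := kP (phi p); first by exists p.
  by apply: inj; rewrite ?inE.
exists k; split => // p Up N nN /=.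
have [W [oW Wp] sub] := chart_nbhs c Up nN.
rewrite /fmap /within /=; apply: filterS (open_nbhs_nbhs (conj oW Wp)) => y Wy My.
by have [|q [Uq Nq] <-] := sub y; rewrite //= kphi.
Qed.

Lemma surface_continuous M (u : E3 -> R) : regular_surface M ->
  (forall U phi p, chart M U phi -> U p -> {for p, continuous (u \o phi)}) ->
  {within M, continuous u}.
Proof.
move=> reg cu; apply/subspace_continuousP => x /reg[U [phi [c [p Up <-]]]].
move=> N nN.
have nP : \forall q \near p, N (u (phi q)) by exact: (cu _ _ _ c Up _ nN).
have [W [oW Wp] sub] := chart_nbhs_near (P := fun y => N (u y)) c Up nP.
rewrite /fmap /within /=; apply: filterS (open_nbhs_nbhs (conj oW Wp)) => y Wy My.
exact: sub.
Qed.

Lemma CkM_continuous k M (u : E3 -> R) : regular_surface M -> CkM k M u ->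
  {within M, continuous u}.
Proof.
by move=> reg Cu; apply: surface_continuous => // U phi p c Up; case: k Cu => [|k] /(_ _ _ c)[+ _]; exact.
Qed.

Lemma within_nbhs M (u : E3 -> R) (x : E3) (P : R -> Prop) : {within M, continuous u} ->
  M x -> nbhs (u x) P -> exists2 O : set E3, open O /\ O x & forall y, M y -> O y -> P (u y).
Proof.
move=> /subspace_continuousP cu Mx nP; have := cu x Mx _ nP.
rewrite /fmap /within /= => n.
exists (interior [set y | M y -> P (u y)]); first by split; [exact: open_interior|].
by move=> y My /interior_subset; exact.
Qed.

Lemma within_chart_continuous M U phi p (u : E3 -> R) : {within M, continuous u} ->
  chart M U phi -> U p -> {for p, continuous (u \o phi)}.
Proof.
move=> cu c Up N /= nN; have Mp := chart_in c Up.
have [W [oW Wp] sub] := within_nbhs cu Mp nN.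
have [oU _ _ _ _] := c.
have : \forall q \near p, U q /\ W (phi q).
  exact: chart_preimage c Up oW Wp.
by apply: filterS => q [Uq Wq]; apply: sub => //; exact: chart_in c Uq.
Qed.

Lemma surface_finite_cover M (O : E3 -> set E3) : compact M ->
  (forall x, M x -> open (O x) /\ O x x) ->
  exists2 s : seq E3, (forall x, x \in s -> M x) & (forall x, M x -> exists2 z, z \in s & O z x).
Proof.
rewrite compact_cover => cM hO.
have [||D DM cov] := cM E3 M O; first by move=> x /hO[].
  by move=> x Mx; exists x => //; case: (hO x Mx).
exists (finmap.enum_fset D) => [x xD|x /cov[z zD Oz]]; last by exists z.
by have := DM x xD; rewrite inE.
Qed.

Lemma surface_closed M : compact M -> closed M.
Proof. by apply: compact_closed; exact: norm_hausdorff. Qed.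

Lemma borel3_open (O : set E3) : open O -> measurable (O : set (borel3 R)).
Proof. exact: sub_sigma_algebra. Qed.

Lemma borel3_surface M : compact M -> measurable (M : set (borel3 R)).
Proof.
move=> /surface_closed/closed_openC/borel3_open/measurableC.
by rewrite setCK.
Qed.

Lemma borel3_chart_image M U phi : compact M -> chart M U phi ->
  measurable (phi @` U : set (borel3 R)).
Proof.
move=> cM /chart_image[W oW ->]; apply: measurableI; first exact: borel3_surface.
exact: borel3_open.
Qed.

Lemma surface_measurable_fun M (u : E3 -> R) : compact M -> {within M, continuous u} ->
  measurable_fun (M : set (borel3 R)) (u : borel3 R -> R).
Proof.
move=> cM cu; apply: measurable_fun_gt => a.
pose W := interior [set y | M y -> a < u y].
rewrite [X in measurable X](_ : _ = (M : set (borel3 R)) `&` W).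
  by apply: measurableI; [exact: borel3_surface|apply: borel3_open; exact: open_interior].
apply/seteqP; split => [x [Mx ax]|x [Mx Wx]]; split => //; last exact: (interior_subset Wx).
have [Z [oO Ox] sub] := within_nbhs cu Mx (lt_nbhsr ax).
by rewrite /W /interior; apply: filterS (open_nbhs_nbhs (conj oO Ox)) => y Oy My; exact: sub.
Qed.

Lemma chart_measurable_fun M U phi : chart M U phi ->
  measurable_fun (U : set P2) (phi : P2 -> borel3 R).
Proof.
move=> c; have [oU _ _ _ _] := c; apply: (@measurability _ _ P2 (borel3 R) U phi (@open E3) erefl).
move=> _ [W oW <-]; apply: open_measurable2.
rewrite openE => p [Up Wp]; exact: (chart_preimage c Up oW Wp).
Qed.

End ChartTopology.

(** * The first fundamental form *)
Section GramMatrix.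
Context {R : realType}.
Local Notation E3 := 'rV[R]_3.

Lemma ord3E (F : 'I_3 -> R) : \sum_i F i = F ord0 + F (inord 1) + F ord_max.
Proof.
rewrite !big_ord_recl big_ord0 addr0 addrA; congr (_ + F _ + F _);
  by apply: val_inj; rewrite /= ?inordK.
Qed.

Lemma ord2E (V : nmodType) (F : 'I_2 -> V) : \sum_i F i = F ord0 + F ord_max.
Proof.
by rewrite !big_ord_recl big_ord0 addr0; congr (_ + F _); apply: val_inj.
Qed.

Lemma dotC (x y : E3) : dot x y = dot y x.
Proof. by apply: eq_bigr => i _; rewrite mulrC. Qed.

Lemma dotDl (x y z : E3) : dot (x + y) z = dot x z + dot y z.
Proof. by rewrite -big_split /=; apply: eq_bigr => i _; rewrite mxE mulrDl. Qed.

Lemma dotZl (a : R) (x z : E3) : dot (a *: x) z = a * dot x z.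
Proof. by rewrite mulr_sumr; apply: eq_bigr => i _; rewrite mxE mulrA. Qed.

Lemma dotDr (x y z : E3) : dot z (x + y) = dot z x + dot z y.
Proof. by rewrite dotC dotDl !(dotC z). Qed.

Lemma dotZr (a : R) (x z : E3) : dot z (a *: x) = a * dot z x.
Proof. by rewrite dotC dotZl dotC. Qed.

Lemma dotNl (x z : E3) : dot (- x) z = - dot x z.
Proof. by rewrite -scaleN1r dotZl mulN1r. Qed.

Lemma dotNr (x z : E3) : dot z (- x) = - dot z x.
Proof. by rewrite dotC dotNl dotC. Qed.

Lemma dot0l (z : E3) : dot 0 z = 0.
Proof. by rewrite /dot big1// => i _; rewrite mxE mul0r. Qed.

Lemma dot_ge0 (x : E3) : 0 <= dot x x.
Proof. by apply: sumr_ge0 => i _; rewrite -expr2 sqr_ge0. Qed.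

Lemma dot_eq0 (x : E3) : dot x x = 0 -> x = 0.
Proof.
move=> /eqP; rewrite psumr_eq0 => [/allP h|i _]; last by rewrite -expr2 sqr_ge0.
apply/rowP => i; rewrite mxE; have := h i (mem_index_enum _).
by rewrite /= mulf_eq0 => /orP[] /eqP.
Qed.

Lemma dotE (x y : E3) : dot x y = (x *m y^T) 0 0.
Proof. by rewrite mxE; apply: eq_bigr => i _; rewrite mxE. Qed.

(** A crude Cauchy-Schwarz inequality, enough for the product of two square
integrable fields to be integrable. *)
Lemma normr_dot_le (x y : E3) : `|dot x y| <= dot x x + dot y y.
Proof.
have h1 : 0 <= dot (x + y) (x + y) by exact: dot_ge0.
have h2 : 0 <= dot (x + (- y)) (x + (- y)) by exact: dot_ge0.
have hx := dot_ge0 x; have hy := dot_ge0 y.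
move: h1 h2; rewrite !(dotDl, dotDr) !(dotNl, dotNr) (dotC y x) => h1 h2.
by rewrite ler_norml; apply/andP; split; lra.
Qed.

Lemma det2E (A : 'M[R]_2) :
  \det A = A ord0 ord0 * A ord_max ord_max - A ord0 ord_max * A ord_max ord0.
Proof.
rewrite (expand_det_row _ ord0) ord2E /cofactor !det_mx11 !mxE /=.
rewrite expr0 expr1 mul1r mulN1r mulrN; congr (_ * A _ _ - _ * A _ _); exact: val_inj.
Qed.

(** The adjugate formula: it shows that the inverse metric is C^1, which the
general matrix inverse hides. *)
Definition inv2 (A : 'M[R]_2) : 'M[R]_2 :=
  \matrix_(i, j) ((\det A)^-1 *
    (if i == j then A (rev_ord i) (rev_ord i) else - A i j)).

Lemma invmx2E (A : 'M[R]_2) : \det A != 0 -> invmx A = inv2 A.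
Proof.
move=> dA; have uA : A \in unitmx by rewrite unitmxE unitfE.
suff E : inv2 A *m A = 1%:M by rewrite -[LHS]mul1mx -E mulmxK.
have r0 : rev_ord (ord0 : 'I_2) = ord_max by exact: val_inj.
have r1 : rev_ord (ord_max : 'I_2) = ord0 by exact: val_inj.
have hd := det2E A.
apply/matrixP => i j; rewrite !mxE ord2E !mxE.
by have [->|->] := ord2_cases i; have [->|->] := ord2_cases j;
  rewrite /= ?r0 ?r1 -!mulrA -mulrDr; apply: (mulfI dA); rewrite mulVKf// hd; ring.
Qed.

Implicit Types (J : 'M[R]_(2, 3)).

Lemma gramE J i j : (J *m J^T) i j = dot (row i J) (row j J).
Proof. by rewrite mxE; apply: eq_bigr => k _; rewrite !mxE. Qed.

(** By Lagrange's identity the Gram determinant is the squared norm of the cross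
product; it is nonzero since v J J^T = 0 gives |v J|^2 = 0. *)
Lemma gram_det_gt0 J : row_free J -> 0 < \det (J *m J^T).
Proof.
move=> fJ; rewrite lt_def; apply/andP; split; last first.
  rewrite det2E !mxE !ord3E !mxE.
  set a0 := J _ _; set a1 := J _ _; set a2 := J _ _.
  set b0 := J ord_max _; set b1 := J ord_max _; set b2 := J ord_max _.
  rewrite [leRHS](_ : _ = (a0 * b1 - a1 * b0) ^+ 2 + (a0 * b2 - a2 * b0) ^+ 2
    + (a1 * b2 - a2 * b1) ^+ 2); last by ring.
  by rewrite !addr_ge0// sqr_ge0.
rewrite -unitfE -unitmxE -row_free_unit; apply/row_freeP.
have ker0 : kermx (J *m J^T) = 0.
  apply/row_matrixP => i; rewrite row0; set v := row i _.
  have vJ0 : v *m (J *m J^T) = 0 by rewrite -row_mul mulmx_ker row0.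
  have : v *m J = 0.
    apply: dot_eq0; rewrite dotE trmx_mul.
    by rewrite mulmxA -(mulmxA v) vJ0 mul0mx mxE.
  by move=> /eqP; rewrite mulmx_free_eq0// => /eqP.
by apply/row_freeP; rewrite -kermx_eq0 ker0.
Qed.

Lemma gram_unit J : row_free J -> J *m J^T \in unitmx.
Proof. by move=> /gram_det_gt0 d; rewrite unitmxE unitfE gt_eqF. Qed.

(** A vector of the row space of J is determined by its products with the rows of
J; [tangent_vector] rebuilds it from them through the inverse metric. *)
Definition tangent_coords J (G : E3) : 'rV[R]_2 := G *m J^T.

Definition tangent_vector J (w : 'rV[R]_2) : E3 := w *m invmx (J *m J^T) *m J.

Lemma tangent_vectorK J w : row_free J -> tangent_coords J (tangent_vector J w) = w.
Proof.
by move=> /gram_unit uJ; rewrite /tangent_coords /tangent_vector -!mulmxA mulVmx// mulmx1.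
Qed.

Lemma tangent_vector_sub J w : (tangent_vector J w <= J)%MS.
Proof. exact: submxMl. Qed.

Lemma tangent_coordsK J G : row_free J -> (G <= J)%MS ->
  tangent_vector J (tangent_coords J G) = G.
Proof.
move=> /gram_unit uJ /submxP[w ->]; rewrite /tangent_vector /tangent_coords.
by rewrite -(mulmxA w J) -(mulmxA w (J *m _)) mulmxV// mulmx1.
Qed.

Lemma tangent_dot J G G' : row_free J -> (G <= J)%MS ->
  dot G G' = (tangent_coords J G' *m (invmx (J *m J^T))^T *m (tangent_coords J G)^T) 0 0.
Proof.
move=> fJ GJ; rewrite -{1}(tangent_coordsK fJ GJ) dotC dotE.
by rewrite /tangent_vector !trmx_mul !mulmxA.
Qed.

Lemma tangent_coordsE J G i : tangent_coords J G 0 i = dot G (row i J).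
Proof. by rewrite mxE; apply: eq_bigr => k _; rewrite !mxE. Qed.

End GramMatrix.

(** * Calculus in a chart *)
Section ChartCalculus.
Context {R : realType}.
Local Notation E3 := 'rV[R]_3.
Local Notation P2 := (measurableTypeR R * measurableTypeR R)%type.
Local Notation leb2 := (@lebesgue2 R : {measure set P2 -> \bar R}).
Implicit Types (M : set E3) (U : set (R * R)) (phi : R * R -> E3) (p : R * R).

Lemma coord_cvg (T : Type) (F : set_system T) (FF : Filter F) (g : T -> E3) (y : E3)
  (k : 'I_3) : g x @[x --> F] --> y -> g x 0 k @[x --> F] --> y 0 k.
Proof. move=> gy; exact: (cvg_comp _ _ gy (@coord_continuous R 1 3 0 k y)). Qed.

Lemma is_derive_coord phi p v (k : 'I_3) : derivable phi p v ->
  is_derive p v (fun q => phi q 0 k) ('D_v phi p 0 k).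
Proof.
move=> dphi.
have lim : h^-1 *: (((fun q => phi q 0 k) \o shift p) (h *: v) - phi p 0 k)
    @[h --> 0^'] --> 'D_v phi p 0 k.
  have E : (fun h : R => h^-1 *: (((fun q => phi q 0 k) \o shift p) (h *: v) - phi p 0 k)) =
     (fun A : E3 => A 0 k) \o (fun h : R => h^-1 *: ((phi \o shift p) (h *: v) - phi p)).
    by apply/funext => h /=; rewrite !mxE.
  have d : (fun h : R => h^-1 *: ((phi \o shift p) (h *: v) - phi p)) @ 0^'
      --> 'D_v phi p by exact: dphi.
  by rewrite E; exact: coord_cvg d.
by split; [apply/cvg_ex; exists ('D_v phi p 0 k)|exact: cvg_lim].
Qed.

Lemma pd_coord U phi p i (k : 'I_3) : Ck 1 U phi -> U p ->
  pd i (fun q => phi q 0 k) p = pd i phi p 0 k.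
Proof.
by move=> [_ C] Up; have [d _] := C i; apply: derive_val; exact: is_derive_coord (d p Up).
Qed.

Lemma Ck1_coord U phi (k : 'I_3) : open U -> Ck 1 U phi ->
  Ck 1 U (fun q => phi q 0 k).
Proof.
move=> oU Cphi; have [c C] := Cphi; split => [p Up|i].
  by apply: coord_cvg; exact: (c p Up).
have [d [cd _]] := C i; split => [p Up|].
  by have [] := is_derive_coord k (d p Up).
split=> // p Up; apply: (@continuous_near_eq _ _ (fun q => pd i phi q 0 k)).
  by apply: (open_near oU Up) => q Uq; rewrite (pd_coord i k Cphi Uq).
by apply: coord_cvg; exact: (cd p Up).
Qed.

Lemma chart_Ck1 M U phi : chart M U phi -> Ck 1 U phi.
Proof. by move=> [_ /(_ 1%N)]. Qed.

Lemma chart_Ck1_pd M U phi i : chart M U phi -> Ck 1 U (pd i phi).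
Proof. by move=> [_ /(_ 2%N)[_ /(_ i)[]]]. Qed.

Lemma Ck1_dot U (a b : R * R -> E3) : open U -> Ck 1 U a -> Ck 1 U b ->
  Ck 1 U (fun p => dot (a p) (b p)).
Proof.
move=> oU Ca Cb; apply: Ck1_sum => // k.
by apply: (Ck1M oU); exact: Ck1_coord.
Qed.

Lemma row_jac phi p i : row i (jac phi p) = pd i phi p.
Proof. by rewrite /jac rowK. Qed.

Lemma metricE phi p i j : metric phi p i j = dot (pd i phi p) (pd j phi p).
Proof. by rewrite /metric gramE !row_jac. Qed.

Lemma Ck1_metric M U phi i j : chart M U phi -> Ck 1 U (fun p => metric phi p i j).
Proof.
move=> c; have [oU _ _ _ _] := c.
apply: (Ck1_eq_on oU _ (Ck1_dot oU (chart_Ck1_pd i c) (chart_Ck1_pd j c))) => p _.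
exact: metricE.
Qed.

Lemma chart_row_free M U phi p : chart M U phi -> U p -> row_free (jac phi p).
Proof. by move=> [_ _ _ + _]; exact. Qed.

Lemma det_metric_gt0 M U phi p : chart M U phi -> U p -> 0 < \det (metric phi p).
Proof. by move=> c Up; apply/gram_det_gt0/chart_row_free; [exact: c|]. Qed.

Lemma Ck1_det_metric M U phi : chart M U phi -> Ck 1 U (fun p => \det (metric phi p)).
Proof.
move=> c; have [oU _ _ _ _] := c.
pose g i j p := metric phi p i j.
have Cg i j : Ck 1 U (g i j) by exact: Ck1_metric c.
apply: (Ck1_eq_on oU (h := (g ord0 ord0 \* g ord_max ord_max) \+
   (fun p => (-1) * (g ord0 ord_max p * g ord_max ord0 p)))) => [p _|].
  by rewrite det2E /= mulN1r.
by apply: (Ck1D oU); [|apply: (Ck1Ml _ oU)]; apply: (Ck1M oU).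
Qed.

Lemma area_density_gt0 M U phi p : chart M U phi -> U p -> 0 < area_density phi p.
Proof. by move=> c Up; rewrite sqrtr_gt0; exact: (det_metric_gt0 c Up). Qed.

Lemma Ck1_area_density M U phi : chart M U phi -> Ck 1 U (area_density phi).
Proof.
move=> c; have [oU _ _ _ _] := c.
apply: (Ck1_comp (th := Num.sqrt) (th' := fun x => (2 * Num.sqrt x)^-1) oU (Ck1_det_metric c)) => p Up.
  by apply: is_derive1_sqrt; exact: (det_metric_gt0 c Up).
have s0 : Num.sqrt (\det (metric phi p)) != 0.
  by rewrite gt_eqF// sqrtr_gt0; exact: (det_metric_gt0 c Up).
apply: cvgV; first by rewrite mulf_neq0.
by apply: cvgM; [exact: cvg_cst|exact: sqrt_continuous].
Qed.

Lemma Ck1_invmx_metric M U phi i j : chart M U phi ->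
  Ck 1 U (fun p => invmx (metric phi p) i j).
Proof.
move=> c; have [oU _ _ _ _] := c.
have CV : Ck 1 U (fun p => (\det (metric phi p))^-1).
  apply: (Ck1V oU (Ck1_det_metric c)) => p Up.
  by rewrite gt_eqF//; exact: (det_metric_gt0 c Up).
pose h p := if i == j then metric phi p (rev_ord i) (rev_ord i)
  else (-1) * metric phi p i j.
have Ch : Ck 1 U h.
  rewrite /h; case: (i == j); first exact: Ck1_metric c.
  by apply: (Ck1Ml _ oU); exact: Ck1_metric c.
apply: (Ck1_eq_on oU _ (Ck1M oU CV Ch)) => p Up.
rewrite invmx2E ?gt_eqF//; last exact: (det_metric_gt0 c Up).
by rewrite mxE /= /h; case: ifP => // _; rewrite mulN1r.
Qed.

(** The i-th component of sqrt(det g) times the gradient of f, whose plane divergence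
is sqrt(det g) times the Laplacian. *)
Definition flux phi (f : E3 -> R) (i : 'I_2) p : R :=
  area_density phi p * \sum_j (invmx (metric phi p)) i j * pd j (f \o phi) p.

Lemma Ck1_flux M U phi (f : E3 -> R) i : chart M U phi -> CkM 2 M f ->
  Ck 1 U (flux phi f i).
Proof.
move=> c Cf; have [oU _ _ _ _] := c.
apply: (Ck1M oU (Ck1_area_density c)); apply: Ck1_sum => // j.
apply: (Ck1M oU (Ck1_invmx_metric i j c)).
by have [_ /(_ j)[_]] := Cf U phi c.
Qed.

Lemma diff_pd (g : R * R -> R) q (v : R * R) : differentiable g q ->
  'd g q v = v.1 * pd ord0 g q + v.2 * pd ord_max g q.
Proof.
move=> dg; rewrite !pd_diffE//.
have -> : v = v.1 *: basis2 ord0 + v.2 *: basis2 ord_max.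
  case: v => a b; rewrite basis20 basis21 /=.
  by congr (_, _); rewrite /= /GRing.scale /= ?mulr1 ?mulr0 ?addr0 ?add0r.
rewrite linearD !linearZ /=.
by rewrite /GRing.scale /= !mulr1 !mulr0 addr0 add0r.
Qed.

(** A continuous curve z is differentiable as soon as Psi o z is, if d Psi is the
identity at z 0: z t - z 0 differs from Psi (z t) - Psi (z 0) by a small
fraction of itself, so both are O(t) and the error is o(t).  This replaces the
inverse function theorem in the comparison of two charts. *)
Lemma derivable_of_left_inverse (V : normedModType R) (Psi : V -> V) (z : R -> V) :
  {for 0, continuous z} -> differentiable Psi (z 0) ->
  'd Psi (z 0) = id :> (V -> V) -> derivable (Psi \o z) 0 1 -> derivable z 0 1.
Proof.
move=> cz dPsi dPsi1 dc; set c := Psi \o z; set c' := 'D_1 c 0.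
have dcl : h^-1 *: (c (h *: 1 + 0) - c 0) @[h --> 0^'] --> c' by exact: dc.
pose C : R := `|c'| + 1; have C0 : 0 < C by rewrite ltr_wpDl.
have small (eta : R) : 0 < eta ->
    \forall t \near 0^', `|z t - z 0 - (c t - c 0)| <= eta * `|z t - z 0|.
  move=> eta0.
  have /eqaddoP/(_ _ eta0) near0 := diff_locally dPsi.
  have cz' : z t @[t --> (0 : R)] --> z 0 by exact: cz.
  have cz0 : z t - z 0 @[t --> (0 : R)] --> (0 : V).
    by rewrite -(subrr (z 0)); apply: cvgB => //; exact: cvg_cst.
  have n0 : \forall t \near (0 : R), `|(Psi \o shift (z 0) -
      (cst (Psi (z 0)) + ('d Psi (z 0) : V -> V))) (z t - z 0)| <= eta * `|z t - z 0|.
    exact: (cz0 _ near0).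
  apply: nbhs_dnbhs; apply: filterS n0 => t.
  by rewrite dPsi1 !fctE /= subrK opprD addrA distrC.
apply/cvg_ex; exists c'; apply/cvgrPdist_le => e e0.
(* 1/2 absorbs the error into |z t - z 0|, giving |z t - z 0| <= 2 C |t|; then
   e / (4 C) makes the error at most e |t| / 2. *)
pose eta := Num.min (1 / 2) (e / (4 * C)).
have eta0 : 0 < eta by rewrite lt_min !divr_gt0// mulr_gt0.
near=> t.
have t0 : t != 0 by near: t; exact: nbhs_dnbhs_neq.
have h1 : `|z t - z 0 - (c t - c 0)| <= eta * `|z t - z 0| by near: t; exact: small.
have h2 : `|c' - t^-1 *: (c (t *: 1 + 0) - c 0)| <= Num.min 1 (e / 2).
  near: t; move/cvgrPdist_le : dcl; apply; by rewrite lt_min ltr01 divr_gt0.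
rewrite /= addr0 [t *: 1]mulr1 in h2 *.
have n3 : `|c t - c 0| <= C * `|t|.
  have -> : c t - c 0 = t *: (t^-1 *: (c t - c 0)) by rewrite scalerA divff// scale1r.
  rewrite normrZ mulrC ler_wpM2r//.
  rewrite -[X in `|X|](subKr c') (le_trans (ler_normB _ _))// lerD2l.
  by rewrite (le_trans h2)// ge_min lexx.
have n4 : `|z t - z 0| <= 2 * `|c t - c 0|.
  have : `|z t - z 0| <= `|z t - z 0 - (c t - c 0)| + `|c t - c 0|.
    by rewrite -{1}(subrK (c t - c 0) (z t - z 0)) ler_normD.
  have : eta * `|z t - z 0| <= 1 / 2 * `|z t - z 0|.
    by rewrite ler_wpM2r// ge_min lexx.
  by move: h1; lra.
have -> : c' - t^-1 *: (z t - z 0) =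
   (c' - t^-1 *: (c t - c 0)) - t^-1 *: (z t - z 0 - (c t - c 0)).
  by rewrite (scalerBr _ (z t - z 0)) opprB addrA subrK.
rewrite (le_trans (ler_normB _ _))// [leRHS]splitr lerD//.
  by rewrite (le_trans h2)// ge_min lexx orbT.
rewrite normrZ normfV ler_pdivrMl ?normr_gt0//.
rewrite (le_trans h1)//.
apply: (@le_trans _ _ (e / (4 * C) * (2 * (C * `|t|)))).
  apply: ler_pM => //; first exact: ltW.
    by rewrite ge_min lexx orbT.
  by rewrite (le_trans n4)// ler_pM2l.
rewrite le_eqVlt; apply/orP; left; apply/eqP.
have Cn : C != 0 by rewrite gt_eqF.
clear -Cn; field; exact: Cn.
Unshelve. all: by end_near.
Qed.

End ChartCalculus.

(** * The gradient of a function of class C^1 *)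
Section Gradient.
Context {R : realType}.
Local Notation E3 := 'rV[R]_3.
Implicit Types (M : set E3) (U : set (R * R)) (phi : R * R -> E3) (p : R * R).

Lemma derive_line (V W : normedModType R) (f : V -> W) (x v : V) :
  'D_v f x = 'D_1 (fun t : R => f (t *: v + x)) 0.
Proof.
have E : (fun h : R => h^-1 *: ((f \o shift x) (h *: v) - f x)) =
    (fun h : R => h^-1 *: (((fun t : R => f (t *: v + x)) \o shift 0) (h *: 1) -
                          f (0 *: v + x))).
  by apply/funext => h /=; rewrite [h *: 1]mulr1 addr0 scale0r add0r.
by rewrite /derive E.
Qed.

(** The i-th coordinate direction of the first chart is a vector a in the second
one, the same for all functions: a is the velocity at 0 of the transition curve
z(t) = phi2^(-1) (phi1 (p + t e_i)).  That curve is known only to be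
continuous; composing phi2 with the linear left inverse L of its differential
gives a map Psi with d Psi = id at q and Psi o z = L o phi1 along the line,
which is differentiable. *)
Lemma chart_change_dir M U1 phi1 U2 phi2 p q i :
  chart M U1 phi1 -> chart M U2 phi2 -> U1 p -> U2 q -> phi1 p = phi2 q ->
  exists a : R * R, forall g : E3 -> R, Ck 1 U2 (g \o phi2) ->
    pd i (g \o phi1) p = a.1 * pd ord0 (g \o phi2) q + a.2 * pd ord_max (g \o phi2) q.
Proof.
move=> c1 c2 U1p U2q pq.
have [oU1 _ _ _ _] := c1; have [oU2 _ _ _ _] := c2.
have [k [kphi phik kcont]] := chart_inverse c2.
pose L : 'M[R]_(3, 2) := (jac phi2 q)^T *m invmx (metric phi2 q).
have JL : jac phi2 q *m L = 1%:M.
  by rewrite /L mulmxA mulmxV//; apply/gram_unit/(chart_row_free c2 U2q).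
pose comb (phi : R * R -> E3) j p := \sum_l phi p 0 l * L l j.
have Ccomb U phi j : open U -> Ck 1 U phi -> Ck 1 U (comb phi j).
  move=> oU Cphi; apply: Ck1_sum => // l; apply: (Ck1M oU); first exact: Ck1_coord.
  exact: Ck1_cst.
have pdcomb l j : pd l (comb phi2 j) q = (l == j)%:R.
  transitivity ((jac phi2 q *m L) l j); last by rewrite JL mxE.
  rewrite (pd_sum l (F := fun m p => phi2 p 0 m * L m j) _ oU2 _ U2q).
    rewrite mxE; apply: eq_bigr => m _.
    rewrite (pdM l oU2 (Ck1_coord m oU2 (chart_Ck1 c2)) (Ck1_cst (L m j) oU2) U2q).
    rewrite pd_cst mulr0 add0r (pd_coord l m (chart_Ck1 c2) U2q) mulrC.
    by rewrite -row_jac !mxE.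
  move=> m; apply: (Ck1M oU2); last exact: Ck1_cst.
  by apply: Ck1_coord => //; exact: chart_Ck1 c2.
pose Psi p := (comb phi2 ord0 p, comb phi2 ord_max p).
pose z (t : R) := k (phi1 (t *: basis2 i + p)).
have line_diff : differentiable (fun t : R => t *: basis2 i + p) (0 : R).
  by apply: differentiableD => //.
have line_cvg : (fun t : R => t *: basis2 i + p) @ (0 : R) --> p.
  by have := differentiable_continuous line_diff; rewrite /prop_for /continuous_at scale0r add0r.
have z0 : z 0 = q by rewrite /z scale0r add0r pq kphi.
have cz : {for 0, continuous z}.
  move=> N; rewrite z0 => nN.
  have [W [oW Wq] sub] := chart_nbhs c2 U2q nN.
  have Wp : W (phi1 p) by rewrite pq.
  have Hn : \forall t \near (0 : R), U1 (t *: basis2 i + p) /\ W (phi1 (t *: basis2 i + p)).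
    exact: (line_cvg _ (chart_preimage c1 U1p oW Wp)).
  suff : \forall t \near (0 : R), N (z t) by [].
  apply: filterS Hn => t [U1t Wt].
  have [|s [U2s Ns] st] := sub (phi1 (t *: basis2 i + p)).
    by split => //; exact: (chart_in c1 U1t).
  by rewrite /z -st kphi.
have near_z : \forall t \near (0 : R), phi2 (z t) = phi1 (t *: basis2 i + p).
  have [W oW EW] := chart_image c2.
  have Wp : W (phi1 p).
    by have : (phi2 @` U2) (phi2 q) by [exists q]; rewrite EW pq => -[].
  have Hn : \forall t \near (0 : R), U1 (t *: basis2 i + p) /\ W (phi1 (t *: basis2 i + p)).
    exact: (line_cvg _ (chart_preimage c1 U1p oW Wp)).
  apply: filterS Hn => t [U1t Wt].
  by apply: (phik _ _).2; rewrite EW; split => //; exact: (chart_in c1 U1t).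
have dPsi : differentiable Psi q.
  apply: differentiable_pair; apply: (Ck1_differentiable oU2 _ U2q);
    by apply: Ccomb => //; exact: chart_Ck1 c2.
have dcomb j : differentiable (comb phi2 j) q.
  by apply: (Ck1_differentiable oU2 _ U2q); apply: Ccomb => //; exact: chart_Ck1 c2.
have dPsi1 : 'd Psi q = id :> (R * R -> R * R).
  rewrite diff_pair//; apply/funext => -[v1 v2].
  by rewrite !diff_pd// !pdcomb /= !(mulr1, mulr0) addr0 add0r.
have dPsiz : derivable (Psi \o z) 0 1.
  apply: (near_eq_derivable (f := fun t : R => (comb phi1 ord0 (t *: basis2 i + p),
      comb phi1 ord_max (t *: basis2 i + p)))).
    by apply: filterS near_z => t /= zt; rewrite /Psi /comb zt.
  apply/derivable1_diffP.
  have dc j : differentiable (comb phi1 j) p.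
    by apply: (Ck1_differentiable oU1 _ U1p); apply: Ccomb => //; exact: chart_Ck1 c1.
  by apply: differentiable_pair; apply: (differentiable_comp line_diff);
    rewrite scale0r add0r.
have dz : derivable z 0 1.
  by apply: (derivable_of_left_inverse cz _ _ dPsiz); rewrite z0.
exists ('D_1 z 0) => g Cg.
have dg : differentiable (g \o phi2) (z 0).
  by rewrite z0; exact: (Ck1_differentiable oU2 Cg U2q).
have dz' : differentiable z 0 by apply/derivable1_diffP.
rewrite -(diff_pd _ (Ck1_differentiable oU2 Cg U2q)) -z0.
rewrite /pd derive_line (@near_eq_derive _ _ _ _ ((g \o phi2) \o z)); last first.
  by apply: filterS near_z => t /= ->.
rewrite deriveE; last exact: differentiable_comp.
by rewrite diff_comp//= (deriveE _ dz').
Qed.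

Lemma chart_change M U1 phi1 U2 phi2 p q :
  chart M U1 phi1 -> chart M U2 phi2 -> U1 p -> U2 q -> phi1 p = phi2 q ->
  exists A : 'M[R]_2, forall g : E3 -> R, Ck 1 U2 (g \o phi2) ->
    forall i, pd i (g \o phi1) p = \sum_l A i l * pd l (g \o phi2) q.
Proof.
move=> c1 c2 U1p U2q pq.
have [a /= aE] := chart_change_dir ord0 c1 c2 U1p U2q pq.
have [b /= bE] := chart_change_dir ord_max c1 c2 U1p U2q pq.
exists (\matrix_(i, l) let v := if i == ord0 then a else b in
         if l == ord0 then v.1 else v.2) => g Cg i.
by rewrite ord2E !mxE /=; have [->|->] := ord2_cases i => /=; [exact: aE|exact: bE].
Qed.

Lemma jac_coord U phi p i (k : 'I_3) : Ck 1 U phi -> U p ->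
  jac phi p i k = pd i ((fun y : E3 => y 0 k) \o phi) p.
Proof. by move=> Cphi Up; rewrite (pd_coord i k Cphi Up) -row_jac [RHS]mxE. Qed.

Definition partials phi (h : E3 -> R) p : 'rV[R]_2 := \row_i pd i (h \o phi) p.

Definition chart_grad phi (h : E3 -> R) p : E3 :=
  tangent_vector (jac phi p) (partials phi h p).

(** Changing charts multiplies the tangent vectors and the partial derivatives by
the same matrix A, so the vector with the given products with the tangent
vectors is the same. *)
Lemma chart_grad_change M U1 phi1 U2 phi2 p q (h : E3 -> R) :
  chart M U1 phi1 -> chart M U2 phi2 -> U1 p -> U2 q -> phi1 p = phi2 q ->
  CkM 1 M h -> chart_grad phi1 h p = chart_grad phi2 h q.
Proof.
move=> c1 c2 U1p U2q pq Ch.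
have [A AE] := chart_change c1 c2 U1p U2q pq.
have fJ1 := chart_row_free c1 U1p; have fJ2 := chart_row_free c2 U2q.
have oU2 : open U2 by case: c2.
have J1 : jac phi1 p = A *m jac phi2 q.
  apply/matrixP => i k; rewrite [RHS]mxE (jac_coord i k (chart_Ck1 c1) U1p) AE.
    by apply: eq_bigr => l _; rewrite (jac_coord l k (chart_Ck1 c2) U2q).
  exact: (Ck1_coord k oU2 (chart_Ck1 c2)).
have D1 : partials phi1 h p = partials phi2 h q *m A^T.
  apply/rowP => i; rewrite mxE (AE h (Ch _ _ c2)) mxE.
  by apply: eq_bigr => l _; rewrite !mxE mulrC.
have sub : (chart_grad phi2 h q <= jac phi1 p)%MS.
  have : (jac phi1 p <= jac phi2 q)%MS by rewrite J1 submxMl.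
  move=> /mxrank_leqif_eq/geq_leqif; rewrite (eqP fJ1) (eqP fJ2) leqnn => /esym/andP[_ J21].
  exact: submx_trans (tangent_vector_sub _ _) J21.
rewrite -[RHS](tangent_coordsK fJ1 sub); congr tangent_vector.
by rewrite D1 /tangent_coords J1 trmx_mul mulmxA -/(tangent_coords _ _) tangent_vectorK.
Qed.

Definition grad M (h : E3 -> R) (x : E3) : E3 :=
  xget 0 [set v | exists U phi p, [/\ chart M U phi, U p, phi p = x & v = chart_grad phi h p]].

Lemma gradE M h U phi p : CkM 1 M h -> chart M U phi -> U p ->
  grad M h (phi p) = chart_grad phi h p.
Proof.
move=> Ch c Up; rewrite /grad; case: xgetP => [v _ [U' [phi' [p' [c' Up' pp ->]]]]|].
  exact: chart_grad_change c' c Up' Up pp Ch.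
by move=> /(_ (chart_grad phi h p))[]; exists U, phi, p.
Qed.

Lemma grad_tangent M h : CkM 1 M h -> tangent_field M (grad M h).
Proof. by move=> Ch U phi c p Up; rewrite (gradE Ch c Up) tangent_vector_sub. Qed.

Lemma dot_grad M h U phi p i : CkM 1 M h -> chart M U phi -> U p ->
  dot (grad M h (phi p)) (pd i phi p) = pd i (h \o phi) p.
Proof.
move=> Ch c Up; rewrite (gradE Ch c Up) -row_jac -tangent_coordsE tangent_vectorK.
  by rewrite mxE.
exact: chart_row_free c Up.
Qed.

Lemma sum_continuous (T : topologicalType) (I : Type) (s : seq I) (F : I -> T -> R) (p : T) :
  (forall k, {for p, continuous (F k)}) ->
  {for p, continuous (fun q => \sum_(k <- s) F k q)}.
Proof.
move=> cF; elim: s => [|k s IH].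
  have -> : (fun q => \sum_(k <- [::]) F k q) = cst 0.
    by apply/funext => q; rewrite big_nil.
  exact: cvg_cst.
have -> : (fun q => \sum_(k <- k :: s) F k q) = (fun q => F k q + \sum_(k <- s) F k q).
  by apply/funext => q; rewrite big_cons.
by apply: cvgD; [exact: cF|exact: IH].
Qed.

Lemma grad_continuous M h U phi p (k : 'I_3) : CkM 1 M h -> chart M U phi -> U p ->
  {for p, continuous ((fun x => grad M h x 0 k) \o phi)}.
Proof.
move=> Ch c Up; have oU : open U by case: c.
apply: (@continuous_near_eq _ _ (fun q => \sum_j (\sum_i pd i (h \o phi) q *
    invmx (metric phi q) i j) * pd j phi q 0 k)).
  apply: (open_near oU Up) => q Uq /=; rewrite (gradE Ch c Uq) mxE.
  apply: eq_bigr => j _; rewrite -row_jac [in RHS]mxE mxE; congr (_ * _).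
  by apply: eq_bigr => i _; rewrite mxE.
have CJ j : Ck 1 U (fun q => pd j phi q 0 k).
  by apply: Ck1_coord => //; exact: chart_Ck1_pd c.
apply: sum_continuous => j.
have cj : {for p, continuous (fun q => \sum_i pd i (h \o phi) q *
    invmx (metric phi q) i j)}.
  apply: sum_continuous => i; apply: cvgM.
    exact: (Ck1_pd_continuous (Ch U phi c) Up).
  exact: (Ck1_continuous (Ck1_invmx_metric i j c) Up).
by apply: cvgM; [exact: cj|exact: (Ck1_continuous (CJ j) Up)].
Qed.

End Gradient.

(** * The area measure *)
Section SurfaceMeasure.
Context {R : realType}.
Local Notation E3 := 'rV[R]_3.
Local Notation B3 := (borel3 R).
Local Notation P2 := (measurableTypeR R * measurableTypeR R)%type.
Local Notation leb2 := (@lebesgue2 R : {measure set P2 -> \bar R}).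
Variables (M : set E3) (sigma : {measure set B3 -> \bar R}).
Hypotheses (cM : compact M) (reg : regular_surface M) (area : is_area_measure M sigma).
Implicit Types (U : set (R * R)) (phi : R * R -> E3) (p : R * R).

Let mM : measurable (M : set B3). Proof. exact: borel3_surface. Qed.

Lemma chart_open U phi : chart M U phi -> open U. Proof. by case. Qed.

Lemma area_density_measurable U phi : chart M U phi ->
  measurable_fun (U : set P2) (area_density phi).
Proof.
move=> c; apply: continuous_measurable2; first exact: (chart_open c).
by move=> p Up; exact: (Ck1_continuous (Ck1_area_density c) Up).
Qed.

Section InChart.
Variables (U : set (R * R)) (phi : R * R -> E3).
Hypothesis c : chart M U phi.

Let mU : measurable (U : set P2).
Proof. exact: open_measurable2 (chart_open c). Qed.
Let mS : measurable (phi @` U : set B3). Proof. exact: borel3_chart_image c. Qed.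
Let mphi := chart_measurable_fun c.
Let phiU p : U p -> (phi @` U) (phi p). Proof. by move=> Up; exists p. Qed.
Let rho0 p : U p -> 0 <= area_density phi p.
Proof. by move=> Up; exact/ltW/(area_density_gt0 c Up). Qed.
Let mrho := area_density_measurable c.
Let sE (A : set B3) : measurable A -> A `<=` phi @` U ->
  sigma A = (\int[leb2]_(p in U `&` phi @^-1` A) (area_density phi p)%:E)%E.
Proof. by case: area => _ /(_ U phi c); exact. Qed.

Lemma chart_Rintegral (g : E3 -> R) : measurable_fun (phi @` U : set B3) (g : B3 -> R) ->
  \int[sigma]_(y in phi @` U) g y = \int[leb2]_(p in U) (g (phi p) * area_density phi p).
Proof. exact: (Rintegral_change_of_variables mU mS mphi phiU mrho rho0 sE). Qed.

Lemma chart_integrable (g : E3 -> R) : measurable_fun (phi @` U : set B3) (g : B3 -> R) ->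
  sigma.-integrable (phi @` U) (EFin \o g) <->
  leb2.-integrable (U : set P2) (fun p => (g (phi p) * area_density phi p)%:E).
Proof. exact: (integrable_change_of_variables mU mS mphi phiU mrho rho0 sE). Qed.

Lemma chart_sigma (W : set (R * R)) : open W -> W `<=` U ->
  sigma (phi @` W : set B3) = (\int[leb2]_(p in W) (area_density phi p)%:E)%E.
Proof.
move=> oW WU; have [oU _ inj _ im] := c.
have mW : measurable (phi @` W : set B3).
  have [Z oZ ->] := im W oW WU; apply: measurableI; first exact: mM.
  exact: borel3_open.
rewrite sE//; last exact: image_subset.
have -> : U `&` phi @^-1` (phi @` W) = W; last by [].
apply/seteqP; split => [p [Up [q Wq qp]]|p Wp]; last by split; [exact: WU|exists p].
by rewrite -(inj q p)// ?inE//; exact: WU.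
Qed.

Lemma chart_measurable_comp (g : E3 -> R) : measurable_fun (M : set B3) (g : B3 -> R) ->
  measurable_fun (U : set P2) (g \o phi).
Proof.
move=> mg; apply: (measurable_comp mM _ mg mphi) => _ [p Up <-].
exact: (chart_in c Up).
Qed.

Lemma measurable_chart_image (g : E3 -> R) : measurable_fun (M : set B3) (g : B3 -> R) ->
  measurable_fun (phi @` U : set B3) (g : B3 -> R).
Proof.
by apply: measurable_funS => //; move=> _ [p Up <-]; exact: (chart_in c Up).
Qed.

End InChart.

Lemma sigma_locally_finite x : M x -> exists Z : set E3,
  [/\ open Z, Z x & (sigma (M `&` Z : set B3) < +oo)%E].
Proof.
move=> /reg[U [phi [c [p Up <-]]]]; have oU := chart_open c.
have [d d0 KU] := open_square oU Up; have cK := @compact_square R p d.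
set K := square p d in KU cK.
pose W : set (R * R) := K°.
have oW : open W by exact: open_interior.
have Wp : W p by exact: square_nbhs.
have WK : W `<=` K by exact: interior_subset.
have WU : W `<=` U by move=> q /WK/KU.
have [_ _ _ _ /(_ W oW WU)[Z oZ EZ]] := c.
exists Z; split => //; first by have : (phi @` W) (phi p) by [exists p]; rewrite EZ => -[].
rewrite -EZ (chart_sigma c oW WU).
have mK := compact_measurable2 cK.
have [C C0 HC] := compact_bound_open cK KU (fun q Uq => Ck1_continuous (Ck1_area_density c) Uq).
apply: (@le_lt_trans _ _ (\int[leb2]_(p in K) (area_density phi p)%:E)%E).
  apply: ge0_subset_integral => //; first exact: open_measurable2.
    apply/measurable_EFinP; apply: (measurable_funS _ KU) (area_density_measurable c).
    exact: open_measurable2.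
  by move=> q /KU Uq; rewrite lee_fin; exact/ltW/(area_density_gt0 c Uq).
have : leb2.-integrable (K : set P2) (EFin \o area_density phi).
  apply: (measurable_bounded_integrable mK (compact_lty2 cK)).
    apply: (measurable_funS _ KU) (area_density_measurable c).
    exact: open_measurable2.
  exists C; split => [|y Cy q Kq /=]; first exact: num_real.
  by rewrite (le_trans (HC _ Kq))// ltW.
by move=> /integrable_lty; apply.
Qed.

Lemma sigma_finite_surface : (sigma (M : set B3) < +oo)%E.
Proof.
have [Q HO] : {Q : E3 -> set E3 & forall x, M x ->
    [/\ open (Q x), Q x x & (sigma (M `&` Q x : set B3) < +oo)%E]}.
  apply: (@choice _ _ (fun x Z => M x -> [/\ open Z, Z x & (sigma (M `&` Z : set B3) < +oo)%E])).
  move=> x; have [Mx|nMx] := pselect (M x); last by exists set0.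
  by have [Z HZ] := sigma_locally_finite Mx; exists Z.
have [s sM cov] := @surface_finite_cover R M Q cM (fun x Mx => let: And3 a b _ := HO x Mx in conj a b).
have : (sigma ((\big[setU/set0]_(z <- s) (M `&` Q z)) : set B3) < +oo)%E /\
    measurable ((\big[setU/set0]_(z <- s) (M `&` Q z)) : set B3).
  elim: s sM {cov} => [|z s IH] sM; first by rewrite big_nil measure0.
  have [|IH1 IH2] := IH; first by move=> x xs; apply: sM; rewrite inE xs orbT.
  have [oz _ fz] := HO z (sM z (mem_head _ _)).
  have mz : measurable (M `&` Q z : set B3).
    by apply: measurableI => //; exact: borel3_open.
  rewrite big_cons; split; last exact: measurableU.
  by rewrite (le_lt_trans (measureU2 _ mz IH2))// lte_add_pinfty.
move=> [fin mS]; apply: le_lt_trans fin; apply: le_measure; rewrite ?inE//.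
by move=> x Mx; have [z zs Oz] := cov x Mx; rewrite -bigcup_seq; exists z.
Qed.

Lemma bounded_integrable (g : E3 -> R) (C : R) :
  measurable_fun (M : set B3) (g : B3 -> R) -> (forall x, M x -> `|g x| <= C) ->
  sigma.-integrable M (EFin \o g).
Proof.
move=> mg gC; apply: (measurable_bounded_integrable mM sigma_finite_surface mg).
exists C; split => [|y Cy q Kq /=]; first exact: num_real.
  by rewrite (le_trans (gC _ Kq))// ltW.
Qed.

Lemma continuous_integrable (g : E3 -> R) : {within M, continuous g} ->
  sigma.-integrable M (EFin \o g).
Proof.
move=> cg; have [C _ HC] := compact_bound cM cg.
exact: (bounded_integrable (surface_measurable_fun cM cg) HC).
Qed.

(** The area density is positive, so its integral over the nonempty open set of
parameters of O cannot vanish. *)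
Lemma sigma_open_gt0 x (O : set E3) : M x -> open O -> O x ->
  (0 < sigma (M `&` O : set B3))%E.
Proof.
move=> Mx oO Ox; have [U [phi [c [p Up px]]]] := reg Mx; subst x.
have oU := chart_open c.
pose W := U `&` phi @^-1` O.
have oW : open W by rewrite openE => q [Uq Oq]; exact: (chart_preimage c Uq oO Oq).
have WU : W `<=` U by move=> q [].
apply: (@lt_le_trans _ _ (sigma (phi @` W : set B3))); last first.
  have [_ _ _ _ /(_ W oW WU)[Z oZ EZ]] := c.
  apply: le_measure; rewrite ?inE.
  - by rewrite EZ; apply: measurableI => //; exact: borel3_open.
  - by apply: measurableI => //; exact: borel3_open.
  - by move=> _ [q [Uq Oq] <-]; split => //; exact: (chart_in c Uq).
rewrite (chart_sigma c oW WU) lt_def integral_ge0 ?andbT; last first.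
  by move=> q [Uq _]; rewrite lee_fin; exact/ltW/(area_density_gt0 c Uq).
apply/eqP => int0; have mW := open_measurable2 oW.
have : (\int[leb2]_(p in W) `|(area_density phi p)%:E| = 0)%E.
  rewrite -{}int0; apply: eq_integral => q /[!inE] -[Uq _].
  by rewrite gee0_abs// lee_fin; exact/ltW/(area_density_gt0 c Uq).
have mf : measurable_fun (W : set P2) (EFin \o area_density phi).
  apply/measurable_EFinP; apply: (measurable_funS _ WU) (area_density_measurable c).
  exact: open_measurable2.
move=> /(ae_eq_integral_abs _ mW mf).1 [N [mN N0 sub]].
have := lebesgue2_open_gt0 oW (conj Up Ox : W p); apply/negP; rewrite -leNgt.
rewrite -N0; apply: le_measure; rewrite ?inE//.
move=> q Wq; apply: sub => /= /(_ Wq) [] q0.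
by have := area_density_gt0 c (WU _ Wq); rewrite q0 ltxx.
Qed.

(** The obstacle constraint is imposed almost everywhere; for a continuous function
it holds everywhere because nonempty open parts of M have positive area. *)
Lemma ae_le_continuous (u : E3 -> R) (b : R) : {within M, continuous u} ->
  {ae sigma, forall x, M x -> `|u x| <= b} -> forall x, M x -> `|u x| <= b.
Proof.
move=> cu [N [mN N0 sub]] x Mx; rewrite leNgt; apply/negP => bx.
have cnu : nbhs (u x) [set t : R | b < `|t|].
  have := @norm_continuous _ _ (u x : R^o) _ (lt_nbhsr bx : nbhs `|u x| [set t | b < t]).
  by [].
have [Z [oO Ox] big] := within_nbhs cu Mx cnu.
have := sigma_open_gt0 Mx oO Ox; apply/negP; rewrite -leNgt -N0.
apply: le_measure; rewrite ?inE//.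
  by apply: measurableI => //; exact: borel3_open.
move=> y [My Oy]; apply: sub => /= /(_ My); rewrite leNgt.
by have := big y My Oy; rewrite /= => ->.
Qed.

End SurfaceMeasure.

Lemma integrable_scale (R : realType) d (T : measurableType d)
    (mu : {measure set T -> \bar R}) (A : set T) (k : R) (g : T -> R) :
  measurable A -> mu.-integrable A (fun x => (g x)%:E) ->
  mu.-integrable A (fun x => (k * g x)%:E).
Proof. by move=> mA ig; under eq_fun do rewrite EFinM; exact: integrableZl. Qed.

(** * Weak gradients *)
Section Sobolev.
Context {R : realType}.
Local Notation E3 := 'rV[R]_3.
Local Notation B3 := (borel3 R).
Local Notation P2 := (measurableTypeR R * measurableTypeR R)%type.
Local Notation leb2 := (@lebesgue2 R : {measure set P2 -> \bar R}).
Variables (M : set E3) (sigma : {measure set B3 -> \bar R}).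
Hypotheses (cM : compact M) (reg : regular_surface M) (area : is_area_measure M sigma).
Implicit Types (U : set (R * R)) (phi : R * R -> E3) (p : R * R).

Let mM : measurable (M : set B3). Proof. exact: borel3_surface. Qed.

Lemma measurable_dot (G G' : E3 -> E3) :
  (forall j, measurable_fun (M : set B3) ((fun x => G x 0 j) : B3 -> R)) ->
  (forall j, measurable_fun (M : set B3) ((fun x => G' x 0 j) : B3 -> R)) ->
  measurable_fun (M : set B3) ((fun x => dot (G x) (G' x)) : B3 -> R).
Proof. by move=> mG mG'; apply: measurable_sum => j; apply: measurable_funM. Qed.

Lemma H1_dot_integrable u G w D : H1 M sigma u G -> H1 M sigma w D ->
  sigma.-integrable M (fun x => (dot (G x) (D x))%:E).
Proof.
move=> [_ mG _ iG _] [_ mD _ iD _].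
apply: (le_integrable mM (g := fun x => (dot (G x) (G x) + dot (D x) (D x))%:E)).
- by apply/measurable_EFinP; exact: measurable_dot.
- move=> x _; rewrite lee_fin (ger0_norm (addr_ge0 (dot_ge0 _) (dot_ge0 _))).
  exact: normr_dot_le.
- by under eq_fun do rewrite EFinD; exact: integrableD.
Qed.

(** In a chart |<G, d_i phi> psi| is bounded by C |G|^2 sqrt(det g), integrable since
|G|^2 is on M, plus a continuous function with compact support. *)
Lemma H1_chart_integrable u G U phi psi i : H1 M sigma u G -> chart M U phi ->
  test_function U psi ->
  leb2.-integrable (U : set P2)
    (fun p => (dot (G (phi p)) (pd i phi p) * psi p)%:E).
Proof.
move=> [_ mG _ iG _] c tpsi; have oU := chart_open c.
have mU : measurable (U : set P2) by exact: open_measurable2.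
have iGU : leb2.-integrable (U : set P2)
    (fun p => (dot (G (phi p)) (G (phi p)) * area_density phi p)%:E).
  apply/(chart_integrable cM area c (g := fun x => dot (G x) (G x))).
    by apply: (measurable_chart_image cM c); exact: measurable_dot.
  apply: integrableS iG => //; first exact: borel3_chart_image c.
  by move=> _ [p Up <-]; exact: (chart_in c Up).
have Cd : Ck 1 U (fun p => dot (pd i phi p) (pd i phi p)).
  by apply: Ck1_dot => //; exact: chart_Ck1_pd c.
have iB := test_function_integrable oU (fun p Up => Ck1_continuous Cd Up) tpsi.
have [Cpsi [K [cK KU psi0]]] := tpsi.
have CV : Ck 1 U (fun p => (area_density phi p)^-1).
  apply: (Ck1V oU (Ck1_area_density c)) => p Up.
  by rewrite gt_eqF//; exact: (area_density_gt0 c Up).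
have CQ : Ck 1 U (fun p => psi p * (area_density phi p)^-1).
  by apply: (Ck1M oU) CV; exact: Ck1S Cpsi.
have [C C0 HC] := compact_bound_open cK KU (fun q Uq => Ck1_continuous CQ Uq).
(* C bounds |psi| / sqrt(det g) on the support of psi. *)
have psiC p : U p -> `|psi p| <= C * area_density phi p.
  move=> Up; have d0 := area_density_gt0 c Up.
  have [Kp|nKp] := pselect (K p); last by rewrite psi0// normr0 mulr_ge0// ltW.
  by have := HC p Kp; rewrite normrM normfV (gtr0_norm d0) ler_pdivrMr.
apply: (le_integrable mU (g := fun p => (C * (dot (G (phi p)) (G (phi p)) * area_density phi p)
    + `|dot (pd i phi p) (pd i phi p) * psi p|)%:E)).
- apply/measurable_EFinP; apply: measurable_funM; last first.
    apply: continuous_measurable2 => // p Up; exact: (Ck1_continuous (p := p) Cpsi I).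
  apply: measurable_sum => j; apply: measurable_funM.
    exact: (chart_measurable_comp cM c (mG j)).
  apply: continuous_measurable2 => // p Up.
  exact: (Ck1_continuous (Ck1_coord j oU (chart_Ck1_pd i c)) Up).
- move=> p Up; rewrite lee_fin normrM.
  have G0 := dot_ge0 (G (phi p)); have d0 := dot_ge0 (pd i phi p).
  have a0 := ltW (area_density_gt0 c Up).
  rewrite [leRHS]ger0_norm; last by rewrite addr_ge0// !mulr_ge0// ltW.
  rewrite normrM (ger0_norm d0).
  apply: le_trans (ler_wpM2r (normr_ge0 _) (normr_dot_le _ _)) _.
  rewrite mulrDl lerD2r mulrCA; apply: ler_wpM2l => //; exact: psiC.
- under eq_fun do rewrite EFinD EFinM.
  apply: integrableD => //; first exact: integrableZl.
  by have := integrable_abse iB.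
Qed.

Lemma weak_gradientE u G U phi psi i : weak_gradient M u G -> chart M U phi ->
  test_function U psi ->
  \int[leb2]_(p in U) (u (phi p) * pd i psi p) =
    - \int[leb2]_(p in U) (dot (G (phi p)) (pd i phi p) * psi p).
Proof. by move=> [_ h] c t; exact: h. Qed.

Lemma H1_weak u G : H1 M sigma u G -> weak_gradient M u G.
Proof. by case. Qed.

Lemma H1_add_scale (t : R) u G w D : {within M, continuous u} -> {within M, continuous w} ->
  H1 M sigma u G -> H1 M sigma w D ->
  H1 M sigma (fun x => u x + t * w x) (fun x => G x + t *: D x).
Proof.
move=> cu cw hu hw; have iGG := H1_dot_integrable hu hu.
have iGD := H1_dot_integrable hu hw; have iDD := H1_dot_integrable hw hw.
have [mu mG _ _ [tG wG]] := hu; have [mw mD _ _ [tD wD]] := hw.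
have cuw : {within M, continuous (fun x => u x + t * w x)}.
  by move=> x; apply: cvgD; [exact: cu|apply: cvgM; [exact: cvg_cst|exact: cw]].
split.
- exact: surface_measurable_fun.
- move=> j; have -> : (fun x => (G x + t *: D x) 0 j) = (fun x => G x 0 j + t * D x 0 j).
    by apply/funext => x; rewrite !mxE.
  by apply: measurable_funD => //; apply: measurable_funM.
- apply: (continuous_integrable cM reg area).
  by move=> x; apply: cvgM; exact: cuw.
- have -> : (fun x => (dot (G x + t *: D x) (G x + t *: D x))%:E) =
    (fun x => (dot (G x) (G x))%:E + ((2 * t)%:E * (dot (G x) (D x))%:E +
       (t ^+ 2)%:E * (dot (D x) (D x))%:E))%E.
    apply/funext => x; rewrite -!EFinM -!EFinD; congr (_%:E).
    by rewrite !(dotDl, dotDr) !(dotZl, dotZr) (dotC (D x) (G x)); ring.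
  by apply: integrableD => //; apply: integrableD => //; exact: integrableZl.
- split=> [U phi c p Up|U phi c psi tpsi i].
    apply: addmx_sub; first exact: (tG _ _ c).
    by apply: scalemx_sub; exact: (tD _ _ c).
  have oU := chart_open c; have mU : measurable (U : set P2) by exact: open_measurable2.
  have iw := test_function_pd_integrable i oU
    (fun p Up => within_chart_continuous cw c Up) tpsi.
  have iu := test_function_pd_integrable i oU
    (fun p Up => within_chart_continuous cu c Up) tpsi.
  have jw := H1_chart_integrable i hw c tpsi.
  have ju := H1_chart_integrable i hu c tpsi.
  transitivity (\int[leb2]_(p in U) (u (phi p) * pd i psi p) +
     t * \int[leb2]_(p in U) (w (phi p) * pd i psi p)).
    rewrite -RintegralZl// -RintegralD//; last first.
      exact: integrable_scale.
    by apply: eq_Rintegral => p _; ring.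
  rewrite wG// wD// mulrN -opprD; congr (- _).
  rewrite -RintegralZl// -RintegralD//; last first.
    exact: integrable_scale.
  by apply: eq_Rintegral => p _; rewrite dotDl dotZl; ring.
Qed.

(** If dth = q dw classically, the weak gradient of th is q times that of w.
Testing th against psi gives int q (d_i w) psi by parts; q psi is itself
a test function, so the weak gradient of w may take the place of d_i w. *)
Lemma H1_chain w D (th q : E3 -> R) : H1 M sigma w D -> CkM 1 M w -> CkM 1 M th ->
  CkM 1 M q ->
  (forall U phi p i, chart M U phi -> U p ->
     pd i (th \o phi) p = q (phi p) * pd i (w \o phi) p) ->
  H1 M sigma th (fun x => q x *: D x).
Proof.
move=> hw Cw Cth Cq dth; have iDD := H1_dot_integrable hw hw.
have [mw mD _ _ [tD wD]] := hw.
have cth := CkM_continuous reg Cth; have cq := CkM_continuous reg Cq.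
have mq := surface_measurable_fun cM cq.
have mqD j : measurable_fun (M : set B3) ((fun x => (q x *: D x) 0 j) : B3 -> R).
  have -> : (fun x => (q x *: D x) 0 j) = (fun x => q x * D x 0 j).
    by apply/funext => x; rewrite mxE.
  exact: measurable_funM.
split => //.
- exact: surface_measurable_fun.
- apply: (continuous_integrable cM reg area).
  by move=> x; apply: cvgM; exact: cth.
- have [C C0 HC] := compact_bound cM cq.
  apply: (le_integrable mM (g := fun x => (C ^+ 2 * dot (D x) (D x))%:E)).
  + by apply/measurable_EFinP; exact: measurable_dot.
  + move=> x Mx; rewrite lee_fin dotZl dotZr mulrA normrM [leRHS]normrM ler_wpM2r//.
    by rewrite expr2 !normrM (gtr0_norm C0) ler_pM// HC.
  + exact: integrable_scale.
- split=> [U phi c p Up|U phi c psi tpsi i].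
    by apply: scalemx_sub; exact: (tD _ _ c).
  have oU := chart_open c.
  have tq := test_function_mul oU (Cq _ _ c) tpsi.
  rewrite (integration_by_parts_plane i oU (Cth _ _ c) tpsi).
  have E := integration_by_parts_plane i oU (Cw _ _ c) tq.
  rewrite (weak_gradientE i (H1_weak hw) c tq) in E.
  congr (- _); transitivity (\int[leb2]_(p in U) (pd i (w \o phi) p *
      (((q \o phi) \* psi) \_ U) p)).
    apply: eq_Rintegral => p /[!inE] Up; rewrite (dth _ _ _ _ c Up).
    by rewrite patchE mem_set//=; ring.
  move/oppr_inj : E => /= <-.
  apply: eq_Rintegral => p /[!inE] Up.
  by rewrite patchE mem_set//= dotZl; ring.
Qed.

Lemma H1_grad (h : E3 -> R) : CkM 1 M h -> H1 M sigma h (grad M h).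
Proof.
move=> Ch; have ch := CkM_continuous reg Ch.
have cg (k : 'I_3) : {within M, continuous (fun x => grad M h x 0 k)}.
  by apply: surface_continuous => // U phi p c Up; exact: (grad_continuous Ch c Up).
split.
- exact: surface_measurable_fun.
- by move=> j; exact: surface_measurable_fun.
- apply: (continuous_integrable cM reg area).
  by move=> x; apply: cvgM; exact: ch.
- apply: (continuous_integrable cM reg area).
  have cM' (T : topologicalType) (f : T -> E3) : (forall k : 'I_3, continuous (fun x => f x 0 k)) ->
      continuous (fun x => dot (f x) (f x)).
    move=> cf x; apply: sum_continuous => k; apply: cvgM; exact: cf.
  by apply: cM' => k; exact: cg.
- split; first exact: grad_tangent.
  move=> U phi c psi tpsi i.
  rewrite (integration_by_parts_plane i (chart_open c) (Ch _ _ c) tpsi); congr (- _).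
  by apply: eq_Rintegral => p /[!inE] Up; rewrite (dot_grad i Ch c Up).
Qed.

(** The hypothesis makes q |D|^2 vanish almost everywhere, hence D = 0 where q > 0.
There the classical partial derivatives of w are orthogonal to all test
functions, so they vanish, and w is constant on a small square. *)
Lemma locally_constant w D (q : E3 -> R) x : H1 M sigma w D -> CkM 1 M w ->
  {within M, continuous q} -> (forall y, M y -> 0 <= q y) ->
  \int[sigma]_(y in M) (q y * dot (D y) (D y)) <= 0 -> M x -> 0 < q x ->
  exists2 Z : set E3, open Z /\ Z x & forall y, M y -> Z y -> w y = w x.
Proof.
move=> hw Cw cq q0 int_le0 Mx qx; have iDD := H1_dot_integrable hw hw.
have [_ mD _ _ _] := hw.
have mq := surface_measurable_fun cM cq.
have mF : measurable_fun (M : set B3) ((fun y => q y * dot (D y) (D y)) : B3 -> R).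
  by apply: measurable_funM => //; exact: measurable_dot.
have F0 y : M y -> 0 <= q y * dot (D y) (D y).
  by move=> My; rewrite mulr_ge0 ?q0// dot_ge0.
have iF : sigma.-integrable M (fun y => (q y * dot (D y) (D y))%:E).
  have [C C0 HC] := compact_bound cM cq.
  apply: (le_integrable mM (g := fun x => (C * dot (D x) (D x))%:E)).
  + exact/measurable_EFinP.
  + move=> y My; rewrite lee_fin !normrM ler_wpM2r//.
    by rewrite (gtr0_norm C0) HC.
  + exact: integrable_scale.
have [U [phi [c [p Up px]]]] := reg Mx; subst x.
have oU := chart_open c; have mU : measurable (U : set P2) by exact: open_measurable2.
have sub : phi @` U `<=` M by move=> _ [q' Uq <-]; exact: (chart_in c Uq).
have mS := borel3_chart_image cM c.
have iFU : leb2.-integrable (U : set P2)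
    (fun r => (q (phi r) * dot (D (phi r)) (D (phi r)) * area_density phi r)%:E).
  apply/(chart_integrable cM area c (g := fun y => q y * dot (D y) (D y))).
    exact: (measurable_chart_image cM c mF).
  by apply: integrableS iF.
have int0 : (\int[leb2]_(r in U)
   `|(q (phi r) * dot (D (phi r)) (D (phi r)) * area_density phi r)%:E| = 0)%E.
  transitivity (\int[leb2]_(r in U)
     (q (phi r) * dot (D (phi r)) (D (phi r)) * area_density phi r)%:E)%E.
    apply: eq_integral => r /[!inE] Ur; rewrite gee0_abs// lee_fin mulr_ge0//.
      exact: F0 (chart_in c Ur).
    exact/ltW/(area_density_gt0 c Ur).
  rewrite -(fineK (integrable_fin_num mU iFU)); congr (_%:E).
  rewrite -[LHS]/(\int[leb2]_(r in U) _)
    -(chart_Rintegral cM area c (g := fun y => q y * dot (D y) (D y))); last first.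
    exact: (measurable_chart_image cM c mF).
  apply/eqP; rewrite eq_le; apply/andP; split; last first.
    by apply: Rintegral_ge0 => y /sub; exact: F0.
  apply: le_trans int_le0; rewrite /Rintegral fine_le//.
  + by apply: integrable_fin_num => //; exact: integrableS iF.
  + exact: integrable_fin_num.
  + by apply: ge0_subset_integral => //; exact/measurable_EFinP.
have ae0 : ae_eq leb2 U (fun r => (q (phi r) * dot (D (phi r)) (D (phi r)) *
    area_density phi r)%:E) (cst 0%E).
  exact/(ae_eq_integral_abs _ mU (measurable_int _ iFU)).
pose W := U `&` [set r | 0 < q (phi r)].
have oW : open W.
  rewrite openE => r [Ur qr]; rewrite /interior; apply: filterI.
    exact: open_nbhs_nbhs.
  have cqr := within_chart_continuous cq c Ur.
  apply: (cqr [set t | 0 < t]); exact: lt_nbhsr.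
have Cwphi := Cw _ _ c.
have pd0 i r : W r -> pd i (w \o phi) r = 0.
  apply: (eq0_of_test_functions oW) => [s [Us _]|psi [Cpsi [K [cK KW psi0]]]].
    exact: (Ck1_pd_continuous Cwphi Us).
  have tU : test_function U psi by split => //; exists K; split => // s /KW[].
  transitivity (\int[leb2]_(s in U) (pd i (w \o phi) s * psi s)).
    rewrite Rintegral_mkcond [RHS]Rintegral_mkcond; apply: eq_Rintegral => s _.
    rewrite !patchE; have [Ws|nWs] := pselect (W s).
      by rewrite !mem_set//; case: Ws.
    rewrite memNset//; case: ifP => // _; rewrite psi0 ?mulr0// => /KW //.
  rewrite -[LHS]opprK -(integration_by_parts_plane i oU Cwphi tU).
  rewrite (weak_gradientE i (H1_weak hw) c tU) opprK /Rintegral.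
  rewrite (ae_eq_integral (cst 0%E)) ?integral0//.
  - exact: measurable_int (H1_chart_integrable i hw c tU).
  - apply: filterS ae0 => s /= s0 Us; have := s0 Us => -[] /eqP.
    rewrite mulf_eq0 (gt_eqF (area_density_gt0 c Us)) orbF mulf_eq0 => /orP[] /eqP h.
      have nKs : ~ K s by move=> /KW[_ /=]; rewrite h ltxx.
      by rewrite psi0// mulr0.
    by rewrite (dot_eq0 h) dot0l mul0r.
have [r r0 Hr] := open_box oW (conj Up qx : W p).
have const s : `|s.1 - p.1| < r -> `|s.2 - p.2| < r -> w (phi s) = w (phi p).
  case: s => s1 s2 /=; case: (p) Hr => p1 p2 /= Hr h1 h2.
  have WU s : W s -> U s by case.
  have [_ Cd] := Cwphi.
  have e1 : w (phi (s1, s2)) - w (phi (p1, s2)) = 0.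
    apply/eqP; rewrite -normr_le0.
    have := @mvt_deviation R (fun t => w (phi (t, s2)))
      (fun t => pd ord0 (w \o phi) (t, s2)) p1 s1 0 0.
    rewrite mulr0 subr0 mul0r; apply => t tb.
    have Wt : W (t, s2).
      apply: Hr => //=; apply: le_lt_trans h1.
      by have := @between_shift R p1 (s1 - p1) t; rewrite subrK; apply.
    rewrite pd0// subr0 normr0; split => //.
    have [d0 _] := Cd ord0; rewrite -[X in is_derive _ _ _ X](pd0 ord0 (t, s2))//.
    by apply: (@is_derive_line0 R (w \o phi)); apply: d0; exact: WU.
  have e2 : w (phi (p1, s2)) - w (phi (p1, p2)) = 0.
    apply/eqP; rewrite -normr_le0.
    have := @mvt_deviation R (fun t => w (phi (p1, t)))
      (fun t => pd ord_max (w \o phi) (p1, t)) p2 s2 0 0.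
    rewrite mulr0 subr0 mul0r; apply => t tb.
    have Wt : W (p1, t).
      apply: Hr => /=; first by rewrite subrr normr0.
      apply: le_lt_trans h2.
      by have := @between_shift R p2 (s2 - p2) t; rewrite subrK; apply.
    rewrite pd0// subr0 normr0; split => //.
    have [d0 _] := Cd ord_max; rewrite -[X in is_derive _ _ _ X](pd0 ord_max (p1, t))//.
    by apply: (@is_derive_line1 R (w \o phi)); apply: d0; exact: WU.
  by move: e1 e2 => /eqP; rewrite subr_eq0 => /eqP -> /eqP; rewrite subr_eq0 => /eqP.
apply: (chart_nbhs_near (P := fun y => w y = w (phi p)) c Up).
exists (ball p.1 r, ball p.2 r) => /=.
  by split; apply: nbhsx_ballx.
by move=> s [/= s1 s2]; apply: const; rewrite distrC.
Qed.

End Sobolev.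

Lemma integrable_add (R : realType) d (T : measurableType d)
    (mu : {measure set T -> \bar R}) (A : set T) (g h : T -> R) : measurable A ->
  mu.-integrable A (fun x => (g x)%:E) -> mu.-integrable A (fun x => (h x)%:E) ->
  mu.-integrable A (fun x => (g x + h x)%:E).
Proof. by move=> mA ig ih; under eq_fun do rewrite EFinD; exact: integrableD. Qed.

(** A quadratic polynomial nonnegative on the right of its root 0 has nonnegative
slope there. *)
Lemma ge0_of_quadratic (R : realType) (I Q t0 : R) : 0 <= Q -> 0 < t0 ->
  (forall t, 0 < t <= t0 -> 0 <= 2 * t * I + t ^+ 2 * Q) -> 0 <= I.
Proof.
move=> Q0 t00 h; rewrite leNgt; apply/negP => I0.
have Q1 : 0 < Q + 1 by rewrite ltr_wpDl.
(* At this t the linear term 2 I is not yet compensated by t Q <= - I. *)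
pose t := Num.min t0 (- I / (Q + 1)).
have t0' : 0 < t by rewrite lt_min t00 divr_gt0// oppr_gt0.
have := h t; rewrite t0' ge_min lexx => /(_ isT).
have -> : 2 * t * I + t ^+ 2 * Q = t * (2 * I + t * Q) by ring.
rewrite pmulr_rge0// => h2.
have : t * (Q + 1) <= - I by rewrite -ler_pdivlMr// ge_min lexx orbT.
rewrite mulrDr mulr1 => h3; lra.
Qed.

(** * First variation and the local form of Green's identity *)
Section Variational.
Context {R : realType}.
Local Notation E3 := 'rV[R]_3.
Local Notation B3 := (borel3 R).
Local Notation P2 := (measurableTypeR R * measurableTypeR R)%type.
Local Notation leb2 := (@lebesgue2 R : {measure set P2 -> \bar R}).
Variables (M : set E3) (sigma : {measure set B3 -> \bar R}).
Hypotheses (cM : compact M) (reg : regular_surface M) (area : is_area_measure M sigma).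
Implicit Types (U : set (R * R)) (phi : R * R -> E3) (p : R * R).

Let mM : measurable (M : set B3). Proof. exact: borel3_surface. Qed.

(** Solutions are handled together with one weak gradient realising the minimum. *)
Definition minimizer (H : E3 -> R) (beta : R) (u : E3 -> R) (G : E3 -> E3) :=
  admissible M sigma beta u G /\
  forall W G', admissible M sigma beta W G' ->
    energy M sigma H u G <= energy M sigma H W G'.

Lemma continuous_mul_integrable (u w : E3 -> R) :
  {within M, continuous u} -> {within M, continuous w} ->
  sigma.-integrable M (fun x => (u x * w x)%:E).
Proof.
move=> cu cw; apply: (continuous_integrable cM reg area (g := fun x => u x * w x)).
by move=> x; apply: cvgM; [exact: cu|exact: cw].
Qed.

(** For an admissible direction the energy is a quadratic polynomial in t with
a minimum at t = 0 on [0, t0]; twice the integral below is its slope. *)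
Lemma variational_inequality (H : E3 -> R) (beta t0 : R) u G th Xi :
  {within M, continuous H} -> {within M, continuous u} -> {within M, continuous th} ->
  minimizer H beta u G -> H1 M sigma th Xi -> 0 < t0 ->
  (forall t, 0 < t <= t0 -> forall x, M x -> `|u x + t * th x| <= beta / 2) ->
  0 <= \int[sigma]_(x in M) (dot (G x) (Xi x) + H x * th x).
Proof.
move=> cH cu cth [[hu _] min] hth t00 adm.
have iGG := H1_dot_integrable cM hu hu; have iGX := H1_dot_integrable cM hu hth.
have iXX := H1_dot_integrable cM hth hth.
have iHu := continuous_mul_integrable cH cu.
have iHt := continuous_mul_integrable cH cth.
have i1 : sigma.-integrable M (fun x => (dot (G x) (G x) + 2 * H x * u x)%:E).
  under eq_fun do rewrite -mulrA EFinD.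
  by apply: integrableD => //; exact: (integrable_scale 2 mM iHu).
have i2 : sigma.-integrable M (fun x => (dot (G x) (Xi x) + H x * th x)%:E).
  by under eq_fun do rewrite EFinD; exact: integrableD.
apply: (@ge0_of_quadratic R _ (\int[sigma]_(x in M) dot (Xi x) (Xi x)) t0) => //.
  by apply: Rintegral_ge0 => x _; exact: dot_ge0.
move=> t tt.
have hW : admissible M sigma beta (fun x => u x + t * th x) (fun x => G x + t *: Xi x).
  split; first exact: (H1_add_scale cM reg area).
  by apply: aeW => x; exact: adm.
have := min _ _ hW; rewrite -subr_ge0.
have -> : energy M sigma H (fun x => u x + t * th x) (fun x => G x + t *: Xi x) =
  energy M sigma H u G +
  (2 * t * \int[sigma]_(x in M) (dot (G x) (Xi x) + H x * th x) +
   t ^+ 2 * \int[sigma]_(x in M) dot (Xi x) (Xi x)).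
  rewrite /energy -RintegralZl// -RintegralZl// -RintegralD//; last 2 first.
  - exact: integrable_scale.
  - exact: integrable_scale.
  rewrite -RintegralD//; last first.
    by apply: integrable_add => //; exact: integrable_scale.
  apply: eq_Rintegral => x _.
  by rewrite !(dotDl, dotDr) !(dotZl, dotZr) (dotC (Xi x) (G x)); ring.
by rewrite addrC addKr.
Qed.

Lemma grad_eq0_near (h : E3 -> R) (Z : set E3) x : CkM 1 M h -> M x -> open Z -> Z x ->
  (forall y, M y -> Z y -> h y = 0) -> grad M h x = 0.
Proof.
move=> Ch Mx oZ Zx h0; have [U [phi [c [p Up px]]]] := reg Mx; subst x.
rewrite (gradE Ch c Up) /chart_grad.
suff -> : partials phi h p = 0 by rewrite /tangent_vector !mul0mx.
have hn : \forall q \near p, (h \o phi) q = (cst 0 : R * R -> R) q.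
  apply: filterS (chart_preimage c Up oZ Zx) => q [Uq Zq] /=.
  by apply: h0 => //; exact: (chart_in c Uq).
by apply/rowP => i; rewrite !mxE (pd_near_eq i hn) pd_cst.
Qed.

Lemma dot_in_chart U phi p (G : E3 -> E3) (h : E3 -> R) : chart M U phi -> U p -> CkM 1 M h ->
  area_density phi p * dot (grad M h (phi p)) (G (phi p)) =
  \sum_i dot (G (phi p)) (pd i phi p) * flux phi h i p.
Proof.
move=> c Up Ch; have fJ := chart_row_free c Up.
rewrite (gradE Ch c Up) (tangent_dot _ fJ) ?tangent_vector_sub// tangent_vectorK//.
rewrite -mulmxA mxE mulr_sumr; apply: eq_bigr => i _.
rewrite tangent_coordsE row_jac mxE /flux mulrCA; congr (_ * (_ * _)).
apply: eq_bigr => j _; rewrite !mxE; congr (_ * _).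
have : (invmx (jac phi p *m (jac phi p)^T))^T = invmx (jac phi p *m (jac phi p)^T).
  by rewrite trmx_inv trmx_mul trmxK.
by move=> /matrixP/(_ i j) <-; rewrite mxE.
Qed.

Lemma laplacian_in_chart U phi p (f H : E3 -> R) : is_laplacian M f H -> chart M U phi ->
  U p -> area_density phi p * H (phi p) = \sum_i pd i (flux phi f i) p.
Proof.
move=> lap c Up; rewrite (lap _ _ c p Up) /laplace_chart mulVKf//.
by rewrite gt_eqF//; exact: (area_density_gt0 c Up).
Qed.

Lemma CkM_2_1 (f : E3 -> R) : CkM 2 M f -> CkM 1 M f.
Proof.
move=> Cf U phi c; have [c0 C1] := Cf U phi c; split => // i.
by have [d [cd _]] := C1 i; split.
Qed.

(** The pointwise identity behind [green_local]: a = <grad f, D>,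
b = <grad f, grad eta>, h = H and d = sqrt(det g); D0, D1 and E0, E1 are the
products of D and grad eta with the tangent vectors, F0, F1 are the components
of the flux and L0, L1 are their partial derivatives. *)
Lemma green_algebra (a b s h d et D0 D1 F0 F1 E0 E1 L0 L1 : R) :
  d * a = D0 * F0 + D1 * F1 -> d * b = E0 * F0 + E1 * F1 -> d * h = L0 + L1 ->
  ((a + h * s) * et + s * b) * d =
  s * (F0 * E0 + et * L0) + D0 * (F0 * et) + (s * (F1 * E1 + et * L1) + D1 * (F1 * et)).
Proof.
move=> da db dh.
have -> : ((a + h * s) * et + s * b) * d = (d * a) * et + (d * h) * s * et + s * (d * b) by ring.
by rewrite da db dh; ring.
Qed.

(** For eta supported in one chart, the components of the flux of f times eta are
test functions; testing psi against them and adding up gives the identity,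
since the divergence of the flux is sqrt(det g) H. *)
Lemma green_local (f H psi eta : E3 -> R) (D : E3 -> E3) U phi (K : set (R * R)) :
  CkM 2 M f -> is_laplacian M f H -> {within M, continuous H} ->
  {within M, continuous psi} -> H1 M sigma psi D -> CkM 1 M eta ->
  chart M U phi -> compact K -> K `<=` U ->
  (forall x, M x -> ~ (phi @` K) x -> eta x = 0) ->
  \int[sigma]_(x in M) ((dot (grad M f x) (D x) + H x * psi x) * eta x +
     psi x * dot (grad M f x) (grad M eta x)) = 0.
Proof.
move=> Cf lap cH cpsi hpsi Ceta c cK KU eta0.
have Cf1 := CkM_2_1 Cf; have oU := chart_open c.
have mU : measurable (U : set P2) by exact: open_measurable2.
have hf := H1_grad cM reg area Cf1; have heta := H1_grad cM reg area Ceta.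
have [_ mf _ _ _] := hf; have [_ me _ _ _] := heta; have [mpsi mD _ _ _] := hpsi.
have ceta := CkM_continuous reg Ceta.
have mH := surface_measurable_fun cM cH; have meta := surface_measurable_fun cM ceta.
pose F x := (dot (grad M f x) (D x) + H x * psi x) * eta x +
     psi x * dot (grad M f x) (grad M eta x).
have mF : measurable_fun (M : set B3) (F : B3 -> R).
  apply: measurable_funD; apply: measurable_funM => //; last exact: measurable_dot.
  by apply: measurable_funD; [exact: measurable_dot|exact: measurable_funM].
have imK : closed (phi @` K).
  apply: compact_closed; first exact: norm_hausdorff.
  apply: continuous_compact => //; apply: continuous_in_subspaceT => p /[!inE] /KU Up.
  exact: (chart_continuous c Up).
have F0 x : M x -> ~ (phi @` U) x -> F x = 0.
  move=> Mx nUx; have nKx : ~ (phi @` K) x.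
    by move=> [q Kq qx]; apply: nUx; exists q => //; exact: KU.
  have g0 : grad M eta x = 0.
    exact: (grad_eq0_near Ceta Mx (closed_openC imK) nKx eta0).
  by rewrite /F eta0// g0 mulr0 add0r dotC dot0l mulr0.
have sub : phi @` U `<=` M by move=> _ [q Uq <-]; exact: (chart_in c Uq).
transitivity (\int[sigma]_(x in phi @` U) F x).
  rewrite Rintegral_mkcond [RHS]Rintegral_mkcond; apply: eq_Rintegral => x _.
  rewrite !patchE; have [Ux|nUx] := pselect ((phi @` U) x).
    by rewrite !mem_set//; exact: sub.
  rewrite [in RHS]memNset//; case: ifPn => //; rewrite inE => Mx; exact: F0.
rewrite (chart_Rintegral cM area c); last exact: (measurable_chart_image cM c mF).
have Ceta' := Ceta _ _ c.
have teta : test_function U ((eta \o phi) \_ U).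
  apply: (test_function_patch oU Ceta' cK KU) => p Up nKp; apply: eta0.
    exact: (chart_in c Up).
  move=> [q Kq qp]; apply: nKp; have [_ _ inj _ _] := c.
  by rewrite -(inj q p)// ?inE//; exact: KU.
have Cflux i := Ck1_flux i c Cf.
pose tau i := (flux phi f i \* ((eta \o phi) \_ U)) \_ U.
have ttau i : test_function U (tau i) := test_function_mul oU (Cflux i) teta.
have pdtau i p : U p -> pd i (tau i) p =
    flux phi f i p * pd i (eta \o phi) p + eta (phi p) * pd i (flux phi f i) p.
  move=> Up; rewrite (pd_test_function_mul i oU (Cflux i) teta Up) patchE mem_set//.
  by congr (_ * _ + _); apply: (pd_eq_on i oU Up) => q Uq; rewrite patchE mem_set.
(* J i is the i-th integration by parts; the integrand is J 0 + J 1. *)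
pose J i p := psi (phi p) * pd i (tau i) p + dot (D (phi p)) (pd i phi p) * tau i p.
have ipd i := test_function_pd_integrable i oU
  (fun p Up => within_chart_continuous cpsi c Up) (ttau i).
have iD i := H1_chart_integrable cM area i hpsi c (ttau i).
have iJ i : leb2.-integrable (U : set P2) (fun p => (J i p)%:E).
  under eq_fun do rewrite EFinD.
  by apply: integrableD; [exact: mU|exact: ipd|exact: iD].
have J0 i : \int[leb2]_(p in U) J i p = 0.
  rewrite RintegralD//; [|exact: ipd|exact: iD].
  by rewrite (weak_gradientE i (H1_weak hpsi) c (ttau i)) addNr.
transitivity (\int[leb2]_(p in U) (J ord0 p + J ord_max p)); last first.
  have -> : \int[leb2]_(p in U) (J ord0 p + J ord_max p) =
    \int[leb2]_(p in U) J ord0 p + \int[leb2]_(p in U) J ord_max p by exact: (RintegralD mU (iJ ord0) (iJ ord_max)).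
  by rewrite !J0 addr0.
apply: eq_Rintegral => p /[!inE] Up.
have e1 := dot_in_chart D c Up Cf1; rewrite ord2E in e1.
have e2 := dot_in_chart (grad M eta) c Up Cf1; rewrite ord2E in e2.
have e3 := laplacian_in_chart lap c Up; rewrite ord2E in e3.
rewrite (dot_grad ord0 Ceta c Up) (dot_grad ord_max Ceta c Up) in e2.
have tauE i : tau i p = flux phi f i p * eta (phi p).
  by rewrite /tau patchE mem_set//= patchE mem_set.
rewrite /F /J (pdtau ord0 p Up) (pdtau ord_max p Up) !tauE.
exact: green_algebra e1 e2 e3.
Qed.

End Variational.

(** * Green's identity on the surface *)
Section Green.
Context {R : realType}.
Local Notation E3 := 'rV[R]_3.
Local Notation B3 := (borel3 R).
Local Notation P2 := (measurableTypeR R * measurableTypeR R)%type.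
Variables (M : set E3) (sigma : {measure set B3 -> \bar R}).
Hypotheses (cM : compact M) (reg : regular_surface M) (area : is_area_measure M sigma).
Implicit Types (U : set (R * R)) (phi : R * R -> E3) (p : R * R).

Let mM : measurable (M : set B3). Proof. exact: borel3_surface. Qed.

(** Support is expressed through a compact set of parameters, the form
required of test functions. *)
Definition bump_in_chart (b : E3 -> R) := CkM 1 M b /\
  exists U phi (K : set (R * R)), [/\ chart M U phi, compact K, K `<=` U &
    forall y, M y -> ~ (phi @` K) y -> b y = 0].

Lemma dist2_continuous (x : E3) : continuous (fun y : E3 => dot (y - x) (y - x)).
Proof.
move=> y; apply: sum_continuous => k.
have ck : {for y, continuous (fun z : E3 => (z - x) 0 k)}.
  have -> : (fun z : E3 => (z - x) 0 k) = (fun z : E3 => z 0 k - x 0 k).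
    by apply/funext => z; rewrite !mxE.
  exact: (cvgB (@coord_continuous R 1 3 0 k y) (cvg_cst _)).
exact: (cvgM ck ck).
Qed.

(** The function ((r^2 - |y - x|^2)^+)^2 of the ambient space, restricted to M. *)
Lemma surface_bump x : M x -> exists b : E3 -> R,
  [/\ bump_in_chart b, continuous b, forall y, 0 <= b y & 0 < b x].
Proof.
move=> Mx; have [U [phi [c [p Up px]]]] := reg Mx.
have oU := chart_open c; have [W oW EW] := chart_image c.
have Wx : W x by have : (phi @` U) x by [exists p]; rewrite EW => -[].
have /nbhs_ballP[rho /= rho0 ball_sub] := open_nbhs_nbhs (conj oW Wx).
(* The closed Euclidean ball of radius rho / 2 lies in the open ball of radius
   rho of the maximum norm. *)
pose r : R := rho / 2; have r0 : 0 < r by rewrite divr_gt0.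
pose C : set E3 := [set y | dot (y - x) (y - x) <= r ^+ 2].
have clC : closed C.
  have /continuous_closedP/(_ _ (@closed_le R (r ^+ 2))) := @dist2_continuous x.
  by [].
have CW : C `<=` W.
  move=> y /= Cy; apply: ball_sub; split => // i j; rewrite !ord1 /ball /=.
  have h : (y 0 j - x 0 j) ^+ 2 <= r ^+ 2.
    apply: le_trans Cy; rewrite /dot (bigD1 j)//= !mxE -expr2 lerDl.
    by apply: sumr_ge0 => k _; rewrite -expr2 sqr_ge0.
  rewrite distrC; apply: (@le_lt_trans _ _ r); last by rewrite /r; lra.
  by rewrite -ler_sqr ?nnegrE// ?(ltW r0)// real_normK ?num_real.
have [k [kphi phik kcont]] := chart_inverse c.
pose K := k @` (M `&` C).
have sub : M `&` C `<=` phi @` U by rewrite EW => y [My /CW Wy].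
have cK : compact K.
  apply: continuous_compact; last exact: compact_closedI.
  apply/subspace_continuousP => y MCy; have [q Uq qy] := sub _ MCy.
  have kq : k y = q by rewrite -qy kphi.
  move=> N nN; have nN' : nbhs q N by rewrite -kq.
  have h0 : \forall z \near y, M z -> N (k z) by rewrite -qy; exact: (kcont q Uq N nN').
  suff : \forall z \near y, (M `&` C) z -> N (k z) by [].
  by apply: filterS h0 => z h [Mz _]; exact: h.
have KU : K `<=` U by move=> _ [y /sub/phik[Uk _] <-].
exists (fun y => Num.max 0 (r ^+ 2 + (-1) * dot (y - x) (y - x)) ^+ 2); split.
- split.
    move=> U' phi' c'; have oU' := chart_open c'.
    pose g p := r ^+ 2 + (-1) * \sum_k (phi' p 0 k + - x 0 k) * (phi' p 0 k + - x 0 k).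
    have Cg : Ck 1 U' g.
      apply: (Ck1D oU' (Ck1_cst _ oU')); apply: (Ck1Ml _ oU'); apply: (Ck1_sum _ oU') => k'.
      by apply: (Ck1M oU'); apply: (Ck1D oU' _ (Ck1_cst _ oU'));
        apply: Ck1_coord => //; exact: chart_Ck1 c'.
    apply: (Ck1_eq_on oU' _ (Ck1_pos_pow 0 oU' Cg)) => q Uq /=.
    by congr (Num.max 0 (_ + _ * _) ^+ 2); apply: eq_bigr => j _; rewrite !mxE.
  exists U, phi, K; split => // y My nKy.
  rewrite max_l ?expr0n//; rewrite mulN1r subr_le0 leNgt; apply/negP => h.
  have MCy : (M `&` C) y by split => //; exact: ltW.
  by apply: nKy; exists (k y); [exists y|case: (phik y (sub _ MCy))].
- move=> y; pose g z : R := r ^+ 2 + (-1) * dot (z - x) (z - x).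
  have cg : g z @[z --> y] --> g y.
    exact: (cvgD (cvg_cst _) (cvgM (cvg_cst _) (@dist2_continuous x y))).
  exact: (cvg_comp _ _ cg (@pos_pow_continuous R 2 _)).
- by move=> y; rewrite exprn_ge0// le_max lexx.
- by rewrite subrr dot0l mulr0 addr0 exprn_gt0// lt_max exprn_gt0 ?orbT.
Qed.

Lemma CkM1_sum (s : seq E3) (b : E3 -> E3 -> R) : (forall z, z \in s -> CkM 1 M (b z)) ->
  CkM 1 M (fun y => \sum_(z <- s) b z y).
Proof.
elim: s => [|z s IH] Cb U phi c; have oU := chart_open c.
  by apply: (Ck1_eq_on oU _ (Ck1_cst 0 oU)) => q _ /=; rewrite big_nil.
have Cs : CkM 1 M (fun y => \sum_(z <- s) b z y).
  by apply: IH => z' zs; apply: Cb; rewrite inE zs orbT.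
have Cz := Cb z (mem_head _ _).
apply: (Ck1_eq_on oU _ (Ck1D oU (Cz _ _ c) (Cs _ _ c))) => q _ /=.
by rewrite big_cons.
Qed.

Lemma partition_of_unity : exists s : seq E3, exists eta : E3 -> E3 -> R,
  (forall z, z \in s -> bump_in_chart (eta z)) /\
  (forall y, M y -> \sum_(z <- s) eta z y = 1).
Proof.
have [b Hb] : {b : E3 -> E3 -> R & forall x, M x ->
    [/\ bump_in_chart (b x), continuous (b x), forall y, 0 <= b x y & 0 < b x x]}.
  apply: (@choice _ _ (fun x b => M x ->
    [/\ bump_in_chart b, continuous b, forall y, 0 <= b y & 0 < b x])).
  move=> x; have [Mx|nMx] := pselect (M x); last by exists (cst 0).
  by have [b Hb] := surface_bump Mx; exists b.
have [|s sM cov] := @surface_finite_cover R M (fun x => [set y | 0 < b x y]) cM.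
  move=> x Mx; have [_ cb _ bx] := Hb x Mx; split => //.
  rewrite openE => y /= y0; rewrite /interior.
  exact: (cb y [set t | 0 < t] (lt_nbhsr y0)).
pose S y := \sum_(z <- s) b z y.
have S0 y : M y -> 0 < S y.
  move=> My; have [z zs /= bz] := cov y My; rewrite /S (big_rem z)//=.
  rewrite ltr_pwDl// big_seq; apply: sumr_ge0 => z' /mem_rem z's.
  by have [] := Hb z' (sM _ z's).
have CS : CkM 1 M S by apply: CkM1_sum => z /sM/Hb[[]].
exists s, (fun z y => b z y * (S y)^-1); split => [z zs|y My]; last first.
  by rewrite -mulr_suml divff// gt_eqF// S0.
have [[Cb [U [phi [K [c cK KU b0]]]]] _ _ _] := Hb z (sM z zs).
split; last first.
  by exists U, phi, K; split => // y My nKy; rewrite b0// mul0r.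
move=> U' phi' c'; have oU' := chart_open c'.
apply: (Ck1M oU' (Cb _ _ c')); apply: (Ck1V oU' (CS _ _ c')) => q Uq.
by rewrite gt_eqF//; apply: S0; exact: (chart_in c' Uq).
Qed.

(** In a chart the gradient depends linearly on the partial derivatives, and these
add up to the derivative of a constant. *)
Lemma grad_sum_const (s : seq E3) (eta : E3 -> E3 -> R) (a : R) x :
  (forall z, z \in s -> CkM 1 M (eta z)) ->
  (forall y, M y -> \sum_(z <- s) eta z y = a) -> M x ->
  \sum_(z <- s) grad M (eta z) x = 0.
Proof.
move=> Ceta sum1 Mx; have [U [phi [c [p Up px]]]] := reg Mx; subst x.
have oU := chart_open c.
transitivity (\sum_(z <- s) chart_grad phi (eta z) p).
  by rewrite !big_seq; apply: eq_bigr => z zs; exact: gradE (Ceta z zs) c Up.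
rewrite /chart_grad /tangent_vector -!mulmx_suml.
suff -> : \sum_(z <- s) partials phi (eta z) p = 0 by rewrite !mul0mx.
apply/rowP => i; rewrite summxE mxE.
transitivity (\sum_(z <- s) pd i (eta z \o phi) p).
  by apply: eq_bigr => z _; rewrite mxE.
have -> : \sum_(z <- s) pd i (eta z \o phi) p =
    pd i (fun q => \sum_(z <- s) eta z (phi q)) p.
  elim: s Ceta {sum1} => [|z s IH] Ceta.
    rewrite big_nil (pd_eq_on (h := cst 0) i oU Up) ?pd_cst// => q _.
    by rewrite big_nil.
  rewrite big_cons IH; last by move=> z' zs; apply: Ceta; rewrite inE zs orbT.
  rewrite -(pdD i oU (Ceta z (mem_head _ _) _ _ c) _ Up).
    by apply: (pd_eq_on i oU Up) => q _; rewrite big_cons.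
  by apply: (CkM1_sum _ c) => z' zs; apply: Ceta; rewrite inE zs orbT.
rewrite (pd_eq_on (h := cst a) i oU Up) ?pd_cst// => q Uq.
by rewrite sum1//; exact: (chart_in c Uq).
Qed.

Lemma integrable_mul_continuous (g eta : E3 -> R) :
  sigma.-integrable M (fun x => (g x)%:E) -> {within M, continuous eta} ->
  sigma.-integrable M (fun x => (g x * eta x)%:E).
Proof.
move=> ig ceta; have [C C0 HC] := compact_bound cM ceta.
have mg : measurable_fun (M : set B3) (g : B3 -> R).
  by apply/measurable_EFinP; exact: measurable_int ig.
have meta := surface_measurable_fun cM ceta.
apply: (le_integrable mM (g := fun x => (C * g x)%:E)).
- by apply/measurable_EFinP; exact: measurable_funM.
- by move=> x Mx; rewrite lee_fin mulrC !normrM ler_wpM2r// (gtr0_norm C0) HC.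
- exact: integrable_scale.
Qed.

Lemma integrable_dot_scale (g psi : E3 -> R) u G w D : H1 M sigma u G -> H1 M sigma w D ->
  {within M, continuous psi} ->
  sigma.-integrable M (fun x => (psi x * dot (G x) (D x))%:E).
Proof.
move=> hu hw cpsi; under eq_fun do rewrite mulrC.
exact: (integrable_mul_continuous (H1_dot_integrable cM hu hw)).
Qed.

(** Summing the local identities over a partition of unity, the terms with
grad eta cancel because their sum is the gradient of 1. *)
Theorem green (f H psi : E3 -> R) (D : E3 -> E3) :
  CkM 2 M f -> is_laplacian M f H -> {within M, continuous H} ->
  {within M, continuous psi} -> H1 M sigma psi D ->
  \int[sigma]_(x in M) (dot (grad M f x) (D x) + H x * psi x) = 0.
Proof.
move=> Cf lap cH cpsi hpsi; have [s [eta [heta eta1]]] := partition_of_unity.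
have Cf1 := CkM_2_1 Cf; have hf := H1_grad cM reg area Cf1.
pose a x := dot (grad M f x) (D x) + H x * psi x.
pose F z x := a x * eta z x + psi x * dot (grad M f x) (grad M (eta z) x).
have Ceta z : z \in s -> CkM 1 M (eta z) by move=> /heta[].
have ia : sigma.-integrable M (fun x => (a x)%:E).
  apply: (integrable_add mM); first exact: (H1_dot_integrable cM hf hpsi).
  exact: (continuous_mul_integrable cM reg area).
have iF z : z \in s -> sigma.-integrable M (fun x => (F z x)%:E).
  move=> zs; apply: (integrable_add mM).
    exact: (integrable_mul_continuous ia (CkM_continuous reg (Ceta z zs))).
  exact: (integrable_dot_scale a hf (H1_grad cM reg area (Ceta z zs)) cpsi).
have F0 z : z \in s -> \int[sigma]_(x in M) F z x = 0.
  move=> zs; have [Cz [U [phi [K [c cK KU e0]]]]] := heta z zs.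
  exact: (green_local cM reg area Cf lap cH cpsi hpsi Cz c cK KU e0).
transitivity (\int[sigma]_(x in M) \sum_(z <- s) F z x).
  apply: eq_Rintegral => x /[!inE] Mx; rewrite big_split /= -mulr_sumr eta1// mulr1.
  rewrite -mulr_sumr.
  have -> : \sum_(z <- s) dot (grad M f x) (grad M (eta z) x) =
      dot (grad M f x) (\sum_(z <- s) grad M (eta z) x).
    elim: (s) => [|z s' IH]; first by rewrite !big_nil dotC dot0l.
    by rewrite !big_cons dotDr IH.
  by rewrite (grad_sum_const Ceta eta1 Mx) (dotC _ 0) dot0l mulr0 addr0.
have : \int[sigma]_(x in M) \sum_(z <- s) F z x = 0 /\
    sigma.-integrable M (fun x => (\sum_(z <- s) F z x)%:E).
  elim: s iF F0 {heta eta1 Ceta} => [|z s IH] iF F0.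
    split.
      transitivity (\int[sigma]_(x in M) (cst 0 : B3 -> R) x).
        by apply: eq_Rintegral => x _; rewrite big_nil.
      by rewrite Rintegral_cst// mul0r.
    have -> : (fun x : B3 => (\sum_(z <- [::]) F z x)%:E) = cst 0%E.
      by apply/funext => x; rewrite big_nil.
    exact: integrable0.
  have [|z' zs|h1 h2] := IH; first by move=> z' zs; apply: iF; rewrite inE zs orbT.
    by apply: F0; rewrite inE zs orbT.
  have iz := iF z (mem_head _ _); split.
    transitivity (\int[sigma]_(x in M) (F z x + \sum_(z <- s) F z x)).
      by apply: eq_Rintegral => x _; rewrite big_cons.
    by rewrite (RintegralD mM iz h2) h1 F0 ?mem_head// addr0.
  have -> : (fun x : B3 => (\sum_(z <- z :: s) F z x)%:E) =
      (fun x => (F z x + \sum_(z <- s) F z x)%:E).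
    by apply/funext => x; rewrite big_cons.
  exact: (integrable_add mM).
by case.
Qed.

End Green.

(** * Connectedness of the surface *)
Lemma connected_clopen (T : topologicalType) (M A : set T) : connected M -> A `<=` M ->
  A !=set0 ->
  (forall x, A x -> exists2 Z : set T, open Z /\ Z x & forall y, M y -> Z y -> A y) ->
  (forall x, M x -> ~ A x -> exists2 Z : set T, open Z /\ Z x & forall y, M y -> Z y -> ~ A y) ->
  A = M.
Proof.
move=> conM AM A0 oA cA; apply: conM => //.
- exists (interior [set y | M y -> A y]); first exact: open_interior.
  apply/seteqP; split => [x Ax|x [Mx /interior_subset]]; last exact.
  split; first exact: AM.
  have [Z [oZ Zx] h] := oA x Ax.
  by rewrite /interior; apply: filterS (open_nbhs_nbhs (conj oZ Zx)) => y Zy My; exact: h.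
- exists (~` (interior [set y | M y -> ~ A y])); first exact/open_closedC/open_interior.
  apply/seteqP; split => [x Ax|x [Mx nI]].
    by split; [exact: AM|move=> /interior_subset h; exact: (h (AM _ Ax) Ax)].
  apply: contrapT => nAx; apply: nI; have [Z [oZ Zx] h] := cA x Mx nAx.
  by rewrite /interior; apply: filterS (open_nbhs_nbhs (conj oZ Zx)) => y Zy My; exact: h.
Qed.

Section SphereConnected.
Context {R : realType}.
Local Notation E3 := 'rV[R]_3.

(** The segment from x to y projected radially onto the sphere. *)
Definition arc (x y : E3) (t : R) : E3 :=
  let z := (1 - t) *: x + t *: y in (Num.sqrt (dot z z))^-1 *: z.

(** If the angle between x and y is at most a right one, the segment avoids the
origin. *)
Lemma segment_dot_gt0 (x y : E3) (t : R) : sphere2 x -> sphere2 y -> 0 <= dot x y ->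
  0 <= t <= 1 -> 0 < dot ((1 - t) *: x + t *: y) ((1 - t) *: x + t *: y).
Proof.
rewrite /sphere2 /= => xx yy xy /andP[t0 t1].
rewrite !(dotDl, dotDr) !(dotZl, dotZr) (dotC y x) xx yy.
have h : 0 <= (1 - t) * (t * dot x y).
  by rewrite mulr_ge0 ?subr_ge0// mulr_ge0.
by nra.
Qed.

Lemma arc_sphere (x y : E3) (t : R) : sphere2 x -> sphere2 y -> 0 <= dot x y ->
  0 <= t <= 1 -> sphere2 (arc x y t).
Proof.
move=> xx yy xy tt; have := segment_dot_gt0 xx yy xy tt.
rewrite /sphere2 /arc /=; set z := _ + _ => z0.
rewrite dotZl dotZr mulrA -expr2 exprVn sqr_sqrtr ?ltW// mulVf// gt_eqF//.
Qed.

Lemma continuous_row (T : topologicalType) (g : T -> E3) (p : T) :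
  (forall k : 'I_3, {for p, continuous (fun q => g q 0 k)}) -> {for p, continuous g}.
Proof.
move=> cg A [P nP sub].
have n k : \forall q \near p, P 0 k (g q 0 k) by apply: cg; exact: nP.
have : \forall q \near p, forall k, P 0 k (g q 0 k).
  by apply: filter_forall => k; exact: n.
by apply: filterS => q h; apply: sub => i j; rewrite ord1; exact: h.
Qed.

Lemma arc_continuous (x y : E3) : sphere2 x -> sphere2 y -> 0 <= dot x y ->
  {within `[(0 : R), 1], continuous (arc x y)}.
Proof.
move=> xx yy xy; apply: continuous_in_subspaceT => t; rewrite inE /= in_itv/= => tt.
have z0 := segment_dot_gt0 xx yy xy tt.
pose z (s : R) : E3 := (1 - s) *: x + s *: y.
have cz k : {for t, continuous (fun s => z s 0 k)}.
  have -> : (fun s => z s 0 k) = (fun s => (1 - s) * x 0 k + s * y 0 k).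
    by apply/funext => s; rewrite !mxE.
  apply: cvgD; apply: cvgM; try exact: cvg_cst.
    by apply: cvgB; [exact: cvg_cst|exact: cvg_id].
  exact: cvg_id.
have cd : {for t, continuous (fun s => dot (z s) (z s))}.
  apply: sum_continuous => k; exact: (cvgM (cz k) (cz k)).
apply: continuous_row => k.
have -> : (fun s => arc x y s 0 k) = (fun s => (Num.sqrt (dot (z s) (z s)))^-1 * z s 0 k).
  by apply/funext => s; rewrite /arc !mxE.
have cs : {for t, continuous (fun s => (Num.sqrt (dot (z s) (z s)))^-1)}.
  apply: cvgV; first by rewrite gt_eqF// sqrtr_gt0.
  exact: (cvg_comp _ _ cd (@sqrt_continuous R _)).
exact: (cvgM cs (cz k)).
Qed.

Lemma sphere_arc_connected (x y : E3) : sphere2 x -> sphere2 y -> 0 <= dot x y ->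
  connected_component sphere2 x y.
Proof.
move=> xx yy xy.
have a0 : arc x y 0 = x.
  by rewrite /arc subr0 scale1r scale0r addr0 xx sqrtr1 invr1 scale1r.
have a1 : arc x y 1 = y.
  by rewrite /arc subrr scale1r scale0r add0r yy sqrtr1 invr1 scale1r.
exists (arc x y @` `[0, 1]%classic).
  split.
  - by exists 0 => //=; rewrite in_itv/= lexx ler01.
  - by move=> _ [t tt <-]; apply: arc_sphere => //; move: tt; rewrite /= in_itv.
  - apply: connected_continuous_connected; first exact: segment_connected.
    exact: arc_continuous.
by exists 1 => //=; rewrite in_itv/= lexx ler01.
Qed.

(** Every point makes an angle of at most a right one with the north or the south
pole, and both poles are orthogonal to a point of the equator. *)
Lemma sphere2_connected : connected (@sphere2 R).
Proof.
pose e (k : 'I_3) : E3 := delta_mx 0 k.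
have dote k (x : E3) : dot (e k) x = x 0 k.
  rewrite /dot (bigD1 k)//= big1 ?addr0 => [|j jk].
    by rewrite mxE !eqxx mul1r.
  by rewrite mxE (negbTE jk) andbF mul0r.
have se k : sphere2 (e k) by rewrite /sphere2 /= dote mxE !eqxx.
have dotNe (x : E3) : sphere2 x -> sphere2 (- x).
  by rewrite /sphere2 /= dotNl dotNr opprK.
suff -> : sphere2 = connected_component sphere2 (e ord0) by exact: component_connected.
apply/seteqP; split; last exact: connected_component_sub.
move=> x xx.
pose v : E3 := if 0 <= x 0 ord_max then e ord_max else - e ord_max.
have sv : sphere2 v by rewrite /v; case: ifP => _ //; exact: dotNe.
apply: (connected_component_trans (y := v)).
  apply: sphere_arc_connected => //.
  by rewrite /v; case: ifP => _; rewrite ?dotNr dote !mxE /= ?oppr0.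
apply: sphere_arc_connected => //.
rewrite /v; case: ifPn => [|]; first by rewrite dote.
by rewrite -ltNge dotNl dote oppr_ge0 => /ltW.
Qed.

Lemma smooth_sphere_connected (M : set E3) : smooth_sphere M -> connected M.
Proof.
move=> [_ _ [h [k [_ ck hM kM [kh hk]]]]].
have -> : M = k @` sphere2.
  apply/seteqP; split => [x Mx|_ [y Sy <-]]; last exact: kM.
  by exists (h x); [exact: hM|exact: kh].
exact: connected_continuous_connected sphere2_connected ck.
Qed.

End SphereConnected.

(** * Comparison of solutions *)
Section Comparison.
Context {R : realType}.
Local Notation E3 := 'rV[R]_3.
Local Notation B3 := (borel3 R).
Variables (M : set E3) (sigma : {measure set B3 -> \bar R}).
Hypotheses (cM : compact M) (reg : regular_surface M) (area : is_area_measure M sigma).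
Hypothesis conM : connected M.
Variable H : E3 -> R.
Hypothesis cH : {within M, continuous H}.
Implicit Types (U : set (R * R)) (phi : R * R -> E3) (p : R * R).

Let mM : measurable (M : set B3). Proof. exact: borel3_surface. Qed.

Lemma CkM1_scale (a : R) (h : E3 -> R) : CkM 1 M h -> CkM 1 M (fun x => a * h x).
Proof. by move=> Ch U phi c; apply: (Ck1Ml a (chart_open c)); exact: Ch. Qed.

Lemma CkM1_add (g h : E3 -> R) : CkM 1 M g -> CkM 1 M h -> CkM 1 M (fun x => g x + h x).
Proof. by move=> Cg Ch U phi c; apply: (Ck1D (chart_open c)); [exact: Cg|exact: Ch]. Qed.

Lemma CkM1_cst (a : R) : CkM 1 M (fun=> a).
Proof. by move=> U phi c; exact: Ck1_cst (chart_open c). Qed.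

Lemma locally_constant_connected (w : E3 -> R) : {within M, continuous w} ->
  (forall x, M x -> exists2 Z : set E3, open Z /\ Z x & forall y, M y -> Z y -> w y = w x) ->
  forall x y, M x -> M y -> w x = w y.
Proof.
move=> cw loc x y Mx My.
have E : M `&` [set z | w z = w y] = M.
  apply: connected_clopen => //.
  - by exists y; split.
  - move=> z [Mz /= zy]; have [Z oZ h] := loc z Mz; exists Z => // t Mt Zt.
    by split => //=; rewrite h.
  - move=> z Mz nz; have [Z oZ h] := loc z Mz; exists Z => // t Mt Zt [_ /= ty].
    by apply: nz; split => //=; rewrite -(h t).
by move: Mx; rewrite -E => -[].
Qed.

(** With K large, psi = f + K - u is nonnegative, so u + t psi is admissible for
small t > 0.  The first variation of u in this direction, minus Green's
identity, is - int |D|^2 with D the weak gradient of psi.  So psi is constant. *)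
Theorem not_in_contact (f : E3 -> R) (beta e : R) u G :
  CkM 2 M f -> is_laplacian M f H -> CkM 1 M u -> minimizer M sigma H beta u G ->
  (forall x, M x -> `|u x| <= beta / 2) -> 0 < e ->
  (forall x, M x -> u x <= beta / 2 - e) ->
  forall x y, M x -> M y -> f x - f y = u x - u y.
Proof.
move=> Cf lap Cu min ub e0 ue.
have Cf1 := CkM_2_1 Cf; have cf := CkM_continuous reg Cf; have cu := CkM_continuous reg Cu.
have [K0 K00 fK] := compact_bound cM cf.
pose K := K0 + `|beta| / 2.
pose fK1 x := f x + K.
have CfK : CkM 1 M fK1 := CkM1_add Cf1 (CkM1_cst K).
have cfK := CkM_continuous reg CfK.
pose psi x := fK1 x + (-1) * u x.
pose D x := grad M fK1 x + (-1) *: G x.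
have [[hu _] _] := min.
have hpsi : H1 M sigma psi D.
  apply: (H1_add_scale cM reg area) => //; exact: (H1_grad cM reg area CfK).
have Cpsi : CkM 1 M psi := CkM1_add CfK (CkM1_scale (-1) Cu).
have cpsi := CkM_continuous reg Cpsi.
have b0 : `|beta / 2| = `|beta| / 2 by rewrite normrM [X in _ * X]ger0_norm.
have psi0 x : M x -> 0 <= psi x.
  move=> Mx; have := fK x Mx; have := ub x Mx; rewrite !ler_norml /psi /fK1 /K.
  by have := ler_norm (beta / 2); rewrite b0 => h1 /andP[? ?] /andP[? ?]; lra.
have [C C0 HC] := compact_bound cM cpsi.
have gE x : M x -> grad M fK1 x = grad M f x.
  move=> Mx; have [U [phi [c [p Up px]]]] := reg Mx; subst x.
  have oU := chart_open c.
  rewrite (gradE CfK c Up) (gradE Cf1 c Up) /chart_grad; congr tangent_vector.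
  apply/rowP => i; rewrite !mxE.
  by rewrite (pdD i oU (Cf1 _ _ c) (Ck1_cst K oU) Up) pd_cst addr0.
have vi : 0 <= \int[sigma]_(x in M) (dot (G x) (D x) + H x * psi x).
  apply: (variational_inequality cM reg area (t0 := e / C) cH cu cpsi min hpsi).
    by rewrite divr_gt0.
  move=> t /andP[t0 te] x Mx; have := ub x Mx; have := ue x Mx; have := psi0 x Mx.
  move=> p0 ux; rewrite !ler_norml => /andP[u1 u2]; apply/andP; split.
    by rewrite (le_trans u1)// lerDl mulr_ge0// ltW.
  have : t * psi x <= e.
    apply: (@le_trans _ _ (e / C * C)); last by rewrite divfK// gt_eqF.
    apply: ler_pM => //; first exact: ltW.
    by rewrite (le_trans _ (HC x Mx))// ler_norm.
  by move: ux; lra.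
have gr := green cM reg area Cf lap cH cpsi hpsi.
have hf := H1_grad cM reg area Cf1.
have iGD := H1_dot_integrable cM hu hpsi; have iFD := H1_dot_integrable cM hf hpsi.
have iDD := H1_dot_integrable cM hpsi hpsi.
have iHp := continuous_mul_integrable cM reg area cH cpsi.
have DD : \int[sigma]_(x in M) (1 * dot (D x) (D x)) <= 0.
  have -> : \int[sigma]_(x in M) (1 * dot (D x) (D x)) =
     \int[sigma]_(x in M) ((dot (grad M f x) (D x) + H x * psi x) -
                          (dot (G x) (D x) + H x * psi x)).
    apply: eq_Rintegral => x /[!inE] Mx; rewrite mul1r {1}/D dotDl dotZl gE//; ring.
  rewrite (RintegralB mM (integrable_add mM iFD iHp) (integrable_add mM iGD iHp)).
  by rewrite gr sub0r oppr_le0.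
have c1 := CkM_continuous reg (CkM1_cst 1).
have loc x : M x -> exists2 Z : set E3, open Z /\ Z x & forall y, M y -> Z y -> psi y = psi x.
  move=> Mx.
  by apply: (locally_constant cM reg area hpsi Cpsi c1 _ DD Mx) => // y _; exact: ler01.
move=> x y Mx My; have := locally_constant_connected cpsi loc Mx My.
rewrite /psi /fK1; lra.
Qed.

(** The locality hypothesis says that every point of M has a neighbourhood which
lies in A or on which u - v - k <= 0 within A; thus the truncation of the
direction theta to A is still C^1.  The two conditions on A make v + t theta
and u - t theta admissible.  The terms in H cancel in the sum of the
variational inequalities. *)
Theorem comparison (A : set E3) (k bu bv : R) u Gu v Gv :
  CkM 1 M u -> CkM 1 M v -> minimizer M sigma H bu u Gu -> minimizer M sigma H bv v Gv ->
  (forall x, M x -> `|u x| <= bu / 2) -> (forall x, M x -> `|v x| <= bv / 2) ->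
  A `<=` M ->
  (forall x, M x -> exists2 Z : set E3, open Z /\ Z x &
     (forall y, M y -> Z y -> A y) \/
     (forall y, M y -> Z y -> A y -> u y - v y - k <= 0)) ->
  (forall x, A x -> 0 < u x - v x - k -> u x - k <= bv / 2) ->
  (forall x, A x -> 0 < u x - v x - k -> - (bu / 2) <= v x + k) ->
  (forall x, A x -> u x - v x <= k) \/
  (A = M /\ exists2 c, k < c & forall x, M x -> u x - v x = c).
Proof.
move=> Cu Cv minu minv ub vb AM loc cond1 cond2.
have cu := CkM_continuous reg Cu; have cv := CkM_continuous reg Cv.
have [[hu _] _] := minu; have [[hv _] _] := minv.
pose w x := u x + (-1) * v x; pose D x := Gu x + (-1) *: Gv x.
have hw : H1 M sigma w D by apply: (H1_add_scale cM reg area).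
have Cw : CkM 1 M w := CkM1_add Cu (CkM1_scale (-1) Cv).
have cw := CkM_continuous reg Cw.
have wE x : w x = u x - v x by rewrite /w mulN1r.
pose W x := w x + (- k).
have CW : CkM 1 M W := CkM1_add Cw (CkM1_cst (- k)).
have WE x : W x = u x - v x - k by rewrite /W wE.
(* The power 3 makes the derivative q of theta with respect to w of class C^1. *)
pose th x := if x \in A then Num.max 0 (W x) ^+ 3 else 0.
pose q x := if x \in A then 3 * Num.max 0 (W x) ^+ 2 else 0.
have local U phi p : chart M U phi -> U p -> exists O : set (R * R),
    [/\ open O, O p, O `<=` U &
     (forall r, O r -> th (phi r) = Num.max 0 (W (phi r)) ^+ 3 /\
                       q (phi r) = 3 * Num.max 0 (W (phi r)) ^+ 2) \/
     (forall r, O r -> th (phi r) = 0 /\ q (phi r) = 0)].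
  move=> c Up; have oU := chart_open c; have Mp := chart_in c Up.
  have [Z [oZ Zp] hZ] := loc _ Mp.
  exists (U `&` phi @^-1` Z); split => //.
  - by rewrite openE => r [Ur Zr]; exact: (chart_preimage c Ur oZ Zr).
  - case: hZ => hZ; [left|right] => r [Ur Zr]; have Mr := chart_in c Ur.
      by rewrite /th /q mem_set//; exact: hZ.
    rewrite /th /q; case: ifPn => //; rewrite inE => /(hZ _ Mr Zr); rewrite -WE => h.
    by rewrite max_l// !expr0n /= mulr0.
have CW3 U phi : chart M U phi -> Ck 1 U (fun r => Num.max 0 (W (phi r)) ^+ 3).
  by move=> c; exact: (Ck1_pos_pow 1 (chart_open c) (CW _ _ c)).
have CW2 U phi : chart M U phi -> Ck 1 U (fun r => 3 * Num.max 0 (W (phi r)) ^+ 2).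
  move=> c; apply: (Ck1Ml 3 (chart_open c)).
  exact: (Ck1_pos_pow 0 (chart_open c) (CW _ _ c)).
have Cth : CkM 1 M th.
  move=> U phi c; apply: Ck1_local => p Up; have [Q [oQ Qp QU h]] := local U phi p c Up.
  case: h => h.
    exists Q, (fun r => Num.max 0 (W (phi r)) ^+ 3); split => //.
      exact: Ck1S QU (CW3 _ _ c).
    by move=> r /h[].
  exists Q, (cst 0); split => //; first exact: Ck1_cst.
  by move=> r /h[].
have Cq : CkM 1 M q.
  move=> U phi c; apply: Ck1_local => p Up; have [Q [oQ Qp QU h]] := local U phi p c Up.
  case: h => h.
    exists Q, (fun r => 3 * Num.max 0 (W (phi r)) ^+ 2); split => //.
      exact: Ck1S QU (CW2 _ _ c).
    by move=> r /h[].
  exists Q, (cst 0); split => //; first exact: Ck1_cst.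
  by move=> r /h[].
have dth U phi p i : chart M U phi -> U p ->
    pd i (th \o phi) p = q (phi p) * pd i (w \o phi) p.
  move=> c Up; have oU := chart_open c; have [Q [oQ Qp QU h]] := local U phi p c Up.
  case: h => h; last first.
    rewrite (pd_eq_on (h := cst 0) i oQ Qp); last by move=> r /h[].
    by rewrite pd_cst (h p Qp).2 mul0r.
  rewrite (pd_eq_on (h := fun r => Num.max 0 (W (phi r)) ^+ 3) i oQ Qp); last by move=> r /h[].
  rewrite (pd_pos_pow 1 i oU (CW _ _ c) Up) (h p Qp).2; congr (_ * _).
  rewrite (pdD i oU (Cw _ _ c) (Ck1_cst (- k) oU) Up) pd_cst addr0 //.
have th_ge0 x : 0 <= th x.
  by rewrite /th; case: ifP => // _; rewrite exprn_ge0// le_max lexx.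
have q_ge0 x : 0 <= q x.
  by rewrite /q; case: ifP => // _; rewrite mulr_ge0// exprn_ge0// le_max lexx.
have hth s : H1 M sigma (fun x => s * th x) (fun x => (s * q x) *: D x).
  apply: (H1_chain cM reg area hw Cw (CkM1_scale s Cth) (CkM1_scale s Cq)).
  move=> U phi p i c Up.
  by rewrite (pdMl i s (chart_open c) (Cth _ _ c) Up) (dth _ _ _ i c Up) mulrA.
have [C C0 HC] := compact_bound cM (CkM_continuous reg CW).
(* With |W| <= C on M, t0 W^3 <= W where W > 0. *)
pose t0 := (C ^+ 2)^-1; have t00 : 0 < t0 by rewrite invr_gt0 exprn_gt0.
have bound t x : 0 < t <= t0 -> M x ->
    t * th x = 0 \/ [/\ A x, 0 < W x & t * th x <= W x].
  move=> /andP[tp tt] Mx; rewrite /th; case: ifPn; last by rewrite mulr0; left.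
  rewrite inE => Ax; have [W0|W0] : W x <= 0 \/ 0 < W x by case: (leP (W x) 0); auto.
    by left; rewrite max_l// expr0n mulr0.
  right; split => //; rewrite max_r ?(ltW W0)// exprS mulrCA -[leRHS]mulr1.
  rewrite ler_pM2l// -(mulVf (x := C ^+ 2)) ?gt_eqF ?exprn_gt0//.
  apply: ler_pM; [exact: ltW|by rewrite exprn_ge0// ltW|exact: tt|].
  rewrite lerXn2r ?nnegrE// ?(ltW W0) ?(ltW C0)//.
  by rewrite (le_trans _ (HC x Mx))// ler_norm.
have cth s : {within M, continuous (fun x => s * th x)}.
  exact: (CkM_continuous reg (CkM1_scale s Cth)).
have vi1 : 0 <= \int[sigma]_(x in M) (dot (Gv x) ((1 * q x) *: D x) + H x * (1 * th x)).
  apply: (variational_inequality cM reg area cH cv (cth 1) minv (hth 1) t00).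
  move=> t tt x Mx; rewrite mul1r; have := vb x Mx.
  case: (bound t x tt Mx) => [->|[Ax W0 le]]; first by rewrite addr0.
  rewrite !ler_norml => /andP[v1 v2]; apply/andP; split.
    by rewrite (le_trans v1)// lerDl mulr_ge0//; case/andP: tt => /ltW.
  by have := cond1 x Ax; rewrite -WE => /(_ W0); move: le; rewrite WE; lra.
have vi2 : 0 <= \int[sigma]_(x in M) (dot (Gu x) (((-1) * q x) *: D x) + H x * ((-1) * th x)).
  apply: (variational_inequality cM reg area cH cu (cth (-1)) minu (hth (-1)) t00).
  move=> t tt x Mx; rewrite mulN1r mulrN; have := ub x Mx.
  case: (bound t x tt Mx) => [->|[Ax W0 le]]; first by rewrite subr0.
  rewrite !ler_norml => /andP[u1 u2]; apply/andP; split; last first.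
    by rewrite (le_trans _ u2)// gerBl mulr_ge0//; case/andP: tt => /ltW.
  by have := cond2 x Ax; rewrite -WE => /(_ W0); move: le; rewrite WE; lra.
have qD : \int[sigma]_(x in M) (q x * dot (D x) (D x)) <= 0.
  have i1 := integrable_add mM (H1_dot_integrable cM hv (hth 1))
    (continuous_mul_integrable cM reg area cH (cth 1)).
  have i2 := integrable_add mM (H1_dot_integrable cM hu (hth (-1)))
    (continuous_mul_integrable cM reg area cH (cth (-1))).
  have := addr_ge0 vi1 vi2; rewrite -(RintegralD mM i1 i2).
  have -> : \int[sigma]_(x in M) (dot (Gv x) ((1 * q x) *: D x) + H x * (1 * th x) +
      (dot (Gu x) (((-1) * q x) *: D x) + H x * ((-1) * th x))) =
      \int[sigma]_(x in M) ((-1) * (q x * dot (D x) (D x))).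
    apply: eq_Rintegral => x _; rewrite !dotZr [in RHS]/D !(dotDl, dotZl).
    by rewrite -/(D x); ring.
  rewrite RintegralZl//; first by rewrite mulN1r oppr_ge0.
  have [_ _ _ _ _] := hth 1.
  have := H1_dot_integrable cM hw (hth 1).
  by under eq_fun do rewrite dotZr mul1r.
have locw x : A x -> 0 < W x -> exists2 Z : set E3, open Z /\ Z x &
    forall y, M y -> Z y -> w y = w x.
  move=> Ax W0; apply: (locally_constant cM reg area hw Cw (CkM_continuous reg Cq)) => //.
    exact: AM.
  by rewrite /q mem_set// max_r ?ltW// mulr_gt0// exprn_gt0.
have [[x0 Ax0 W0]|none] := pselect (exists2 x, A x & 0 < W x); last first.
  left => x Ax; rewrite -subr_le0 -WE leNgt; apply/negP => W0.
  by apply: none; exists x.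
(* The level set of w through a point of A with W > 0 is open in M and closed in
   M, the points outside A having neighbourhoods where W <= 0 within A. *)
right; pose S := A `&` [set y | w y = w x0].
have SM : S = M.
  apply: connected_clopen => //.
  - by move=> y [/AM].
  - by exists x0; split.
  - move=> y [Ay /= yw].
    have Wy : 0 < W y by rewrite /W yw.
    have [Z [oZ Zy] hZ] := loc y (AM _ Ay); have [Z' [oZ' Zy'] hZ'] := locw y Ay Wy.
    case: hZ => hZ; last by have := hZ y (AM _ Ay) Zy Ay; rewrite -WE leNgt Wy.
    exists (Z `&` Z'); first by split; [exact: openI|].
    by move=> z Mz [Zz Zz']; split; [exact: hZ|rewrite /= hZ'].
  - move=> y My nS; have [Z [oZ Zy] hZ] := loc y My.
    have [yw|yw] := pselect (w y = w x0).
      case: hZ => hZ; first by exfalso; apply: nS; split => //; exact: hZ.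
      exists Z => // z Mz Zz [Az /= zw]; have := hZ z Mz Zz Az; rewrite -WE /W zw leNgt.
      by move: W0; rewrite /W => ->.
    have [Z' oZ' hZ'] : exists2 Z' : set E3, open Z' /\ Z' y &
        forall z, M z -> Z' z -> w z != w x0.
      apply: (within_nbhs (P := fun t => t != w x0) cw My).
      by apply: open_nbhs_nbhs; split; [exact: open_neq|exact/eqP].
    by exists Z' => // z Mz Zz [_ /= zw]; have := hZ' z Mz Zz; rewrite zw eqxx.
split; first by apply/seteqP; split => // y; rewrite -{1}SM => -[].
exists (w x0); first by rewrite -subr_gt0.
by move=> x; rewrite -{1}SM -wE => -[].
Qed.

End Comparison.

(** * Components of the superconductivity region *)
Section Components.
Context {R : realType}.
Local Notation E3 := 'rV[R]_3.
Implicit Types (M : set E3).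

(** The image of a segment in a chart joins nearby points within a small
neighbourhood. *)
Lemma surface_locally_connected M (Z : set E3) x : regular_surface M -> M x ->
  open Z -> Z x -> exists2 Z' : set E3, open Z' /\ Z' x & forall y, M y -> Z' y ->
    exists B : set E3, [/\ B x, B y, connected B & B `<=` M `&` Z].
Proof.
move=> reg Mx oZ Zx; have [U [phi [c [p Up px]]]] := reg x Mx; subst x.
have oU := chart_open c.
have oV : open (U `&` phi @^-1` Z).
  by rewrite openE => q [Uq Zq]; exact: (chart_preimage c Uq oZ Zq).
have [r r0 Hr] := open_box oV (conj Up Zx : (U `&` phi @^-1` Z) p).
have nP : \forall q \near p, `|q.1 - p.1| < r /\ `|q.2 - p.2| < r.
  exists (ball p.1 r, ball p.2 r) => /=; first by split; apply: nbhsx_ballx.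
  by move=> q [/= q1 q2]; split; rewrite distrC.
have [Z' oZ' sub] := chart_nbhs c Up nP.
exists Z' => // y My Zy; have [|q [Uq [q1 q2]] <-] := sub y; first by split.
pose g (t : R) : R * R := t *: (q - p) + p.
have gV t : 0 <= t <= 1 -> (U `&` phi @^-1` Z) (g t).
  move=> /andP[t0 t1]; apply: Hr; rewrite /g /= addrK.
    by apply: le_lt_trans q1; rewrite normrM (ger0_norm t0) ler_piMl.
  by apply: le_lt_trans q2; rewrite normrM (ger0_norm t0) ler_piMl.
have g0 : g 0 = p by rewrite /g scale0r add0r.
have g1 : g 1 = q by rewrite /g scale1r subrK.
exists ((phi \o g) @` `[0, 1]%classic); split.
- by exists 0; rewrite /= ?g0// in_itv/= lexx ler01.
- by exists 1; rewrite /= ?g1// in_itv/= lexx ler01.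
- apply: connected_continuous_connected; first exact: segment_connected.
  apply: continuous_in_subspaceT => t; rewrite inE /= in_itv/= => tt.
  have [Ug _] := gV t tt; apply: continuous_comp; last exact: (chart_continuous c Ug).
  by apply/differentiable_continuous/differentiableD.
- move=> _ [t tt <-]; move: tt; rewrite /= in_itv/= => /gV[Ug Zg].
  by split => //; exact: (chart_in c Ug).
Qed.

Variables (M : set E3) (b : R) (V : E3 -> R) (omega : set E3).
Hypotheses (cM : compact M) (reg : regular_surface M) (cV : {within M, continuous V}).
Hypothesis comp : is_component (SC M b V) omega.

Lemma component_sub : omega `<=` SC M b V.
Proof. by have [x _ ->] := comp; exact: connected_component_sub. Qed.

Lemma component_surface : omega `<=` M.
Proof. by move=> x /component_sub[]. Qed.

Lemma component_nonempty : omega !=set0.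
Proof. by have [x Ax ->] := comp; exists x; exact: connected_component_refl. Qed.

Lemma SC_component_nbhs x : SC M b V x ->
  exists2 Z : set E3, open Z /\ Z x &
    forall y, M y -> Z y -> connected_component (SC M b V) x y.
Proof.
move=> [Mx Vx].
have [Z1 [oZ1 Z1x] h1] : exists2 Z : set E3, open Z /\ Z x &
    forall y, M y -> Z y -> `|V y| < b / 2.
  apply: (within_nbhs (P := fun t => `|t| < b / 2) cV Mx).
  exact: (@norm_continuous _ _ (V x : R^o) _ (lt_nbhsl Vx : nbhs `|V x| [set t | t < b / 2])).
have [Z [oZ Zx] h] := surface_locally_connected reg Mx oZ1 Z1x.
exists Z => // y My Zy; have [B [Bx By cB sub]] := h y My Zy.
exists B => //; split => // z /sub[Mz Zz].
by split => //; exact: h1.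
Qed.

Lemma component_open x : omega x ->
  exists2 Z : set E3, open Z /\ Z x & forall y, M y -> Z y -> omega y.
Proof.
move=> ox; have [Z oZ h] := SC_component_nbhs (component_sub ox).
exists Z => // y My Zy; have := h y My Zy; have [x0 _ E] := comp.
by move: ox; rewrite E; exact: connected_component_trans.
Qed.

Lemma SC_closure_component : SC M b V `&` closure omega = omega.
Proof.
apply/seteqP; split => [x [Sx clx]|x ox]; last first.
  by split; [exact: component_sub|exact: subset_closure].
have [Z [oZ Zx] h] := SC_component_nbhs Sx.
have [y [oy Zy]] := clx Z (open_nbhs_nbhs (conj oZ Zx)).
have xy := h y (component_surface oy) Zy.
move: oy; have [x0 _ ->] := comp => x0y.
exact: connected_component_trans x0y (connected_component_sym xy).
Qed.

Lemma closure_component_sub : closure omega `<=` M.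
Proof.
rewrite (closure_id M).1; last exact: surface_closed.
exact: closure_subset component_surface.
Qed.

Lemma closure_component_boundary x : closure omega x -> ~ omega x -> boundary_in M omega x.
Proof.
move=> clx nx; have Mx := closure_component_sub clx.
by split; [split|apply: subset_closure; split].
Qed.

(** A boundary point of omega in the region would belong to omega, which is open. *)
Lemma boundary_not_SC x : boundary_in M omega x -> ~ SC M b V x.
Proof.
move=> [[Mx clx] clc] Sx.
have /component_open[Z [oZ Zx] h] : omega x by rewrite -SC_closure_component.
have [y [[My ny] Zy]] := clc Z (open_nbhs_nbhs (conj oZ Zx)).
exact/ny/h.
Qed.

(** Provides the locality hypothesis of [comparison] for A = omega: a point lies in
the open set omega, off its closure, or on its boundary, where w < 0 is an open
condition. *)
Lemma component_dichotomy (w : E3 -> R) : {within M, continuous w} ->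
  (forall x, boundary_in M omega x -> w x < 0) ->
  forall x, M x -> exists2 Z : set E3, open Z /\ Z x &
     (forall y, M y -> Z y -> omega y) \/
     (forall y, M y -> Z y -> omega y -> w y <= 0).
Proof.
move=> cw wb x Mx; have [ox|nx] := pselect (omega x).
  by have [Z oZ h] := component_open ox; exists Z => //; left.
have [clx|nclx] := pselect (closure omega x); last first.
  exists (~` closure omega); first by split => //; exact/closed_openC/closed_closure.
  by right => y _ ny /subset_closure.
have w0 := wb x (closure_component_boundary clx nx).
have [Z oZ h] := within_nbhs (P := fun t => t < 0) cw Mx (lt_nbhsl w0).
by exists Z => //; right => y My Zy _; exact/ltW/h.
Qed.

Lemma SC_closure_component_eq (b' : R) (V' : E3 -> R) :
  (forall x, omega x -> `|V' x| < b' / 2) ->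
  (forall x, boundary_in M omega x -> ~ `|V' x| < b' / 2) ->
  SC M b' V' `&` closure omega = omega.
Proof.
move=> Vo Vb; apply/seteqP; split => [x [[Mx Vx] clx]|x ox].
  by apply: contrapT => nx; exact: (Vb x (closure_component_boundary clx nx)).
by split; [split; [exact: component_surface|exact: Vo]|exact: subset_closure].
Qed.

End Components.

(** * Dependence of the solution on the width of the obstacles *)
Section SolutionComparison.
Context {R : realType}.
Local Notation E3 := 'rV[R]_3.
Variables (M : set E3) (sigma : {measure set (borel3 R) -> \bar R}).
Hypotheses (cM : compact M) (reg : regular_surface M) (area : is_area_measure M sigma).
Hypothesis conM : connected M.
Variable H : E3 -> R.
Hypothesis cH : {within M, continuous H}.

(** With A = M and k half the difference of the widths, v + k and u - k meet
the constraints automatically where u - v > k.  In the constant case v would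
stay away from its upper obstacle, which the contact hypothesis forbids. *)
Lemma solution_comparison (bu bv : R) u Gu v Gv :
  CkM 1 M u -> CkM 1 M v -> minimizer M sigma H bu u Gu -> minimizer M sigma H bv v Gv ->
  (forall x, M x -> `|u x| <= bu / 2) -> (forall x, M x -> `|v x| <= bv / 2) ->
  (forall e, 0 < e -> ~ (forall x, M x -> v x <= bv / 2 - e)) ->
  forall x, M x -> u x - v x <= `|bu - bv| / 2.
Proof.
move=> Cu Cv minu minv ub vb touch; set k := `|bu - bv| / 2.
have [k1 k2] : bu - bv <= 2 * k /\ bv - bu <= 2 * k.
  have e2 : 2 * k = `|bu - bv| by rewrite /k mulrC divfK.
  by rewrite e2; split; [exact: ler_norm|rewrite distrC; exact: ler_norm].
have [|||h|[_ [c kc Vc]]] := comparison (A := M) (k := k) cM reg area conM cH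
    Cu Cv minu minv ub vb (@subset_refl _ M).
- by move=> y My; exists setT; [split => //; exact: openT|left].
- by move=> y My _; have := ub y My; rewrite ler_norml => /andP[? ?]; lra.
- by move=> y My _; have := vb y My; rewrite ler_norml => /andP[? ?]; lra.
- exact: h.
- exfalso; apply: (touch (c - k)); first by rewrite subr_gt0.
  by move=> y My; have := Vc y My; have := ub y My; rewrite ler_norml => /andP[? ?]; lra.
Qed.

(** The comparison is applied with k + e, which makes the boundary inequality
strict; the constant case would need omega = M. *)
Lemma component_comparison (b : R) (W : E3 -> R) (omega : set E3) (k bu bv : R) u Gu v Gv :
  {within M, continuous W} -> is_component (SC M b W) omega -> omega <> M ->
  CkM 1 M u -> CkM 1 M v -> minimizer M sigma H bu u Gu -> minimizer M sigma H bv v Gv ->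
  (forall x, M x -> `|u x| <= bu / 2) -> (forall x, M x -> `|v x| <= bv / 2) ->
  (forall x, boundary_in M omega x -> u x - v x <= k) ->
  (forall x, omega x -> u x - k <= bv / 2) ->
  (forall x, omega x -> - (bu / 2) <= v x + k) ->
  forall x, omega x -> u x - v x <= k.
Proof.
move=> cW comp oM Cu Cv minu minv ub vb bd c1 c2 x ox.
apply/ler_addgt0Pr => e e0.
have cw : {within M, continuous (fun y => u y - v y - (k + e))}.
  move=> y; apply: cvgB; last exact: cvg_cst.
  by apply: cvgB; [exact: (CkM_continuous reg Cu)|exact: (CkM_continuous reg Cv)].
have [|||h|[oE _]] := comparison (A := omega) (k := k + e) cM reg area conM cH
    Cu Cv minu minv ub vb (component_surface comp).
- by apply: (component_dichotomy cM reg cW comp cw) => y bdy; have := bd y bdy; lra.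
- by move=> y oy _; have := c1 y oy; lra.
- by move=> y oy _; have := c2 y oy; lra.
- exact: h.
- by have := oM oE.
Qed.

End SolutionComparison.

Lemma oscillation_gt (R : realType) (M : set 'rV[R]_3) (f : 'rV[R]_3 -> R) (b : R) :
  compact M -> M !=set0 -> {within M, continuous f} -> b < oscillation M f ->
  exists x y, [/\ M x, M y & b < f x - f y].
Proof.
move=> cM M0 cf; rewrite /oscillation => bo.
have [C C0 HC] := compact_bound cM cf.
have fM0 : f @` M !=set0 by have [x Mx] := M0; exists (f x); exists x.
have hs : has_sup (f @` M).
  by split => //; exists C => _ [x Mx <-]; rewrite (le_trans _ (HC x Mx))// ler_norm.
have hi : has_inf (f @` M).
  split => //; exists (- C) => _ [x Mx <-].
  by have := HC x Mx; rewrite ler_norml => /andP[].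
pose e := (sup (f @` M) - inf (f @` M) - b) / 2.
have e0 : 0 < e by rewrite divr_gt0// subr_gt0.
have [_ [x Mx <-] hx] := sup_adherent e0 hs.
have [_ [y My <-] hy] := inf_adherent e0 hi.
exists x, y; split => //; move: hx hy; rewrite /e; lra.
Qed.

(** * Persistence of the component *)
Theorem proposition4p3 (R : realType) (M : set 'rV[R]_3)
    (sigma : {measure set (borel3 R) -> \bar R})
    (f H : 'rV[R]_3 -> R) (V : R -> 'rV[R]_3 -> R)
    (beta0 : R) (omega : set 'rV[R]_3) :
  smooth_sphere M ->
  is_area_measure M sigma ->
  CkM 2 M f ->
  (exists x y, [/\ M x, M y & f x <> f y]) ->
  is_laplacian M f H ->
  CkM 1 M H ->
  (forall beta, 0 < beta <= oscillation M f ->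
     obstacle_solution M sigma H beta (V beta) /\ CkM 1 M (V beta)) ->
  0 < beta0 < oscillation M f ->
  is_component (SC M beta0 (V beta0)) omega ->
  (exists c : R, forall x, boundary_in M omega x -> V beta0 x = c) ->
  exists2 delta : R, 0 < delta <= beta0 &
    forall beta, beta0 - delta < beta <= beta0 ->
      SC M beta (V beta) `&` closure omega
        = SC M beta0 (V beta0) `&` closure omega
      /\ SC M beta0 (V beta0) `&` closure omega = omega.
Proof.
move=> sph area Cf [x0 [_ [Mx0 _ _]]] lap CH sol /andP[b0 bosc] comp [c0 bdc].
have [cM reg _] := sph; have conM := smooth_sphere_connected sph.
have cH := CkM_continuous reg CH; have cf := CkM_continuous reg Cf.
have [xM [ym [MxM Mym fxy]]] := oscillation_gt cM (ex_intro _ x0 Mx0) cf bosc.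
have CV beta : 0 < beta <= beta0 -> CkM 1 M (V beta).
  move=> /andP[bp bb]; apply: (sol beta _).2.
  by rewrite bp (le_trans bb)// ltW.
have cV beta (hb : 0 < beta <= beta0) := CkM_continuous reg (CV beta hb).
have minV beta : 0 < beta <= beta0 -> exists G, minimizer M sigma H beta (V beta) G.
  move=> /andP[bp bb]; have [|[G adm min] _] := sol beta; first by rewrite bp (le_trans bb)// ltW.
  by exists G.
have bV beta : 0 < beta <= beta0 -> forall x, M x -> `|V beta x| <= beta / 2.
  move=> hb; have [G [[_ ae] _]] := minV beta hb.
  exact: (ae_le_continuous cM reg area (cV beta hb) ae).
(* No solution stays away from its upper obstacle: it would oscillate as f. *)
have contact beta e : 0 < beta <= beta0 -> 0 < e ->
    ~ (forall x, M x -> V beta x <= beta / 2 - e).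
  move=> hb e0 he; have [G min] := minV beta hb.
  have := not_in_contact cM reg area conM cH Cf lap (CV beta hb) min (bV beta hb) e0 he MxM Mym.
  have := bV beta hb xM MxM; have := bV beta hb ym Mym; rewrite !ler_norml.
  by case/andP: hb => _ bb; move=> /andP[? ?] /andP[? ?] ?; lra.
have h0 : 0 < beta0 <= beta0 by rewrite b0 lexx.
have cV0 := cV beta0 h0; have bV0 := bV beta0 h0; have [G0 min0] := minV beta0 h0.
have clM := closure_component_sub cM comp.
have oM := component_surface comp.
have oS := component_sub comp.
have SCo := SC_closure_component reg cV0 comp.
have ccl : compact (closure omega) by exact: subclosed_compact (@closed_closure _ _) cM clM.
have cl0 : closure omega !=set0.
  by have [x ox] := component_nonempty comp; exists x; exact: subset_closure.
have cVcl : {within closure omega, continuous (V beta0)}.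
  exact: continuous_subspaceW clM cV0.
have bd_abs x : boundary_in M omega x -> V beta0 x = beta0 / 2 \/ V beta0 x = - (beta0 / 2).
  move=> bx; have Mx : M x by case: bx => -[].
  have : ~ `|V beta0 x| < beta0 / 2.
    by move=> lt; exact: (boundary_not_SC reg cV0 comp bx).
  move=> /negP; rewrite -leNgt => ge; have := bV0 x Mx => le.
  have /eqP : `|V beta0 x| == beta0 / 2 by rewrite eq_le le ge.
  by case: (ler0P (V beta0 x)) => _ E; [right; rewrite -E opprK|left].
(* Otherwise V would be smaller than beta0 / 2 on all of the compact M. *)
have omega_neqM : omega <> M.
  move=> oE.
  have [z /[!inE] clz maxz] := compact_EVT_max cl0 ccl cVcl.
  have [_] : SC M beta0 (V beta0) z by apply: oS; rewrite oE; exact: clM.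
  rewrite ltr_norml => /andP[_ Vz].
  apply: (contact beta0 (beta0 / 2 - V beta0 z) h0); first by rewrite subr_gt0.
  move=> x Mx; rewrite subKr; apply: maxz; rewrite inE; apply: subset_closure.
  by rewrite oE.
have [sgn|sgn] : (forall x, boundary_in M omega x -> V beta0 x = beta0 / 2) \/
    (forall x, boundary_in M omega x -> V beta0 x = - (beta0 / 2)).
  have [[x1 bx1]|none] := pselect (exists x, boundary_in M omega x); last first.
    by left => x bx; exfalso; apply: none; exists x.
  by have [E|E] := bd_abs x1 bx1; [left|right] => x bx; rewrite bdc// -(bdc x1).
- have [z /[!inE] clz minz] := compact_EVT_min cl0 ccl cVcl.
  have Vz : - (beta0 / 2) < V beta0 z.
    have [oz|nz] := pselect (omega z).
      by have [_] := oS z oz; rewrite ltr_norml => /andP[].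
    rewrite sgn; last exact: (closure_component_boundary cM comp clz nz).
    by lra.
  have Vz2 : V beta0 z <= beta0 / 2.
    by have := bV0 z (clM z clz); rewrite ler_norml => /andP[].
  (* beta > beta0 - delta means that the minimum of V on the closure of omega,
     lowered by (beta0 - beta) / 2, is above - beta / 2. *)
  exists (V beta0 z + beta0 / 2); first by apply/andP; split; lra.
  move=> beta /andP[bl bu]; split => //; rewrite SCo.
  have hb : 0 < beta <= beta0 by apply/andP; split => //; lra.
  have [G1 min1] := minV beta hb; have bV1 := bV beta hb.
  have mz x : omega x -> V beta0 z <= V beta0 x.
    by move=> ox; apply: minz; rewrite inE; exact: subset_closure.
  have low x : M x -> V beta0 x - V beta x <= (beta0 - beta) / 2.
    move=> Mx; have := solution_comparison cM reg area conM cH (CV _ h0) (CV _ hb)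
      min0 min1 bV0 bV1 (fun e => contact beta e hb) Mx.
    by rewrite ger0_norm ?subr_ge0.
  have upp x : omega x -> V beta x - V beta0 x <= - ((beta0 - beta) / 2).
    apply: (component_comparison cM reg area conM cH cV0 comp omega_neqM (CV _ hb) (CV _ h0)
      min1 min0 bV1 bV0) => y.
    + move=> bdy; rewrite sgn//; have My : M y by case: bdy => -[].
      by have := bV1 y My; rewrite ler_norml => /andP[? ?]; lra.
    + by move=> oy; have := bV1 y (oM y oy); rewrite ler_norml => /andP[? ?]; lra.
    + by move=> oy; have := mz y oy; lra.
  apply: (SC_closure_component_eq cM comp) => x hx.
    have := upp x hx; have := low x (oM x hx); have := mz x hx.
    have [_] := oS x hx; rewrite !ltr_norml => /andP[? ?] ? ? ?.
    by apply/andP; split; lra.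
  have Mx : M x by case: hx => -[].
  by have := low x Mx; rewrite sgn// ltr_norml => ? /andP[? ?]; lra.
- have [z /[!inE] clz maxz] := compact_EVT_max cl0 ccl cVcl.
  have Vz : V beta0 z < beta0 / 2.
    have [oz|nz] := pselect (omega z).
      by have [_] := oS z oz; rewrite ltr_norml => /andP[].
    rewrite sgn; last exact: (closure_component_boundary cM comp clz nz).
    by lra.
  have Vz2 : - (beta0 / 2) <= V beta0 z.
    by have := bV0 z (clM z clz); rewrite ler_norml => /andP[].
  (* beta > beta0 - delta means that the maximum of V on the closure of omega,
     raised by (beta0 - beta) / 2, is below beta / 2. *)
  exists (beta0 / 2 - V beta0 z); first by apply/andP; split; lra.
  move=> beta /andP[bl bu]; split => //; rewrite SCo.
  have hb : 0 < beta <= beta0 by apply/andP; split => //; lra.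
  have [G1 min1] := minV beta hb; have bV1 := bV beta hb.
  have mz x : omega x -> V beta0 x <= V beta0 z.
    by move=> ox; apply: maxz; rewrite inE; exact: subset_closure.
  have upp x : M x -> V beta x - V beta0 x <= (beta0 - beta) / 2.
    move=> Mx; have := solution_comparison cM reg area conM cH (CV _ hb) (CV _ h0)
      min1 min0 bV1 bV0 (fun e => contact beta0 e h0) Mx.
    by rewrite distrC ger0_norm ?subr_ge0.
  have low x : omega x -> V beta0 x - V beta x <= - ((beta0 - beta) / 2).
    apply: (component_comparison cM reg area conM cH cV0 comp omega_neqM (CV _ h0) (CV _ hb)
      min0 min1 bV0 bV1) => y.
    + move=> bdy; rewrite sgn//; have My : M y by case: bdy => -[].
      by have := bV1 y My; rewrite ler_norml => /andP[? ?]; lra.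
    + by move=> oy; have := mz y oy; lra.
    + by move=> oy; have := bV1 y (oM y oy); rewrite ler_norml => /andP[? ?]; lra.
  apply: (SC_closure_component_eq cM comp) => x hx.
    have := low x hx; have := upp x (oM x hx); have := mz x hx.
    have [_] := oS x hx; rewrite !ltr_norml => /andP[? ?] ? ? ?.
    by apply/andP; split; lra.
  have Mx : M x by case: hx => -[].
  by have := upp x Mx; rewrite sgn// ltr_norml => ? /andP[? ?]; lra.
Qed.
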